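(* Let $\gamma$ be a simple closed, smooth, strictly convex curve in the Euclidean plane $\mathbf{R}^2$, with length $P$, enclosed area $A$, and curvature $k(x)>0$ with minimum $k_{\min}=\min_x k(x)>0$. For the billiard inside $\gamma$, let $\delta\in[0,1]$ be the proportion (with respect to the invariant measure $\mu$) of the phase space not occupied by $m$-orbits. Then $$\delta\geq \frac{\pi(P^2-4\pi A)}{4P(P+\sqrt{4\pi A})}\geq \frac{\pi(P^2-4 \pi A) }{8 P^2},$$ and also $$\delta\geq \frac{(P^2-4 \pi A)\,k_{\min} }{8 P}.$$
   Context: Billiard setup: $x$ is an arclength parameter on the closed curve $\gamma$ (so $x\in\mathbf{R}/P\mathbf{Z}$). The phase space is $\Omega=\{(x,\varphi): x\in\mathbf{R}/P\mathbf{Z},\ \varphi\in(0,\pi)\}$, where $\varphi$ is the angle between the tangent to $\gamma$ at $\gamma(x)$ and a chord leaving $\gamma(x)$ into the domain bounded by $\gamma$. The billiard map $T:\Omega\to\Omega$, $T(x,\varphi)=(y,\psi)$, sends the ray leaving $\gamma(x)$ at angle $\varphi$ to its next hit point $\gamma(y)$ and the reflected angle $\psi$ (angle of reflection equals angle of incidence). $T$ preserves the measure $d\mu=\sin\varphi\,dx\,d\varphi$, and $\mu(\Omega)=2P$. Let $L(x,y)$ be the distance between $\gamma(x)$ and $\gamma(y)$. A billiard configuration is a sequence $\{x_n\}_{n\in\mathbf{Z}}$ of points of $\gamma$ such that consecutive points are consecutive bounce points of a billiard trajectory; it is an $m$-configuration if for every $M<N$ the second variation of the functional $\sum_{n=M}^{N-1}L(x_n,x_{n+1})$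 with respect to $x_{M+1},\dots,x_{N-1}$ (endpoints $x_M,x_N$ fixed) is negative definite. The corresponding orbits of $T$ in $\Omega$ are called $m$-orbits. Let $\mathcal{M}\subseteq\Omega$ be the (closed, $T$-invariant) set of all points lying on $m$-orbits, $\Delta=\Omega\setminus\mathcal{M}$, and $\delta=\mu(\Delta)/\mu(\Omega)$. *)

(* Defs.v *)
From Stdlib Require Import Reals Lra ZArith.
Open Scope R_scope.

Definition rect_cover (E : R -> R -> Prop) (a b c d : nat -> R) : Prop :=
  (forall i, a i <= b i /\ c i <= d i) /\
  (forall x y, E x y -> exists i, a i <= x <= b i /\ c i <= y <= d i).

Definition outer_measure_is (w : R -> R -> R -> R -> R) (E : R -> R -> Prop) (m : R) : Prop :=
  (forall a b c d l, rect_cover E a b c d ->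
     infinite_sum (fun i => w (a i) (b i) (c i) (d i)) l -> m <= l) /\
  (forall m', (forall a b c d l, rect_cover E a b c d ->
     infinite_sum (fun i => w (a i) (b i) (c i) (d i)) l -> m' <= l) -> m' <= m).

Definition lebesgue_w (a b c d : R) : R := (b - a) * (d - c).

(* measure  sin(phi) dx dphi  on R x (0,pi) (density extended by 0 outside (0,pi)) *)
Definition clampPI (t : R) : R := Rmax 0 (Rmin t PI).
Definition billiard_w (a b c d : R) : R := (b - a) * (cos (clampPI c) - cos (clampPI d)).

Definition onCurve (gx gy : R -> R) (p q : R) : Prop := exists s, gx s = p /\ gy s = q.

(* Domain bounded by gamma: points off gamma whose path-component in the complement
   of gamma is bounded. *)
Definition inside (gx gy : R -> R) (p q : R) : Prop :=
  ~ onCurve gx gy p q /\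
  exists Rb, forall cx cy : R -> R,
    continuity cx -> continuity cy -> cx 0 = p -> cy 0 = q ->
    (forall t, 0 <= t <= 1 -> ~ onCurve gx gy (cx t) (cy t)) ->
    sqrt (cx 1 ^ 2 + cy 1 ^ 2) <= Rb.

(* Billiard map: T(x,phi) = (y,psi).  The curve is positively oriented, so the
   inward normal at gamma(s) is n(s) = (-ty s, tx s).  The ray leaves gamma(x) in
   direction v = cos phi t(x) + sin phi n(x), gamma(y) is its next hit point and
   the outgoing direction cos psi t(y) + sin psi n(y) is the mirror image of v in the
   tangent line at gamma(y). *)
Definition bounce (gx gy tx ty : R -> R) (x phi y psi : R) : Prop :=
  let vx := cos phi * tx x - sin phi * ty x in
  let vy := cos phi * ty x + sin phi * tx x in
  let nx := - ty y in
  let ny := tx y in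
  let dn := vx * nx + vy * ny in
  0 < phi < PI /\ 0 < psi < PI /\
  ~ (gx y = gx x /\ gy y = gy x) /\
  (exists s, 0 < s /\ gx y = gx x + s * vx /\ gy y = gy x + s * vy /\
     (forall s', 0 < s' < s -> ~ onCurve gx gy (gx x + s' * vx) (gy x + s' * vy))) /\
  cos psi * tx y + sin psi * nx = vx - 2 * dn * nx /\
  cos psi * ty y + sin psi * ny = vy - 2 * dn * ny.

Definition billiard_config (gx gy tx ty : R -> R) (xs phis : Z -> R) : Prop :=
  forall n : Z, bounce gx gy tx ty (xs n) (phis n) (xs (n + 1)%Z) (phis (n + 1)%Z).

Definition Lchord (gx gy : R -> R) (x y : R) : R :=
  sqrt ((gx x - gx y) ^ 2 + (gy x - gy y) ^ 2).

Fixpoint sumZ (M : Z) (n : nat) (f : Z -> R) : R :=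
  match n with
  | O => 0
  | S n' => f M + sumZ (M + 1)%Z n' f
  end.

Definition action (gx gy : R -> R) (M N : Z) (xs : Z -> R) : R :=
  sumZ M (Z.to_nat (N - M)) (fun n => Lchord gx gy (xs n) (xs (n + 1)%Z)).

(* m-configuration: for all M < N, the second variation of the action w.r.t.
   x_{M+1},...,x_{N-1} (endpoints fixed) is negative definite, i.e. for every
   nonzero variation xi (xi_M = xi_N = 0) the second derivative at t = 0 of
   t |-> action (x + t xi) is negative. *)
Definition m_config (gx gy : R -> R) (xs : Z -> R) : Prop :=
  forall M N : Z, (M < N)%Z ->
  forall xi : Z -> R, xi M = 0 -> xi N = 0 ->
  (exists n, (M < n < N)%Z /\ xi n <> 0) ->
  exists eps g' c, 0 < eps /\
    (forall t, Rabs t < eps ->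
       derivable_pt_lim (fun t => action gx gy M N (fun n => xs n + t * xi n)) t (g' t)) /\
    derivable_pt_lim g' 0 c /\ c < 0.

(* phase space Omega_set = (R/PZ) x (0,pi), with x represented in [0,P) *)
Definition Omega_set (P x phi : R) : Prop := 0 <= x < P /\ 0 < phi < PI.

Definition on_m_orbit (P : R) (gx gy tx ty : R -> R) (x phi : R) : Prop :=
  exists xs phis : Z -> R,
    billiard_config gx gy tx ty xs phis /\ m_config gx gy xs /\
    (exists k : Z, xs 0%Z = x + IZR k * P) /\ phis 0%Z = phi.

Definition Delta_set (P : R) (gx gy tx ty : R -> R) (x phi : R) : Prop :=
  Omega_set P x phi /\ ~ on_m_orbit P gx gy tx ty x phi.

(* signed curvature of the arclength-parametrized curve (Dx 0, Dy 0) *)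
Definition curv (Dx Dy : nat -> R -> R) (t : R) : R :=
  Dx 1%nat t * Dy 2%nat t - Dy 1%nat t * Dx 2%nat t.

(* Main.v *)
Require Import Defs.
From Stdlib Require Import Reals ZArith Lra Lia ClassicalEpsilon.
From Coquelicot Require Import Coquelicot.
Open Scope R_scope.

(** Let u = - cos phi, so that mu = ds du.  The second variation of the length functional in the
    direction xi_n = w (x_n), cut off at the ends of a long orbit segment, is negative on an
    m-orbit.  Since z^2 / L >= 2 a z - a^2 L, it bounds from below, up to a constant independent
    of the segment, a Birkhoff sum of
        H = b + b o T - a^2 L,    b = (2 a w - k w^2) sin phi.
    Birkhoff sums of H are therefore bounded on the set of m-orbits, while H <= c everywhere when
    2 (2 a w - k w^2) <= c.  As T preserves mu, the integral of H over the phase space is at most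
    c times the total mass of any cover of Delta; only finite Birkhoff sums, which are continuous,
    occur, so neither measurability nor an invariant Jacobi field enters.  By Santalo's formula
    the integral of H is pi * int (2 a w - k w^2) ds - 2 pi a^2 A, and the two bounds are the
    cases w = 1, a = sqrt (pi / A), c = 4 a and w = 1 / k, a = 1, c = 2 / kmin.

    In the coordinates (s, r) of the chord from s to s + r one has mu = sin phi sin psi / L dr ds,
    which is symmetric under reversal of the chord; this gives the invariance of mu.  Santalo's
    formula is Green's theorem for the form S d beta, where S is the area cut off by the chord
    and beta its direction. *)


(** * Continuity, integration and roots with parameters *)

(** Origin of the constants: for [w = 1] the estimate reads [m >= PI P / 2 - PI^2 / (2 a) - PI a A /
    2], which is best at [a = sqrt (PI / A)]. For [w = 1 / k] one has
    [2 a w - k w^2 = (2 a - 1) / k], so up to the common factor the loss is [a^2 / (2 a - 1)], least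
    at [a = 1]; the integral of [1 / k] is then bounded below by Cauchy-Schwarz from the total
    curvature [2 PI].

    Two global facts about the curve have to be earned. That the tangent turns exactly once is
    deduced from simplicity, by exhibiting a double point on any closed locally convex curve that
    turns more. That the path-theoretic [inside] has Green's area as outer measure is obtained by
    slicing the domain between two graphs.

    The chord coordinates degenerate at [r = 0] and [r = P], that is at [phi = 0] and [phi = PI].
    All functions are extended continuously across these edges, so that Riemann integrals of
    continuous functions suffice. *)

Lemma continuity_2d_pt_comp (f g h : R -> R -> R) (x y : R) :
  continuity_2d_pt f (g x y) (h x y) ->
  continuity_2d_pt g x y -> continuity_2d_pt h x y ->
  continuity_2d_pt (fun u v => f (g u v) (h u v)) x y.
Proof.
  intros Hf Hg Hh eps.
  destruct (Hf eps) as [d Hd].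
  destruct (Hg d) as [d1 H1]. destruct (Hh d) as [d2 H2].
  exists (mkposreal _ (Rmin_stable_in_posreal d1 d2)); simpl.
  intros u v Hu Hv. apply Hd.
  - apply H1; eapply Rlt_le_trans; eauto; apply Rmin_l.
  - apply H2; eapply Rlt_le_trans; eauto; apply Rmin_r.
Qed.

Lemma continuity_2d_pt_comp1 (f : R -> R) (g : R -> R -> R) (x y : R) :
  continuous f (g x y) -> continuity_2d_pt g x y ->
  continuity_2d_pt (fun u v => f (g u v)) x y.
Proof.
  intros Hf Hg. apply continuity_1d_2d_pt_comp; [|exact Hg].
  apply continuity_pt_filterlim; exact Hf.
Qed.

Lemma continuity_2d_pt_section_r (f : R -> R -> R) (x y : R) :
  continuity_2d_pt f x y -> continuous (f x) y.
Proof.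
  intros Hf. apply continuity_pt_filterlim, continuity_pt_locally. intros eps.
  destruct (Hf eps) as [d Hd]. exists d. intros z Hz.
  apply Hd; [|exact Hz]. rewrite Rminus_diag, Rabs_R0. apply cond_pos.
Qed.

Lemma continuity_2d_pt_section_l (f : R -> R -> R) (x y : R) :
  continuity_2d_pt f x y -> continuous (fun u => f u y) x.
Proof.
  intros Hf. apply continuity_pt_filterlim, continuity_pt_locally. intros eps.
  destruct (Hf eps) as [d Hd]. exists d. intros z Hz.
  apply Hd; [exact Hz|]. rewrite Rminus_diag, Rabs_R0. apply cond_pos.
Qed.

Lemma continuity_2d_pt_Rmin (f g : R -> R -> R) (x y : R) :
  continuity_2d_pt f x y -> continuity_2d_pt g x y ->
  continuity_2d_pt (fun u v => Rmin (f u v) (g u v)) x y.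
Proof.
  intros Hf Hg.
  apply (continuity_2d_pt_ext (fun u v => (f u v + g u v - Rabs (f u v - g u v)) * / 2)).
  - intros u v. unfold Rmin, Rabs. destruct (Rle_dec _ _), (Rcase_abs _); lra.
  - apply continuity_2d_pt_mult; [|apply continuity_2d_pt_const].
    apply continuity_2d_pt_minus; [apply continuity_2d_pt_plus; assumption|].
    apply continuity_2d_pt_comp1; [apply continuous_Rabs|apply continuity_2d_pt_minus; assumption].
Qed.

Lemma continuity_2d_pt_Rmax (f g : R -> R -> R) (x y : R) :
  continuity_2d_pt f x y -> continuity_2d_pt g x y ->
  continuity_2d_pt (fun u v => Rmax (f u v) (g u v)) x y.
Proof.
  intros Hf Hg.
  apply (continuity_2d_pt_ext (fun u v => - Rmin (- f u v) (- g u v))).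
  - intros u v. rewrite <- Ropp_Rmax. lra.
  - apply continuity_2d_pt_opp, continuity_2d_pt_Rmin; apply continuity_2d_pt_opp; assumption.
Qed.

(** Decomposes an expression along its operations; the goals left over are continuity of the opaque
    functions and nonvanishing of denominators. Specific operations are matched before the generic
    application patterns. *)
Ltac cont2 :=
  match goal with
  | |- continuity_2d_pt (fun x y => x) _ _ => apply continuity_2d_pt_id1
  | |- continuity_2d_pt (fun x y => y) _ _ => apply continuity_2d_pt_id2
  | |- continuity_2d_pt (fun x y => ?c) _ _ => apply continuity_2d_pt_const
  | |- continuity_2d_pt (fun x y => @?f x y + @?g x y) _ _ =>
      apply (continuity_2d_pt_plus f g); cont2
  | |- continuity_2d_pt (fun x y => @?f x y - @?g x y) _ _ =>
      apply (continuity_2d_pt_minus f g); cont2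
  | |- continuity_2d_pt (fun x y => @?f x y * @?g x y) _ _ =>
      apply (continuity_2d_pt_mult f g); cont2
  | |- continuity_2d_pt (fun x y => - @?f x y) _ _ =>
      apply (continuity_2d_pt_opp f); cont2
  | |- continuity_2d_pt (fun x y => @?f x y / @?g x y) _ _ =>
      apply (continuity_2d_pt_mult f (fun x y => / g x y)); cont2
  | |- continuity_2d_pt (fun x y => / @?g x y) _ _ =>
      apply (continuity_2d_pt_inv g); [cont2|]
  | |- continuity_2d_pt (fun x y => @?f x y ^ 2) _ _ =>
      apply (continuity_2d_pt_ext (fun x y => f x y * f x y)); [intros; simpl; ring|];
      apply (continuity_2d_pt_mult f f); cont2
  | |- continuity_2d_pt (fun x y => @?f x y ^ 3) _ _ =>
      apply (continuity_2d_pt_ext (fun x y => f x y * (f x y * f x y))); [intros; simpl; ring|];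
      apply (continuity_2d_pt_mult f (fun x y => f x y * f x y)); cont2
  | |- continuity_2d_pt (fun x y => Rmin (@?f x y) (@?g x y)) _ _ =>
      apply (continuity_2d_pt_Rmin f g); cont2
  | |- continuity_2d_pt (fun x y => Rmax (@?f x y) (@?g x y)) _ _ =>
      apply (continuity_2d_pt_Rmax f g); cont2
  | |- continuity_2d_pt (fun x y => sqrt (@?f x y)) _ _ =>
      apply (continuity_2d_pt_comp1 sqrt f); [apply continuous_sqrt|cont2]
  | |- continuity_2d_pt (fun x y => ?h (@?f x y)) _ _ =>
      apply (continuity_2d_pt_comp1 h f); [|cont2]
  | |- continuity_2d_pt (fun x y => ?h (@?f x y) (@?g x y)) _ _ =>
      apply (continuity_2d_pt_comp h f g); [|cont2|cont2]
  | |- _ => idtac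
  end.

Ltac cont1 :=
  match goal with |- continuous ?f ?x =>
    apply (continuity_2d_pt_section_l (fun u _ => f u) x 0); cbv beta; cont2 end.

(** Retraction of the line onto an interval: composing with it turns continuity on the interval into
    continuity everywhere, and it makes implicitly defined functions total. *)
Definition clamp (a b x : R) : R := Rmax a (Rmin x b).

Ltac clamp_cases := intros; unfold clamp, Rmax, Rmin; repeat destruct (Rle_dec _ _); lra.

Lemma clamp_in (a b x : R) : a <= b -> a <= clamp a b x <= b.
Proof. clamp_cases. Qed.

Lemma clamp_id (a b x : R) : a <= x <= b -> clamp a b x = x.
Proof. clamp_cases. Qed.

Lemma clamp_lo (a b x : R) : a <= b -> x <= a -> clamp a b x = a.
Proof. clamp_cases. Qed.

Lemma clamp_hi (a b x : R) : a <= b -> b <= x -> clamp a b x = b.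
Proof. clamp_cases. Qed.

Lemma clamp_continuous (a b x : R) : continuous (clamp a b) x.
Proof. unfold clamp. cont1. Qed.

(* [RInt] with its codomain fixed to the type [R], so that [ring] and [lra] see real equations. *)
Definition int (f : R -> R) (a b : R) : R := RInt f a b.

Lemma int_refl (f : R -> R) (a : R) : int f a a = 0.
Proof. exact (RInt_point a f). Qed.

Lemma int_const (a b c : R) : int (fun _ => c) a b = (b - a) * c.
Proof. exact (RInt_const a b c). Qed.

Lemma int_plus (f g : R -> R) (a b : R) :
  ex_RInt f a b -> ex_RInt g a b ->
  int (fun x => f x + g x) a b = int f a b + int g a b.
Proof. exact (RInt_plus f g a b). Qed.

Lemma int_minus (f g : R -> R) (a b : R) :
  ex_RInt f a b -> ex_RInt g a b ->
  int (fun x => f x - g x) a b = int f a b - int g a b.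
Proof. exact (RInt_minus f g a b). Qed.

Lemma int_scal (f : R -> R) (a b l : R) :
  ex_RInt f a b -> int (fun x => l * f x) a b = l * int f a b.
Proof. exact (RInt_scal f a b l). Qed.

Lemma int_Chasles (f : R -> R) (a b c : R) :
  ex_RInt f a b -> ex_RInt f b c -> int f a c = int f a b + int f b c.
Proof. intros H1 H2. symmetry. exact (RInt_Chasles f a b c H1 H2). Qed.

Lemma int_swap (f : R -> R) (a b : R) : ex_RInt f a b -> int f b a = - int f a b.
Proof. intros H. symmetry. exact (opp_RInt_swap f a b H). Qed.

Lemma int_ext (f g : R -> R) (a b : R) :
  a <= b -> (forall x, a < x < b -> f x = g x) -> int f a b = int g a b.
Proof.
  intros Hab H. apply (RInt_ext (V := R_CompleteNormedModule)).
  intros x. rewrite Rmin_left, Rmax_right by assumption. apply H.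
Qed.

Lemma int_le (f g : R -> R) (a b : R) :
  a <= b -> ex_RInt f a b -> ex_RInt g a b ->
  (forall x, a < x < b -> f x <= g x) -> int f a b <= int g a b.
Proof. exact (RInt_le f g a b). Qed.

Lemma ex_int_cont (f : R -> R) (a b : R) :
  (forall x, continuous f x) -> ex_RInt f a b.
Proof. intros Hf. apply (ex_RInt_continuous (V := R_CompleteNormedModule)). auto. Qed.

Lemma ex_int_cont_on (f : R -> R) (a b : R) :
  (forall x, a <= x <= b -> continuous f x) -> a <= b -> ex_RInt f a b.
Proof.
  intros Hf Hab. apply (ex_RInt_continuous (V := R_CompleteNormedModule)). intros z Hz.
  rewrite Rmin_left, Rmax_right in Hz by assumption. auto.
Qed.

Lemma ex_int_const (a b c : R) : ex_RInt (fun _ => c) a b.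
Proof. apply ex_int_cont. intros. apply continuous_const. Qed.

Lemma int_is_derive (f : R -> R) (a x : R) :
  (forall t, continuous f t) -> is_derive (int f a) x (f x).
Proof.
  intros Hf. apply (is_derive_RInt f _ a x); [|apply Hf].
  apply filter_forall. intros t.
  apply (RInt_correct (V := R_CompleteNormedModule)), ex_int_cont. auto.
Qed.

Lemma is_derive_continuous {f : R -> R} {x l : R} : is_derive f x l -> continuous f x.
Proof.
  intros H. apply (@ex_derive_continuous R_AbsRing R_NormedModule). exists l. exact H.
Qed.

Lemma mean_value (f df : R -> R) (a b : R) :
  (forall x, is_derive f x (df x)) ->
  exists c, Rmin a b <= c <= Rmax a b /\ f b - f a = df c * (b - a).
Proof.
  intros D. apply MVT_gen; [auto|]. intros x _.
  apply continuity_pt_filterlim, (is_derive_continuous (D x)).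
Qed.

Lemma intermediate_value (f : R -> R) (a b y : R) :
  (forall x, continuous f x) -> a <= b -> f a <= y <= f b \/ f b <= y <= f a ->
  exists c, a <= c <= b /\ f c = y.
Proof.
  intros C Hab Hy. destruct (IVT_gen_consistent f a b y C) as [c [Hc E]].
  - unfold Rmin, Rmax. destruct (Rle_dec (f a) (f b)); lra.
  - rewrite Rmin_left, Rmax_right in Hc by exact Hab. eauto.
Qed.

Definition choose {Q : R -> Prop} (E : exists x, Q x) : R :=
  proj1_sig (constructive_indefinite_description Q E).

Lemma choose_spec {Q : R -> Prop} (E : exists x, Q x) : Q (choose E).
Proof. exact (proj2_sig (constructive_indefinite_description Q E)). Qed.

Lemma is_derive_sub (f g : R -> R) (x a b : R) :
  is_derive f x a -> is_derive g x b -> is_derive (fun t => f t - g t) x (a - b).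
Proof. intros Hf Hg. exact (is_derive_minus f g x a b Hf Hg). Qed.

Lemma is_derive_eq (f : R -> R) (x l l' : R) : is_derive f x l -> l = l' -> is_derive f x l'.
Proof. intros H <-. exact H. Qed.

Lemma eq_of_derive_zero (f g df : R -> R) (a b : R) :
  a <= b ->
  (forall x, a < x < b -> is_derive f x (df x)) ->
  (forall x, a < x < b -> is_derive g x (df x)) ->
  (forall x, a <= x <= b -> continuous f x) ->
  (forall x, a <= x <= b -> continuous g x) ->
  f b - f a = g b - g a.
Proof.
  intros Hab Hf Hg Cf Cg.
  destruct (MVT_gen (fun x => f x - g x) a b (fun _ => 0)) as [c [_ Hc]].
  - intros x Hx. rewrite Rmin_left, Rmax_right in Hx by assumption.
    replace 0 with (minus (df x) (df x)) by (unfold minus, plus, opp; simpl; ring).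
    apply (is_derive_minus f g); auto.
  - intros x Hx. rewrite Rmin_left, Rmax_right in Hx by assumption.
    apply continuity_pt_filterlim. apply (continuous_minus f g); auto.
  - lra.
Qed.

(** The derivative is required only inside the interval, which suits [slope], differentiated for
    [0 < r < P]. Clamping the argument of [df] gives an integrand continuous on the line, whose
    primitive has the same derivative as [f] inside. *)
Lemma int_derive_open (f df : R -> R) (a b : R) :
  a <= b ->
  (forall x, a < x < b -> is_derive f x (df x)) ->
  (forall x, a <= x <= b -> continuous f x) ->
  (forall x, a <= x <= b -> continuous df x) ->
  int df a b = f b - f a.
Proof.
  intros Hab Hf Cf Cdf.
  set (dg := fun x => df (clamp a b x)).
  assert (Cdg : forall t, continuous dg t).
  { intros t. apply (continuous_comp (clamp a b) df); [apply clamp_continuous|].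
    apply Cdf, clamp_in, Hab. }
  assert (E : int df a b = int dg a b).
  { apply int_ext; [assumption|]. intros x Hx.
    unfold dg. rewrite clamp_id; [reflexivity|lra]. }
  rewrite E.
  rewrite (eq_of_derive_zero f (fun t => int dg a t) df a b); auto.
  - rewrite int_refl. ring.
  - intros x Hx. replace (df x) with (dg x) by (unfold dg; rewrite clamp_id; [reflexivity|lra]).
    apply int_is_derive, Cdg.
  - intros x Hx. apply (is_derive_continuous (l := dg x)), int_is_derive, Cdg.
Qed.

Lemma continuous_int_param (f : R -> R -> R) (c d x : R) :
  c <= d -> (forall x y, continuity_2d_pt f x y) ->
  continuous (fun x => int (f x) c d) x.
Proof.
  intros Hcd Hf.
  assert (Ex : forall x, ex_RInt (f x) c d).
  { intros u. apply ex_int_cont_on; [|exact Hcd]. intros; apply continuity_2d_pt_section_r, Hf. }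
  apply continuity_pt_filterlim, continuity_pt_locally. intros eps.
  assert (He : 0 < eps / (d - c + 1)) by (apply Rdiv_lt_0_compat; [apply cond_pos|lra]).
  destruct (uniform_continuity_2d_1d' f c d x (fun y _ => Hf x y) (mkposreal _ He)) as [dl Hdl].
  exists dl. intros y Hy. change (Rabs (y - x) < dl) in Hy. simpl in Hdl.
  assert (E : int (f y) c d - int (f x) c d = int (fun t => f y t - f x t) c d).
  { symmetry. apply (int_minus (f y) (f x) c d); auto. }
  rewrite E.
  apply Rle_lt_trans with ((d - c) * (eps / (d - c + 1))).
  - apply abs_RInt_le_const; [exact Hcd| |].
    + apply (ex_RInt_minus (f y) (f x)); auto.
    + intros t Ht. apply Rabs_def2 in Hy. left.
      apply Hdl; try lra. rewrite Rminus_diag, Rabs_R0. apply cond_pos.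
  - apply Rlt_le_trans with ((d - c + 1) * (eps / (d - c + 1))).
    + apply Rmult_lt_compat_r; [exact He|lra].
    + right. field. lra.
Qed.

Ltac ex_int := apply ex_int_cont; intros; cont1; auto.

Lemma ex_int_section (f : R -> R -> R) (x a b : R) :
  (forall x y, continuity_2d_pt f x y) -> ex_RInt (f x) a b.
Proof. intros Cf. apply ex_int_cont. intros y. apply continuity_2d_pt_section_r, Cf. Qed.

Lemma ex_int_row (f : R -> R -> R) (a b c d : R) :
  (forall x y, continuity_2d_pt f x y) -> c <= d -> ex_RInt (fun x => int (f x) c d) a b.
Proof. intros Cf Hcd. apply ex_int_cont. intros x. apply continuous_int_param; assumption. Qed.

(** Both iterated integrals vanish for [b = a] and have the same derivative in [b], by
    differentiation under the integral sign. *)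
Lemma Fubini_plane (f : R -> R -> R) (a b c d : R) :
  a <= b -> c <= d -> (forall x y, continuity_2d_pt f x y) ->
  int (fun x => int (f x) c d) a b = int (fun y => int (fun x => f x y) a b) c d.
Proof.
  intros Hab Hcd Hf.
  assert (Cr : forall x y, continuous (f x) y) by (intros; apply continuity_2d_pt_section_r, Hf).
  assert (Cl : forall x y, continuous (fun x => f x y) x) by (intros; apply (continuity_2d_pt_section_l f), Hf).
  assert (D : forall t, is_derive (fun t => int (fun y => int (fun x => f x y) a t) c d) t
     (int (f t) c d)).
  { intros t.
    assert (E : int (f t) c d =
      int (fun y => Derive (fun z => int (fun x => f x y) a z) t) c d).
    { apply int_ext; [assumption|]. intros y _. symmetry.
      apply is_derive_unique, (int_is_derive (fun x => f x y)). auto. }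
    rewrite E. apply (is_derive_RInt_param (fun z y => int (fun x => f x y) a z)).
    - apply filter_forall. intros z y _. exists (f z y). apply (int_is_derive (fun x => f x y)); auto.
    - intros y _. apply (continuity_2d_pt_ext f); [|apply Hf].
      intros u v. symmetry. apply is_derive_unique, (int_is_derive (fun x => f x v)); auto.
    - apply filter_forall. intros z. apply ex_int_cont_on; [|exact Hcd]. intros y _.
      (* The parametric lemma needs ordered bounds, so for [z < a] the inner integral is
         reversed. *)
      destruct (Rle_dec a z).
      + apply (continuous_int_param (fun y x => f x y)); [assumption|].
        intros u v. apply (continuity_2d_pt_comp f (fun _ v => v) (fun u _ => u)); [apply Hf|cont2|cont2].
      + apply continuous_ext with (fun y => - int (fun x => f x y) z a).
        * intros v. symmetry. apply int_swap, ex_int_cont. auto.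
        * apply (continuous_opp (fun y => int (fun x => f x y) z a)).
          apply (continuous_int_param (fun y x => f x y)); [lra|].
          intros u v'. apply (continuity_2d_pt_comp f (fun _ v => v) (fun u _ => u)); [apply Hf|cont2|cont2]. }
  rewrite (int_derive_open (fun t => int (fun y => int (fun x => f x y) a t) c d)
     (fun x => int (f x) c d) a b); auto.
  - rewrite (int_ext (fun y => int (fun x => f x y) a a) (fun _ => 0)).
    + rewrite int_const. ring.
    + assumption.
    + intros y _. apply int_refl.
  - intros x _. apply (is_derive_continuous (D x)).
  - intros x _. apply continuous_int_param; auto.
Qed.

Lemma clamp_rectangle_continuity (f : R -> R -> R) (a b c d : R) :
  a <= b -> c <= d ->
  (forall x y, a <= x <= b -> c <= y <= d -> continuity_2d_pt f x y) ->
  forall x y, continuity_2d_pt (fun x y => f (clamp a b x) (clamp c d y)) x y.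
Proof.
  intros Hab Hcd Hf x y.
  apply (continuity_2d_pt_comp f (fun x _ => clamp a b x) (fun _ y => clamp c d y)).
  - apply Hf; apply clamp_in; assumption.
  - cont2. apply clamp_continuous.
  - cont2. apply clamp_continuous.
Qed.

Lemma int_clamp2 (f : R -> R -> R) (a b c d : R) :
  a <= b -> c <= d ->
  int (fun x => int (f x) c d) a b =
  int (fun x => int (fun y => f (clamp a b x) (clamp c d y)) c d) a b.
Proof.
  intros Hab Hcd. apply int_ext; [assumption|]. intros x Hx.
  apply int_ext; [assumption|]. intros y Hy.
  rewrite !clamp_id; [reflexivity|lra|lra].
Qed.

Lemma Fubini (f : R -> R -> R) (a b c d : R) :
  a <= b -> c <= d ->
  (forall x y, a <= x <= b -> c <= y <= d -> continuity_2d_pt f x y) ->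
  int (fun x => int (f x) c d) a b = int (fun y => int (fun x => f x y) a b) c d.
Proof.
  intros Hab Hcd Hf.
  rewrite int_clamp2 by assumption.
  rewrite (Fubini_plane (fun x y => f (clamp a b x) (clamp c d y)) a b c d); auto.
  - symmetry. apply (int_clamp2 (fun y x => f x y)); assumption.
  - apply clamp_rectangle_continuity; assumption.
Qed.

(** A root that separates the signs of [F q] moves continuously with [q]: the strict signs at
    [rho p - eps / 2] and [rho p + eps / 2] persist nearby. The parameter may lie in any uniform
    space, so one argument serves the inverse of the tangent angle, the next bounce point and the
    boundary graphs. *)
Lemma continuous_root {T : UniformSpace} (rho : T -> R) (F : T -> R -> R) (a b : R) (p : T) :
  locally p (fun q => a <= rho q <= b /\ forall r, a <= r <= b ->
     (r < rho q -> F q r < 0) /\ (rho q < r -> 0 < F q r)) ->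
  (forall r, continuous (fun q => F q r) p) ->
  continuous rho p.
Proof.
  intros Hl Cf.
  pose proof (locally_singleton _ _ Hl) as [Hp Hs].
  apply filterlim_locally. intros eps.
  assert (He := cond_pos eps).
  assert (L1 : locally p (fun q => a <= rho q <= b -> 
     (forall r, a <= r <= b -> (r < rho q -> F q r < 0) /\ (rho q < r -> 0 < F q r)) -> rho p - eps < rho q)).
  { destruct (Rle_dec a (rho p - eps / 2)) as [h|h].
    - destruct (Hs (rho p - eps / 2)) as [Hn _]; [lra|].
      assert (Hneg : F p (rho p - eps / 2) < 0) by (apply Hn; lra).
      generalize (Cf (rho p - eps / 2)). intros C.
      assert (Lq : locally p (fun q => F q (rho p - eps / 2) < 0)).
      { apply (C (fun z => z < 0)). apply open_lt. exact Hneg. }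
      revert Lq. apply filter_imp. intros q Hq Hq1 Hq2.
      destruct (Rlt_dec (rho q) (rho p - eps / 2)) as [h1|h1]; [|lra].
      destruct (Hq2 (rho p - eps / 2)) as [_ h2]; [lra|]. specialize (h2 h1). lra.
    - apply filter_forall. intros q Hq _. lra. }
  assert (L2 : locally p (fun q => a <= rho q <= b -> 
     (forall r, a <= r <= b -> (r < rho q -> F q r < 0) /\ (rho q < r -> 0 < F q r)) -> rho q < rho p + eps)).
  { destruct (Rle_dec (rho p + eps / 2) b) as [h|h].
    - destruct (Hs (rho p + eps / 2)) as [_ Hn]; [lra|].
      assert (Hneg : 0 < F p (rho p + eps / 2)) by (apply Hn; lra).
      generalize (Cf (rho p + eps / 2)). intros C.
      assert (Lq : locally p (fun q => 0 < F q (rho p + eps / 2))).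
      { apply (C (fun z => 0 < z)). apply open_gt. exact Hneg. }
      revert Lq. apply filter_imp. intros q Hq Hq1 Hq2.
      destruct (Rlt_dec (rho p + eps / 2) (rho q)) as [h1|h1]; [|lra].
      destruct (Hq2 (rho p + eps / 2)) as [h2 _]; [lra|]. specialize (h2 h1). lra.
    - apply filter_forall. intros q Hq _. lra. }
  generalize (filter_and _ _ Hl (filter_and _ _ L1 L2)). apply filter_imp.
  intros q [[Q1 Q2] [Q3 Q4]]. specialize (Q3 Q1 Q2). specialize (Q4 Q1 Q2).
  change (Rabs (rho q - rho p) < eps). apply Rabs_def1; lra.
Qed.

Lemma ex_int_param (f : R -> R -> R) (a b c d : R) :
  a <= b -> c <= d ->
  (forall x y, a <= x <= b -> c <= y <= d -> continuity_2d_pt f x y) ->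
  ex_RInt (fun x => int (f x) c d) a b.
Proof.
  intros Hab Hcd Hf.
  apply (ex_RInt_ext (V := R_NormedModule) (fun x => int (fun y => f (clamp a b x) (clamp c d y)) c d)).
  - intros x. rewrite Rmin_left, Rmax_right by assumption. intros Hx. apply int_ext; [exact Hcd|].
    intros y Hy. rewrite !clamp_id; [reflexivity|lra|lra].
  - apply ex_int_cont. intros x. apply continuous_int_param; [exact Hcd|].
    apply clamp_rectangle_continuity; assumption.
Qed.

Lemma eq_of_small_difference (x y K d : R) :
  0 < d -> (forall e, 0 < e < d -> Rabs (x - y) <= K * e) -> x = y.
Proof.
  intros Hd Hs. apply Rminus_diag_uniq.
  destruct (Req_dec (x - y) 0) as [e|n]; [exact e|]. exfalso.
  apply Rabs_pos_lt in n. set (a := Rabs (x - y)) in *.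
  set (K' := Rabs K + 1).
  assert (HK : 0 < K' /\ K <= K') by (unfold K'; generalize (Rabs_pos K) (Rle_abs K); lra).
  set (e := Rmin (d / 2) (a / (2 * K'))).
  assert (He : 0 < e) by (apply Rmin_glb_lt; [lra|apply Rdiv_lt_0_compat; lra]).
  assert (E1 : e <= d / 2) by apply Rmin_l. assert (E2 : e <= a / (2 * K')) by apply Rmin_r.
  specialize (Hs e ltac:(lra)). apply Rle_div_r in E2; [|lra]. nra.
Qed.

(** * Integrals bounded by covers *)

(** A continuous majorant of the indicator of [[a, b]]: 1 up to distance [eta], 0 from distance
    [2 eta] on. Products of two of them replace indicators of rectangles. *)
Definition trapezoid (a b eta x : R) : R :=
  Rmax 0 (Rmin 1 (Rmin ((x - a) / eta + 2) ((b - x) / eta + 2))).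

Lemma trapezoid_continuous (a b eta x : R) : continuous (trapezoid a b eta) x.
Proof. unfold trapezoid, Rdiv. cont1. Qed.

Lemma trapezoid_bounds (a b eta x : R) : 0 <= trapezoid a b eta x <= 1.
Proof.
  unfold trapezoid. split; [apply Rmax_l|].
  apply Rmax_lub; [lra|apply Rmin_l].
Qed.

Lemma trapezoid_one (a b eta x : R) :
  0 < eta -> a - eta <= x <= b + eta -> trapezoid a b eta x = 1.
Proof.
  intros He Hx. unfold trapezoid.
  assert (1 <= (x - a) / eta + 2).
  { assert (-1 <= (x - a) / eta) by (apply Rle_div_r; lra). lra. }
  assert (1 <= (b - x) / eta + 2).
  { assert (-1 <= (b - x) / eta) by (apply Rle_div_r; lra). lra. }
  rewrite (Rmin_left 1); [apply Rmax_right; lra|]. apply Rmin_glb; assumption.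
Qed.

Lemma trapezoid_zero (a b eta x : R) :
  0 < eta -> x <= a - 2 * eta \/ b + 2 * eta <= x -> trapezoid a b eta x = 0.
Proof.
  intros He Hx. unfold trapezoid. apply Rmax_left.
  eapply Rle_trans; [apply Rmin_r|]. destruct Hx as [Hx|Hx].
  - eapply Rle_trans; [apply Rmin_l|].
    assert ((x - a) / eta <= -2) by (apply Rle_div_l; lra). lra.
  - eapply Rle_trans; [apply Rmin_r|].
    assert ((b - x) / eta <= -2) by (apply Rle_div_l; lra). lra.
Qed.

Lemma int_trapezoid_le (a b eta A B : R) :
  0 < eta -> a <= b -> A <= B -> int (trapezoid a b eta) A B <= b - a + 4 * eta.
Proof.
  intros He Hab HAB.
  set (p := a - 2 * eta). set (q := b + 2 * eta).
  assert (Ex : forall x y, ex_RInt (trapezoid a b eta) x y)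
    by (intros; apply ex_int_cont; intros; apply trapezoid_continuous).
  assert (Pos : forall x y, x <= y -> 0 <= int (trapezoid a b eta) x y).
  { intros x y Hxy. apply (RInt_ge_0 (trapezoid a b eta)); auto. intros; apply trapezoid_bounds. }
  assert (Z : forall x y, x <= y -> y <= p \/ q <= x -> int (trapezoid a b eta) x y = 0).
  { intros x y Hxy Ho. rewrite (int_ext _ (fun _ => 0)); [|exact Hxy|].
    - rewrite int_const. ring.
    - intros z Hz. apply trapezoid_zero; [exact He|]. unfold p, q in Ho. lra. }
  set (A' := Rmin A p). set (B' := Rmax B q).
  assert (HA : A' <= A /\ A' <= p) by (split; [apply Rmin_l|apply Rmin_r]).
  assert (HB : B <= B' /\ q <= B') by (split; [apply Rmax_l|apply Rmax_r]).
  apply Rle_trans with (int (trapezoid a b eta) A' B').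
  - rewrite (int_Chasles _ A' A B') by auto. rewrite (int_Chasles _ A B B') by auto.
    generalize (Pos A' A) (Pos B B'). lra.
  - rewrite (int_Chasles _ A' p B') by auto. rewrite (int_Chasles _ p q B') by auto.
    rewrite (Z A' p) by lra. rewrite (Z q B') by lra.
    apply Rle_trans with (0 + (int (fun _ => 1) p q + 0)).
    + apply Rplus_le_compat_l, Rplus_le_compat_r, int_le; auto.
      * unfold p, q; lra.
      * apply ex_int_const.
      * intros; apply trapezoid_bounds.
    + rewrite int_const. unfold p, q. lra.
Qed.

Lemma sum_continuous (f : nat -> R -> R) (N : nat) (x : R) :
  (forall i, continuous (f i) x) -> continuous (fun x => sum_f_R0 (fun i => f i x) N) x.
Proof.
  intros Hf. induction N as [|N IH]; simpl; [apply Hf|].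
  apply (continuous_plus (fun x => sum_f_R0 (fun i => f i x) N) (f (S N))); auto.
Qed.

Lemma int_sum (f : nat -> R -> R) (N : nat) (a b : R) :
  (forall i x, continuous (f i) x) ->
  int (fun x => sum_f_R0 (fun i => f i x) N) a b = sum_f_R0 (fun i => int (f i) a b) N.
Proof.
  intros Hf. induction N as [|N IH]; simpl; [reflexivity|].
  rewrite <- IH. apply (int_plus (fun x => sum_f_R0 (fun i => f i x) N) (f (S N))).
  - apply ex_int_cont. intros x. apply sum_continuous. auto.
  - apply ex_int_cont. auto.
Qed.

Lemma sum_half_pow (N : nat) : sum_f_R0 (fun i => (1/2) ^ (S i)) N <= 1.
Proof.
  assert (E : sum_f_R0 (fun i => (1/2) ^ (S i)) N = 1 - (1/2) ^ (S N)).
  { induction N as [|N IH]; [simpl; lra|]. rewrite tech5, IH. simpl. lra. }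
  rewrite E. assert (0 < (1/2) ^ (S N)) by (apply pow_lt; lra). lra.
Qed.

Lemma sum_term_le (f : nat -> R) (N i : nat) :
  (forall j, 0 <= f j) -> (i <= N)%nat -> f i <= sum_f_R0 f N.
Proof.
  intros Hf Hi. induction N as [|N IH].
  - replace i with 0%nat by lia. simpl; lra.
  - simpl. destruct (Nat.eq_dec i (S N)) as [->|n].
    + assert (0 <= sum_f_R0 f N) by (apply cond_pos_sum; auto). lra.
    + assert (f i <= sum_f_R0 f N) by (apply IH; lia). specialize (Hf (S N)). lra.
Qed.

(* Compactness: choosing the gauge at a covered point below [1/(i+1)], with [i] the index of a
   rectangle through it, bounds the indices that occur. *)
Lemma finite_subcover (g : R -> R -> R) (A B C D eps : R) (a b u v eta : nat -> R) :
  0 < eps ->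
  (forall x y, continuity_2d_pt g x y) ->
  (forall i, 0 < eta i) ->
  (forall x y, A <= x <= B -> C <= y <= D -> 0 < g x y ->
     exists i, a i <= x <= b i /\ u i <= y <= v i) ->
  exists N : nat, forall x y, A <= x <= B -> C <= y <= D -> g x y <= eps \/
    exists i, (i <= N)%nat /\ a i - eta i <= x <= b i + eta i /\ u i - eta i <= y <= v i + eta i.
Proof.
  intros He Cg Heta Hcov.
  assert (Ch : forall x y, exists d : posreal, A <= x <= B -> C <= y <= D ->
    (g x y <= 0 /\ forall x' y', Rabs (x' - x) < d -> Rabs (y' - y) < d -> g x' y' < eps) \/
    exists i, a i <= x <= b i /\ u i <= y <= v i /\ d <= eta i /\ d <= / (INR i + 1)).
  { intros x y.
    destruct (Rle_dec (g x y) 0) as [Hg|Hg].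
    - destruct (Cg x y (mkposreal _ He)) as [d Hd]. exists d. intros _ _. left. split; [exact Hg|].
      intros x' y' Hx Hy. specialize (Hd x' y' Hx Hy). apply Rabs_def2 in Hd. simpl in Hd. lra.
    - destruct (excluded_middle_informative (A <= x <= B /\ C <= y <= D)) as [[Hx Hy]|Hn].
      + destruct (Hcov x y Hx Hy) as [i [Hi1 Hi2]]; [lra|].
        assert (Hi : 0 < / (INR i + 1)) by (apply Rinv_0_lt_compat; generalize (pos_INR i); lra).
        exists (mkposreal _ (Rmin_stable_in_posreal (mkposreal _ (Heta i)) (mkposreal _ Hi))); simpl.
        intros _ _. right. exists i. repeat split; try lra; [apply Rmin_l|apply Rmin_r].
      + exists (mkposreal 1 Rlt_0_1). tauto. }
  set (delta := fun x y => proj1_sig (constructive_indefinite_description _ (Ch x y))).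
  assert (Hdelta := fun x y => proj2_sig (constructive_indefinite_description _ (Ch x y))).
  fold delta in Hdelta.
  destruct (compactness_value_2d A B C D delta) as [d Hd].
  destruct (archimed (/ d)) as [Har _].
  exists (Z.to_nat (up (/ d))). intros x y Hx Hy.
  destruct (NNPP _ (Hd x y Hx Hy)) as (s & t & Hs & Ht & H1 & H2 & H3).
  destruct (Hdelta s t Hs Ht) as [[_ Hg]|(i & I1 & I2 & I3 & I4)].
  - left. left. apply Hg; assumption.
  - right. exists i. change (proj1_sig (constructive_indefinite_description _ (Ch s t))) with (delta s t) in *.
    apply Rabs_def2 in H1. apply Rabs_def2 in H2. repeat split; try lra.
    assert (Hdi : d <= / (INR i + 1)) by lra.
    assert (Hp := pos_INR i). assert (Hdp := cond_pos d).
    assert (INR i + 1 <= / d).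
    { rewrite <- (Rinv_inv (INR i + 1)). apply Rinv_le_contravar; assumption. }
    apply Nat2Z.inj_le. rewrite Z2Nat.id.
    + apply le_IZR. rewrite <- INR_IZR_INZ. lra.
    + apply le_IZR. lra.
Qed.

(** This stands in for measure theory. By compactness finitely many slightly enlarged rectangles
    cover the points with [g > eps], so [g] is at most [eps] plus [c] times a finite sum of products
    of trapezoids, and this majorant is integrated term by term. *)
Lemma cover_bound (g : R -> R -> R) (A B C D c l : R) (a b u v : nat -> R) :
  A <= B -> C <= D -> 0 <= c ->
  (forall x y, continuity_2d_pt g x y) ->
  (forall x y, A <= x <= B -> C <= y <= D -> g x y <= c) ->
  (forall i, a i <= b i /\ u i <= v i) ->
  (forall x y, A <= x <= B -> C <= y <= D -> 0 < g x y ->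
     exists i, a i <= x <= b i /\ u i <= y <= v i) ->
  infinite_sum (fun i => (b i - a i) * (v i - u i)) l ->
  int (fun x => int (g x) C D) A B <= c * l.
Proof.
  intros HAB HCD Hc Cg Hgc Hord Hcov Hsum.
  apply le_epsilon. intros e0 He0.
  (* The losses are [eps] times the area of the big rectangle and [c eps] from enlarging the cover;
     the extra 1 keeps [M] positive. *)
  set (M := (B - A) * (D - C) + c + 1).
  assert (HM : 0 < M) by (unfold M; assert (0 <= (B - A) * (D - C)) by (apply Rmult_le_pos; lra); lra).
  set (eps := e0 / M). assert (He : 0 < eps) by (apply Rdiv_lt_0_compat; assumption).
  (* Widening both sides of rectangle [i] by [4 eta] adds at most [4 eta] times the sum of its sides
     plus 4, once [eta <= 1]; this choice makes the gain at most [eps / 2^(i+1)]. *)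
  set (eta := fun i => Rmin 1 (eps * (1/2) ^ (S i) / (4 * ((b i - a i) + (v i - u i) + 4)))).
  assert (Heta : forall i, 0 < eta i).
  { intros i. destruct (Hord i). apply Rmin_glb_lt; [lra|].
    apply Rdiv_lt_0_compat; [|lra]. apply Rmult_lt_0_compat; [exact He|apply pow_lt; lra]. }
  destruct (finite_subcover g A B C D eps a b u v eta He Cg Heta Hcov) as [N HN].
  set (p := fun i => trapezoid (a i) (b i) (eta i)).
  set (q := fun i => trapezoid (u i) (v i) (eta i)).
  set (h := fun x y => eps + c * sum_f_R0 (fun i => p i x * q i y) N).
  assert (Cp : forall i x, continuous (p i) x) by (intros; apply trapezoid_continuous).
  assert (Cq : forall i x, continuous (q i) x) by (intros; apply trapezoid_continuous).
  assert (Cs : forall x y, continuous (fun y => sum_f_R0 (fun i => p i x * q i y) N) y).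
  { intros x y. apply (sum_continuous (fun i y => p i x * q i y)). intros i. cont1. apply Cq. }
  assert (Csc : forall x y, continuous (fun y => c * sum_f_R0 (fun i => p i x * q i y) N) y).
  { intros x y. apply (continuous_mult (fun _ => c)); [apply continuous_const|apply Cs]. }
  assert (Ch : forall x y, continuous (h x) y).
  { intros x y. apply (continuous_plus (fun _ => eps)); [apply continuous_const|apply Csc]. }
  assert (Ih : forall x, int (h x) C D = (D - C) * eps + c * sum_f_R0 (fun i => p i x * int (q i) C D) N).
  { intros x. unfold h. rewrite int_plus, int_const, int_scal.
    - rewrite (int_sum (fun i y => p i x * q i y)) by (intros; cont1; apply Cq).
      f_equal. f_equal. apply sum_eq. intros i _. apply int_scal, ex_int_cont, Cq.
    - apply ex_int_cont, Cs.
    - apply ex_int_const.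
    - apply ex_int_cont, Csc. }
  assert (Cih : forall x, continuous (fun x => sum_f_R0 (fun i => p i x * int (q i) C D) N) x).
  { intros x. apply (sum_continuous (fun i x => p i x * int (q i) C D)). intros i. cont1. apply Cp. }
  assert (Cihc : forall x, continuous (fun x => c * sum_f_R0 (fun i => p i x * int (q i) C D) N) x).
  { intros x. apply (continuous_mult (fun _ => c)); [apply continuous_const|apply Cih]. }
  apply Rle_trans with (int (fun x => (D - C) * eps + c * sum_f_R0 (fun i => p i x * int (q i) C D) N) A B).
  { apply int_le; [exact HAB| | |].
    - apply ex_int_row; (assumption || lra).
    - apply ex_int_cont. intros x. apply (continuous_plus (fun _ => (D - C) * eps)); [apply continuous_const|apply Cihc].
    - intros x Hx. rewrite <- Ih. apply int_le; [exact HCD| | |].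
      + apply ex_int_section, Cg.
      + apply ex_int_cont, Ch.
      + intros y Hy. unfold h.
        assert (Hpos : forall j, 0 <= p j x * q j y).
        { intros j. apply Rmult_le_pos; apply trapezoid_bounds. }
        assert (Hsp : 0 <= sum_f_R0 (fun i => p i x * q i y) N) by (apply cond_pos_sum; exact Hpos).
        destruct (HN x y) as [Hle|(i & Hi & Hxi & Hyi)]; [lra|lra| |].
        * assert (0 <= c * sum_f_R0 (fun i => p i x * q i y) N) by (apply Rmult_le_pos; assumption). lra.
        * assert (E1 : p i x = 1) by (apply trapezoid_one; auto).
          assert (E2 : q i y = 1) by (apply trapezoid_one; auto).
          assert (T := sum_term_le (fun i => p i x * q i y) N i Hpos Hi). simpl in T.
          rewrite E1, E2 in T.
          assert (c * 1 <= c * sum_f_R0 (fun i => p i x * q i y) N) by (apply Rmult_le_compat_l; lra).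
          specialize (Hgc x y). lra. }
  rewrite int_plus, int_const, int_scal.
  2:{ apply ex_int_cont, Cih. }
  2:{ apply ex_int_const. }
  2:{ apply ex_int_cont, Cihc. }
  rewrite (int_sum (fun i x => p i x * int (q i) C D)) by (intros; cont1; apply Cp).
  assert (S1 : sum_f_R0 (fun i => int (fun x => p i x * int (q i) C D) A B) N <= l + eps).
  { apply Rle_trans with (sum_f_R0 (fun i => (b i - a i) * (v i - u i) + (1/2) ^ (S i) * eps) N).
    - apply sum_Rle. intros i _. destruct (Hord i) as [O1 O2].
      assert (E : int (fun x => p i x * int (q i) C D) A B = int (q i) C D * int (p i) A B).
      { rewrite <- int_scal by (apply ex_int_cont, Cp). apply int_ext; [exact HAB|]. intros; ring. }
      rewrite E.
      assert (B1 := int_trapezoid_le (u i) (v i) (eta i) C D (Heta i) O2 HCD).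
      assert (B2 := int_trapezoid_le (a i) (b i) (eta i) A B (Heta i) O1 HAB).
      fold (q i) in B1. fold (p i) in B2.
      assert (0 <= int (p i) A B).
      { apply (RInt_ge_0 (p i)); [exact HAB|apply ex_int_cont, Cp|]. intros; apply trapezoid_bounds. }
      assert (Hei := Heta i).
      apply Rle_trans with ((v i - u i + 4 * eta i) * (b i - a i + 4 * eta i)).
      { apply Rmult_le_compat; try lra.
        apply (RInt_ge_0 (q i)); [exact HCD|apply ex_int_cont, Cq|]. intros; apply trapezoid_bounds. }
      set (w := (b i - a i) + (v i - u i) + 4).
      assert (Hw : 0 < w) by (unfold w; lra).
      assert (Le1 : eta i <= 1) by apply Rmin_l.
      assert (Le2 : eta i <= eps * (1/2) ^ (S i) / (4 * w)) by apply Rmin_r.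
      apply Rle_div_r in Le2; [|lra].
      assert (eta i * (4 * eta i) <= eta i * 4) by (apply Rmult_le_compat_l; lra).
      unfold w in Le2. nra.
    - rewrite sum_plus. apply Rplus_le_compat.
      + apply (sum_incr (fun i => (b i - a i) * (v i - u i))); [exact Hsum|].
        intros i. destruct (Hord i). apply Rmult_le_pos; lra.
      + rewrite <- scal_sum. generalize (sum_half_pow N). intros. nra. }
  assert (c * sum_f_R0 (fun i => int (fun x => p i x * int (q i) C D) A B) N <= c * (l + eps))
    by (apply Rmult_le_compat_l; assumption).
  assert (E0 : e0 = eps * M) by (unfold eps; field; lra).
  rewrite E0. unfold M. nra.
Qed.

(** * Locally convex curves with two turns are not simple *)

Lemma derive_pos_right (f : R -> R) (x l : R) :
  is_derive f x l -> 0 < l ->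
  exists d, 0 < d /\ forall h, 0 < h < d -> f x < f (x + h).
Proof.
  intros H Hl. apply is_derive_Reals in H.
  destruct (H (l / 2)) as [d Hd]; [lra|].
  exists d. split; [apply cond_pos|]. intros h Hh.
  assert (Hd' := Hd h ltac:(lra) ltac:(rewrite Rabs_right; lra)).
  apply Rabs_def2 in Hd'.
  assert (l / 2 < (f (x + h) - f x) / h) by lra.
  apply Rlt_div_r in H0; [|lra]. assert (0 < l / 2 * h) by (apply Rmult_lt_0_compat; lra). lra.
Qed.

Lemma derive_neg_right (f : R -> R) (x l : R) :
  is_derive f x l -> l < 0 ->
  exists d, 0 < d /\ forall h, 0 < h < d -> f (x + h) < f x.
Proof.
  intros H Hl. destruct (derive_pos_right (fun t => - f t) x (- l)) as [d [Hd Hf]]; [|lra|].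
  - apply (is_derive_opp f x l H).
  - exists d. split; [exact Hd|]. intros h Hh. specialize (Hf h Hh). lra.
Qed.

Lemma strictly_increasing_open (f df : R -> R) (a b : R) :
  a < b -> (forall x, a < x < b -> is_derive f x (df x)) -> (forall x, a < x < b -> 0 < df x) ->
  (forall x, a <= x <= b -> continuous f x) -> f a < f b.
Proof.
  intros Hab Hf Hd Cf.
  assert (W : forall p q, a <= p <= q -> q <= b -> f p <= f q).
  { intros p q Hp Hq.
    (* The intermediate point may be an endpoint, where the sign of [df] is unknown; the truncated
       derivative agrees with [df] inside and is nonnegative everywhere. *)
    destruct (MVT_gen f p q (fun x => Rmax 0 (df x))) as [c [_ Hc]].
    - intros x. rewrite Rmin_left, Rmax_right by lra. intros Hx. rewrite Rmax_right.
      + apply Hf; lra. + left. apply Hd; lra.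
    - intros x. rewrite Rmin_left, Rmax_right by lra. intros Hx. apply continuity_pt_filterlim, Cf; lra.
    - assert (0 <= Rmax 0 (df c) * (q - p)) by (apply Rmult_le_pos; [apply Rmax_l|lra]). lra. }
  set (p := (2 * a + b) / 3). set (q := (a + 2 * b) / 3).
  assert (a < p < q) by (unfold p, q; lra). assert (q < b) by (unfold q; lra).
  destruct (MVT_cor2 f df p q) as [c [Hc1 Hc2]]; [lra| |].
  { intros c Hc. apply is_derive_Reals, Hf. lra. }
  assert (0 < df c * (q - p)) by (apply Rmult_lt_0_compat; [apply Hd|]; lra).
  assert (f a <= f p) by (apply W; lra). assert (f q <= f b) by (apply W; lra). lra.
Qed.

Lemma strictly_increasing (f df : R -> R) (a b : R) :
  a < b -> (forall x, is_derive f x (df x)) -> (forall x, a < x < b -> 0 < df x) -> f a < f b.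
Proof.
  intros Hab Hf Hd. apply (strictly_increasing_open f df); auto.
  intros x _. apply (is_derive_continuous (Hf x)).
Qed.

Lemma constant_of_derive_zero (f : R -> R) (a b : R) :
  (forall x, is_derive f x 0) -> f a = f b.
Proof. intros Hf. destruct (mean_value f (fun _ => 0) a b Hf) as [c [_ Hc]]. lra. Qed.

Lemma positive_near (f : R -> R) (x : R) :
  continuous f x -> 0 < f x -> exists d, 0 < d /\ forall y, Rabs (y - x) < d -> 0 < f y.
Proof.
  intros C H. destruct (C (fun z => 0 < z) (open_gt 0 (f x) H)) as [d Hd].
  exists d. split; [apply cond_pos|]. exact Hd.
Qed.

Lemma negative_near (f : R -> R) (x : R) :
  continuous f x -> f x < 0 -> exists d, 0 < d /\ forall y, Rabs (y - x) < d -> f y < 0.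
Proof.
  intros C H. destruct (C (fun z => z < 0) (open_lt 0 (f x) H)) as [d Hd].
  exists d. split; [apply cond_pos|]. exact Hd.
Qed.

(** [c] is the supremum of the times up to which [f] has stayed nonpositive. The sign of [df c]
    records the direction of crossing; for the height over a rotating tangent line it tells on which
    side of the contact point the crossing happens. *)
Lemma first_exit (f df : R -> R) (a b : R) :
  a < b -> (forall x, is_derive f x (df x)) -> f a <= 0 -> 0 < f b ->
  exists c, a <= c < b /\ f c = 0 /\ (forall s, a <= s <= c -> f s <= 0) /\ 0 <= df c.
Proof.
  intros Hab Hf Ha Hb.
  assert (Cf : forall x, continuous f x) by (intros x; apply (is_derive_continuous (Hf x))).
  set (S := fun c => a <= c <= b /\ forall s, a <= s <= c -> f s <= 0).
  destruct (completeness S) as [c [Hub Hlub]].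
  { exists b. intros x [Hx _]. lra. }
  { exists a. split; [lra|]. intros s Hs. replace s with a by lra. exact Ha. }
  assert (Hac : a <= c).
  { apply Hub. split; [lra|]. intros s Hs. replace s with a by lra. exact Ha. }
  assert (Hlt : forall s, a <= s < c -> f s <= 0).
  { intros s Hs. destruct (Rle_dec (f s) 0) as [h|h]; [exact h|].
    assert (c <= s); [|lra]. apply Hlub. intros x [Hx1 Hx2].
    destruct (Rle_dec x s) as [h'|h']; [exact h'|]. specialize (Hx2 s). lra. }
  assert (Hc : f c <= 0).
  { destruct (Rle_dec (f c) 0) as [h|h]; [exact h|].
    destruct (positive_near f c (Cf c)) as [d [Hd1 Hd2]]; [lra|].
    destruct (Req_dec a c) as [e|e]; [rewrite <- e; exact Ha|].
    assert (f (Rmax a (c - d / 2)) <= 0).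
    { apply Hlt. split; [apply Rmax_l|]. apply Rmax_lub_lt; lra. }
    assert (0 < f (Rmax a (c - d / 2))); [|lra].
    apply Hd2. generalize (Rmax_r a (c - d/2)). intros.
    assert (Rmax a (c - d / 2) < c) by (apply Rmax_lub_lt; lra).
    apply Rabs_def1; lra. }
  assert (Hcb : c <= b) by (apply Hlub; intros x [Hx _]; lra).
  assert (Hcb' : c < b) by (destruct (Req_dec c b); [subst c; lra|lra]).
  assert (Hall : forall s, a <= s <= c -> f s <= 0).
  { intros s Hs. destruct (Req_dec s c); [subst s; exact Hc|]. apply Hlt; lra. }
  assert (Hext : forall d, 0 < d -> (forall h, 0 < h < d -> f (c + h) <= 0) -> False).
  { intros d Hd Hh. set (t := Rmin b (c + d / 2)).
    assert (c < t) by (apply Rmin_glb_lt; lra).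
    assert (t <= b) by apply Rmin_l. assert (t <= c + d / 2) by apply Rmin_r.
    assert (t <= c); [|lra]. apply Hub. split; [lra|]. intros s Hs.
    destruct (Rle_dec s c); [apply Hall; lra|]. replace s with (c + (s - c)) by ring. apply Hh; lra. }
  exists c. split; [lra|]. split; [|split; [exact Hall|]].
  - destruct (Req_dec (f c) 0) as [e|e]; [exact e|]. exfalso.
    destruct (negative_near f c (Cf c)) as [d [Hd1 Hd2]]; [lra|].
    apply (Hext d Hd1). intros h Hh. left. apply Hd2. rewrite Rabs_right; lra.
  - destruct (Rle_dec 0 (df c)) as [h|h]; [exact h|]. exfalso.
    destruct (derive_neg_right f c (df c) (Hf c)) as [d [Hd1 Hd2]]; [lra|].
    apply (Hext d Hd1). intros h' Hh. specialize (Hd2 h' Hh). lra.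
Qed.

Lemma derivatives_at_max (F d : R -> R) (a d1 r : R) :
  0 < r -> (forall x, is_derive F x (d x)) -> is_derive d a d1 ->
  (forall x, Rabs (x - a) < r -> F x <= F a) -> d a = 0 /\ d1 <= 0.
Proof.
  intros Hr HF Hd Hmax.
  assert (H0 : d a = 0).
  { assert (pr : derivable_pt F a) by (exists (d a); apply is_derive_Reals, HF).
    assert (E := deriv_maximum F (a - r) (a + r) a pr ltac:(lra) ltac:(lra)).
    rewrite Derive_Reals, (is_derive_unique _ _ _ (HF a)) in E. apply E.
    intros x H1 H2. apply Hmax, Rabs_def1; lra. }
  split; [exact H0|].
  destruct (Rle_dec d1 0) as [h|h]; [exact h|]. exfalso.
  destruct (derive_pos_right d a d1 Hd) as [e [He1 He2]]; [lra|].
  assert (Hm : 0 < Rmin e r / 2 < e /\ Rmin e r / 2 < r).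
  { generalize (Rmin_glb_lt _ _ _ He1 Hr) (Rmin_l e r) (Rmin_r e r). lra. }
  specialize (Hmax (a + Rmin e r / 2)). rewrite Rabs_right in Hmax by lra.
  destruct (MVT_cor2 F d a (a + Rmin e r / 2)) as [c [Hc1 Hc2]]; [lra| |].
  { intros c _. apply is_derive_Reals, HF. }
  assert (0 < d c) by (specialize (He2 (c - a)); replace (a + (c - a)) with c in He2 by ring; lra).
  assert (0 < d c * (a + Rmin e r / 2 - a)) by (apply Rmult_lt_0_compat; lra). lra.
Qed.

Section DoublePoint.

(** The curve is parametrized by its tangent angle, [rad] being the radius of curvature. *)
Variables x y rad : R -> R.
Hypothesis Hx : forall a, is_derive x a (rad a * cos a).
Hypothesis Hy : forall a, is_derive y a (rad a * sin a).
Hypothesis Hrad : forall a, 0 < rad a.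

Let D (a b : R) : R := - sin a * (x b - x a) + cos a * (y b - y a).
(** Position of point [b] along the oriented tangent line at [a], measured from the contact
    point. *)
Let E (a b : R) : R := cos a * (x b - x a) + sin a * (y b - y a).

Lemma frame_zero (a b : R) : D a b = 0 -> E a b = 0 -> x a = x b /\ y a = y b.
Proof.
  intros H1 H2. assert (T := sin2_cos2 a). unfold Rsqr in T.
  assert (x b - x a = (sin a * sin a + cos a * cos a) * (x b - x a)) as Ex by (rewrite T; ring).
  assert (y b - y a = (sin a * sin a + cos a * cos a) * (y b - y a)) as Ey by (rewrite T; ring).
  assert (x b - x a = - sin a * D a b + cos a * E a b) by (rewrite Ex; unfold D, E; ring).
  assert (y b - y a = cos a * D a b + sin a * E a b) by (rewrite Ey; unfold D, E; ring).
  rewrite H1, H2 in *. lra.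
Qed.

Lemma Dx_value (a : R) : ex_derive x a /\ Derive (fun t => x t) a = rad a * cos a.
Proof. split; [eexists; apply Hx|apply is_derive_unique, Hx]. Qed.

Lemma Dy_value (a : R) : ex_derive y a /\ Derive (fun t => y t) a = rad a * sin a.
Proof. split; [eexists; apply Hy|apply is_derive_unique, Hy]. Qed.

Lemma D_derive_r (a b : R) : is_derive (D a) b (rad b * sin (b - a)).
Proof.
  unfold D. destruct (Dx_value b) as [X1 X2]. destruct (Dy_value b) as [Y1 Y2].
  auto_derive; [tauto|]. rewrite X2, Y2, sin_minus. ring.
Qed.

Lemma D_derive_l (a b : R) : is_derive (fun a => D a b) a (- E a b).
Proof.
  unfold D, E. destruct (Dx_value a) as [X1 X2]. destruct (Dy_value a) as [Y1 Y2].
  auto_derive; [tauto|]. rewrite X2, Y2. ring.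
Qed.

Lemma D_pos (a b : R) : a < b <= a + PI -> 0 < D a b.
Proof.
  intros H. replace 0 with (D a a) by (unfold D; ring).
  apply (strictly_increasing (D a) (fun b => rad b * sin (b - a))); [lra|apply D_derive_r|].
  intros c Hc. apply Rmult_lt_0_compat; [apply Hrad|]. apply sin_gt_0; lra.
Qed.

Lemma D_decr (a b c : R) : a + PI <= b -> b < c -> c <= a + 2 * PI -> D a c < D a b.
Proof.
  intros H1 H2 H3. apply Ropp_lt_cancel.
  apply (strictly_increasing (fun b => - D a b) (fun b => - (rad b * sin (b - a)))); [lra| |].
  - intros t. apply (is_derive_opp (D a)), D_derive_r.
  - intros t Ht. assert (sin (t - a) < 0) by (apply sin_lt_0; lra).
    generalize (Hrad t). nra.
Qed.

(* [D a b] is the height of point [b] over the oriented tangent line at [a].  The curve comes back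
   to the tangent line at [a0] after one turn, ahead of [a0].  Rotating the tangent line, the
   return point moves towards the contact point and has to meet it before the line reaches the
   end of the arc from the other side. *)
Lemma double_point_of_turn (a0 : R) :
  D a0 (a0 + 2 * PI) = 0 -> 0 <= E a0 (a0 + 2 * PI) ->
  exists a b, a < b <= a + 2 * PI /\ x a = x b /\ y a = y b.
Proof.
  intros HD HE. assert (Hpi := PI_RGT_0).
  set (b1 := a0 + 2 * PI) in *.
  destruct (first_exit (fun a => D a b1) (fun a => - E a b1) a0 (a0 + PI)) as (as_ & H1 & H2 & H3 & H4).
  { lra. } { intros a. apply D_derive_l. } { lra. } { apply D_pos. unfold b1; lra. }
  assert (Hroot : forall a, exists b, a0 <= a <= as_ -> a + PI <= b <= b1 /\ D a b = 0).
  { intros a. destruct (Rle_dec a0 a); [|exists 0; lra]. destruct (Rle_dec a as_); [|exists 0; lra].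
    assert (CD : forall t, continuous (D a) t) by (intros t; apply (is_derive_continuous (D_derive_r a t))).
    assert (Hb1 : a + PI <= b1) by (unfold b1; lra).
    destruct (intermediate_value (D a) (a + PI) b1 0 CD Hb1) as [b Hb]; [|exists b; auto].
    assert (0 < D a (a + PI)) by (apply D_pos; lra). assert (D a b1 <= 0) by (apply H3; lra). lra. }
  set (bt := fun a => choose (Hroot (clamp a0 as_ a))).
  assert (Hbt : forall a, clamp a0 as_ a + PI <= bt a <= b1 /\ D (clamp a0 as_ a) (bt a) = 0).
  { intros a. apply (choose_spec (Hroot (clamp a0 as_ a))), clamp_in. lra. }
  assert (Hcl : forall a, a0 <= clamp a0 as_ a <= as_) by (intros; apply clamp_in; lra).
  assert (Cx : forall t, continuous x t) by (intros t; apply (is_derive_continuous (Hx t))).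
  assert (Cy : forall t, continuous y t) by (intros t; apply (is_derive_continuous (Hy t))).
  assert (Ccl : forall t, continuous (clamp a0 as_) t) by (intros; apply clamp_continuous).
  assert (Cbt : forall a, continuous bt a).
  { intros a. apply (continuous_root bt (fun a r => - D (clamp a0 as_ a) r) (a0 + PI) b1).
    - apply filter_forall. intros q. specialize (Hcl q). destruct (Hbt q) as [B1 B2]. split; [lra|].
      intros r Hr. split; intros Hlt.
      + destruct (Rle_dec r (clamp a0 as_ q + PI)).
        * assert (0 < D (clamp a0 as_ q) r) by (apply D_pos; lra). lra.
        * assert (D (clamp a0 as_ q) (bt q) < D (clamp a0 as_ q) r) by (apply D_decr; unfold b1 in *; lra). lra.
      + assert (D (clamp a0 as_ q) r < D (clamp a0 as_ q) (bt q)) by (apply D_decr; unfold b1 in *; lra). lra.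
    - intros r. apply (continuous_opp (fun a => D (clamp a0 as_ a) r)).
      apply (continuous_comp (clamp a0 as_) (fun a => D a r)); [apply Ccl|].
      apply (is_derive_continuous (D_derive_l _ r)). }
  set (e := fun a => E (clamp a0 as_ a) (bt a)).
  assert (Ce : forall a, continuous e a).
  { intros a. unfold e, E. cont1; auto.
    - apply continuous_cos.
    - apply continuous_sin. }
  assert (Euniq : forall a, a0 <= a <= as_ -> D a b1 = 0 -> bt a = b1).
  { intros a Ha HDa. destruct (Hbt a) as [B1 B2]. rewrite clamp_id in B1, B2 by lra.
    destruct (Req_dec (bt a) b1) as [h|h]; [exact h|].
    assert (D a b1 < D a (bt a)) by (apply D_decr; unfold b1 in *; lra). lra. }
  assert (E0 : 0 <= e a0).
  { unfold e. rewrite clamp_id by lra. rewrite Euniq by (auto; lra). exact HE. }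
  assert (E1 : e as_ <= 0).
  { unfold e. rewrite clamp_id by lra. rewrite Euniq by (auto; lra). lra. }
  destruct (intermediate_value e a0 as_ 0 Ce ltac:(lra) ltac:(lra)) as [a [Ha Ha']].
  exists a, (bt a). destruct (Hbt a) as [B1 B2]. unfold e in Ha'. rewrite clamp_id in B1, B2, Ha' by lra.
  split; [unfold b1 in *; lra|]. apply frame_zero; assumption.
Qed.

(** [h] is the support function, and [F a] is minus its integral over the turn starting at [a]. [F]
    is [Theta]-periodic, hence has a global maximum at some [a0]. There the first derivative, the
    height [D a0 (a0 + 2 PI)], vanishes, and the second, [- E a0 (a0 + 2 PI)], is nonpositive: one
    turn later the curve is on the tangent line and not behind the contact point, the configuration
    that forces a double point. *)
Lemma double_point (Theta : R) :
  2 * PI < Theta -> cos Theta = 1 -> sin Theta = 0 ->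
  (forall a, x (a + Theta) = x a /\ y (a + Theta) = y a) ->
  exists a b, a < b < a + Theta /\ x a = x b /\ y a = y b.
Proof.
  intros HT Hc Hs Hper. assert (Hpi := PI_RGT_0).
  set (h := fun a => x a * sin a - y a * cos a).
  assert (Dh : forall a, is_derive h a (x a * cos a + y a * sin a)).
  { intros a. unfold h. destruct (Dx_value a) as [X1 X2]. destruct (Dy_value a) as [Y1 Y2].
    auto_derive; [tauto|]. rewrite X2, Y2. ring. }
  assert (Ch : forall a, continuous h a) by (intros a; apply (is_derive_continuous (Dh a))).
  assert (Hh : forall a, h (a + Theta) = h a).
  { intros a. unfold h. destruct (Hper a) as [-> ->]. rewrite sin_plus, cos_plus, Hc, Hs. ring. }
  assert (Dsh : forall c a, is_derive (fun a => int h 0 (a + c)) a (h (a + c))).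
  { intros c a. assert (T := is_derive_comp (int h 0) (fun a => a + c) a _ 1 (int_is_derive h 0 (a + c) Ch)).
    unfold scal in T; simpl in T; unfold mult in T; simpl in T. rewrite Rmult_1_l in T. apply T.
    auto_derive; [exact I|ring]. }
  set (F := fun a => int h 0 a - int h 0 (a + 2 * PI)).
  set (d := fun a => h a - h (a + 2 * PI)).
  assert (DF : forall a, is_derive F a (d a)).
  { intros a. apply (is_derive_minus (int h 0) (fun a => int h 0 (a + 2 * PI))); [apply int_is_derive, Ch|apply Dsh]. }
  assert (Fper : forall a, F (a + Theta) = F a).
  { assert (K : forall a b, int h 0 (a + Theta) - int h 0 a = int h 0 (b + Theta) - int h 0 b).
    { intros a b. apply (constant_of_derive_zero (fun a => int h 0 (a + Theta) - int h 0 a)).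
      intros t. apply is_derive_eq with (h (t + Theta) - h t); [|rewrite Hh; ring].
      apply is_derive_sub; [apply Dsh|apply int_is_derive, Ch]. }
    intros a. unfold F. specialize (K a (a + 2 * PI)).
    replace (a + Theta + 2 * PI) with (a + 2 * PI + Theta) by ring. lra. }
  destruct (continuity_ab_maj F 0 Theta) as [a0 [Hmax Ha0]]; [lra| |].
  { intros c _. apply continuity_pt_filterlim, (is_derive_continuous (DF c)). }
  destruct (derivatives_at_max F d a0 (- E a0 (a0 + 2 * PI)) Theta) as [M1 M2]; [lra|exact DF| | |].
  - unfold d, h, E. set (b := a0 + 2 * PI).
    destruct (Dx_value a0) as [X1 X2]. destruct (Dy_value a0) as [Y1 Y2].
    destruct (Dx_value b) as [X3 X4]. destruct (Dy_value b) as [Y3 Y4]. fold b in X3, X4, Y3, Y4.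
    auto_derive; [tauto|].
    fold b. rewrite X2, X4, Y2, Y4.
    assert (Eb1 : sin b = sin a0) by (unfold b; rewrite sin_plus, sin_2PI, cos_2PI; ring).
    assert (Eb2 : cos b = cos a0) by (unfold b; rewrite cos_plus, sin_2PI, cos_2PI; ring).
    rewrite Eb1, Eb2. ring.
  - intros t Ht. apply Rabs_def2 in Ht.
    destruct (Rle_dec 0 t); [destruct (Rle_dec t Theta)|].
    + apply Hmax; lra.
    + replace t with ((t - Theta) + Theta) by ring. rewrite Fper. apply Hmax; lra.
    + rewrite <- Fper. apply Hmax; lra.
  - destruct (double_point_of_turn a0) as (a & b & H1 & H2).
    + unfold d, h in M1. unfold D.
      rewrite sin_plus, cos_plus, sin_2PI, cos_2PI in M1. lra.
    + lra.
    + exists a, b. split; [lra|exact H2].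
Qed.

End DoublePoint.

(** * The tangent angle *)

Set Implicit Arguments.
(** Frenet form of the hypotheses on the curve. Simplicity is stated for every window of one period,
    so that it applies without reducing parameters to [[0, P)]. *)
Record oval (P kmin : R) (X Y X1 Y1 k : R -> R) : Prop := {
  oval_P : 0 < P;
  oval_kmin : 0 < kmin;
  oval_dX : forall t, is_derive X t (X1 t);
  oval_dY : forall t, is_derive Y t (Y1 t);
  oval_dX1 : forall t, is_derive X1 t (- k t * Y1 t);
  oval_dY1 : forall t, is_derive Y1 t (k t * X1 t);
  oval_unit : forall t, X1 t * X1 t + Y1 t * Y1 t = 1;
  oval_ck : forall t, continuous k t;
  oval_k : forall t, kmin <= k t;
  oval_pX : forall t, X (t + P) = X t;
  oval_pY : forall t, Y (t + P) = Y t;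
  oval_pX1 : forall t, X1 (t + P) = X1 t;
  oval_pY1 : forall t, Y1 (t + P) = Y1 t;
  oval_pk : forall t, k (t + P) = k t;
  oval_simple : forall s t, s < t < s + P -> X s = X t -> Y s = Y t -> False }.

Record tangent_angle (X1 Y1 k tau : R -> R) : Prop := {
  angle_derive : forall t, is_derive tau t (k t);
  angle_X1 : forall t, X1 t = cos (tau t);
  angle_Y1 : forall t, Y1 t = sin (tau t) }.
Unset Implicit Arguments.

Lemma derive_value (f df : R -> R) :
  (forall t, is_derive f t (df t)) -> forall t, ex_derive f t /\ Derive (fun u : R => f u) t = df t.
Proof. intros D t. split; [eexists; apply D|apply is_derive_unique, D]. Qed.

Ltac use_derivative D :=
  repeat match type of D with forall t, is_derive ?f t _ =>
    match goal with
    | |- ex_derive (fun t => f t) ?u => exact (proj1 (derive_value _ _ D u))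
    | |- context [Derive (fun t => f t) ?u] => rewrite (proj2 (derive_value _ _ D u))
    end end.

Ltac curve_derive H :=
  auto_derive; [repeat split|];
  use_derivative (oval_dX H); use_derivative (oval_dY H);
  use_derivative (oval_dX1 H); use_derivative (oval_dY1 H); auto.

Lemma unit_vector_angle (a b : R) : a * a + b * b = 1 -> exists th, a = cos th /\ b = sin th.
Proof.
  intros H. assert (Ha : -1 <= a <= 1) by nra.
  destruct (Rle_dec 0 b) as [h|h].
  - exists (acos a). rewrite cos_acos, sin_acos by lra. split; [reflexivity|].
    replace (1 - a²) with (b * b) by (unfold Rsqr; lra). symmetry. apply sqrt_square, h.
  - exists (- acos a). rewrite cos_neg, sin_neg, cos_acos, sin_acos by lra. split; [reflexivity|].
    replace (1 - a²) with (- b * - b) by (unfold Rsqr; lra). rewrite sqrt_square by lra. ring.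
Qed.

Section Turning.

Context {P kmin : R} {X Y X1 Y1 k : R -> R} (H : oval P kmin X Y X1 Y1 k).

(** Take [tau] to be the integral of the curvature with the right initial angle. By Frenet's
    equations the components of the unit tangent along [(cos tau, sin tau)] and its normal are
    constant, so they keep their initial values 1 and 0. *)
Lemma tangent_angle_exists : exists tau : R -> R, tangent_angle X1 Y1 k tau.
Proof.
  destruct (unit_vector_angle (X1 0) (Y1 0) (oval_unit H 0)) as [th [E1 E2]].
  set (tau := fun t => th + int k 0 t).
  assert (Dt : forall t, is_derive tau t (k t)).
  { intros t. unfold tau.
    assert (T := int_is_derive k 0 t (oval_ck H)).
    apply is_derive_eq with (0 + k t); [|ring].
    apply (is_derive_plus (fun _ => th) (int k 0)); [|exact T].
    apply (is_derive_const (V := R_NormedModule) th t). }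
  exists tau.
  assert (A : forall t, X1 t * cos (tau t) + Y1 t * sin (tau t) = 1 /\
                        Y1 t * cos (tau t) - X1 t * sin (tau t) = 0).
  { intros t.
    assert (T0 : tau 0 = th) by (unfold tau; rewrite int_refl; ring).
    split.
    - rewrite (constant_of_derive_zero (fun t => X1 t * cos (tau t) + Y1 t * sin (tau t)) t 0).
      + rewrite T0, E1, E2. generalize (sin2_cos2 th). unfold Rsqr. lra.
      + intros u. curve_derive H; use_derivative Dt. ring.
    - rewrite (constant_of_derive_zero (fun t => Y1 t * cos (tau t) - X1 t * sin (tau t)) t 0).
      + rewrite T0, E1, E2. ring.
      + intros u. curve_derive H; use_derivative Dt. ring. }
  split; [exact Dt| |]; intros t; destruct (A t) as [A1 A2]; assert (T := sin2_cos2 (tau t)); unfold Rsqr in T;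
  set (c := cos (tau t)) in *; set (s := sin (tau t)) in *.
  - replace (X1 t) with (c * (X1 t * c + Y1 t * s) - s * (Y1 t * c - X1 t * s) + X1 t * (1 - (s * s + c * c))) by ring.
    rewrite A1, A2, T. ring.
  - replace (Y1 t) with (s * (X1 t * c + Y1 t * s) + c * (Y1 t * c - X1 t * s) + Y1 t * (1 - (s * s + c * c))) by ring.
    rewrite A1, A2, T. ring.
Qed.

Context {tau : R -> R} (A : tangent_angle X1 Y1 k tau).
Let Htau := angle_derive A.
Let HX1 := angle_X1 A.
Let HY1 := angle_Y1 A.

Lemma kpos (t : R) : 0 < k t.
Proof. generalize (oval_kmin H) (oval_k H t). lra. Qed.

Lemma tau_growth (s t : R) : s <= t -> kmin * (t - s) <= tau t - tau s.
Proof.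
  intros Hst. destruct (mean_value tau k s t Htau) as [c [_ ->]].
  apply Rmult_le_compat_r; [lra|apply (oval_k H)].
Qed.

Lemma tau_lt (s t : R) : s < t -> tau s < tau t.
Proof.
  intros Hst. assert (G := tau_growth s t ltac:(lra)).
  assert (0 < kmin * (t - s)) by (apply Rmult_lt_0_compat; [apply (oval_kmin H)|lra]). lra.
Qed.

Lemma tau_surjective (th : R) : exists t, tau t = th.
Proof.
  assert (Hk := oval_kmin H).
  set (r := Rabs (th - tau 0) / kmin).
  assert (Hr : 0 <= r) by (apply Rdiv_le_0_compat; [apply Rabs_pos|exact Hk]).
  assert (Ek : kmin * r = Rabs (th - tau 0)) by (unfold r; field; lra).
  assert (G1 := tau_growth 0 r Hr). assert (G2 := tau_growth (- r) 0 ltac:(lra)).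
  generalize (Rle_abs (th - tau 0)) (Rle_abs (- (th - tau 0))). rewrite Rabs_Ropp. intros A1 A2.
  destruct (intermediate_value tau (- r) r th) as [t [_ Ht]]; [|lra|lra|exists t; exact Ht].
  intros t. apply (is_derive_continuous (Htau t)).
Qed.

(** Inverse of the tangent angle; it reparametrizes the curve by direction, the form required by
    [double_point]. *)
Definition zeta (th : R) : R := choose (tau_surjective th).

Lemma tau_zeta (th : R) : tau (zeta th) = th.
Proof. exact (choose_spec (tau_surjective th)). Qed.

Lemma tau_inj (s t : R) : tau s = tau t -> s = t.
Proof.
  intros E. destruct (Rtotal_order s t) as [h|[h|h]]; [|exact h|];
  apply tau_lt in h; lra.
Qed.

Lemma zeta_tau (t : R) : zeta (tau t) = t.
Proof. apply tau_inj, tau_zeta. Qed.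

Lemma zeta_lt (a b : R) : a < b -> zeta a < zeta b.
Proof.
  intros Hab. destruct (Rlt_dec (zeta a) (zeta b)) as [h|h]; [exact h|].
  destruct (Req_dec (zeta b) (zeta a)) as [e|e].
  - assert (tau (zeta b) = tau (zeta a)) by (rewrite e; reflexivity). rewrite !tau_zeta in H0. lra.
  - assert (T : tau (zeta b) < tau (zeta a)) by (apply tau_lt; lra). rewrite !tau_zeta in T. lra.
Qed.

Lemma zeta_continuous (th : R) : continuous zeta th.
Proof.
  apply (continuous_root zeta (fun q r => tau r - q) (zeta (th - 1)) (zeta (th + 1))).
  - exists (mkposreal 1 Rlt_0_1). intros q Hq. change (Rabs (q - th) < 1) in Hq. apply Rabs_def2 in Hq.
    split; [split; left; apply zeta_lt; lra|]. intros r _. split; intros Hr;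
    apply tau_lt in Hr; rewrite tau_zeta in Hr; lra.
  - intros r. cont1.
Qed.

(** The candidate derivative is integrated first: its primitive composed with [tau] has derivative
    1, hence is the parameter up to a constant, and substituting [zeta] recovers the inverse. *)
Lemma zeta_derive (th : R) : is_derive zeta th (/ k (zeta th)).
Proof.
  set (rad := fun a => / k (zeta a)).
  assert (Cr : forall a, continuous rad a).
  { intros a. apply (continuous_Rinv_comp (fun a => k (zeta a))).
    - apply (continuous_comp zeta k); [apply zeta_continuous|apply (oval_ck H)].
    - generalize (kpos (zeta a)). lra. }
  assert (E : forall t, int rad 0 (tau t) - t = int rad 0 (tau (zeta 0)) - zeta 0).
  { intros t. apply (constant_of_derive_zero (fun t => int rad 0 (tau t) - t)). intros u.
    apply is_derive_eq with (k u * rad (tau u) - 1).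
    - apply is_derive_sub; [|apply (is_derive_id (K := R_AbsRing))].
      apply (is_derive_comp (int rad 0) tau); [apply int_is_derive, Cr|apply Htau].
    - unfold rad. rewrite zeta_tau. field. generalize (kpos u). lra. }
  apply (is_derive_ext (fun a => int rad 0 a + zeta 0)).
  - intros a. specialize (E (zeta a)). rewrite !tau_zeta, int_refl in E. lra.
  - apply is_derive_eq with (rad th + 0); [|unfold rad; ring].
    apply (is_derive_plus (int rad 0) (fun _ => zeta 0)); [apply int_is_derive, Cr|].
    apply (is_derive_const (V := R_NormedModule)).
Qed.

(** Rotation number one. Periodicity of the tangent gives [cos Th = 1] and [sin Th = 0]. A positive
    [Th] below [2 PI] is impossible, since then [cos Th = 1 - 2 sin^2 (Th / 2) < 1]; a value above
    [2 PI] would produce a double point, against simplicity. *)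
Lemma turning (t : R) : tau (t + P) = tau t + 2 * PI.
Proof.
  assert (HP := oval_P H). assert (Hpi := PI_RGT_0).
  set (Th := tau (0 + P) - tau 0).
  assert (ETh : forall t, tau (t + P) = tau t + Th).
  { intros u. assert (tau (u + P) - tau u = Th); [|lra].
    apply (constant_of_derive_zero (fun t => tau (t + P) - tau t)). intros v.
    apply is_derive_eq with (k (v + P) - k v); [|rewrite (oval_pk H); ring].
    apply is_derive_sub; [|apply Htau].
    apply is_derive_eq with (1 * k (v + P)); [|ring].
    apply (is_derive_comp tau (fun t => t + P)); [apply Htau|]. auto_derive; [exact I|ring]. }
  assert (HTh : 0 < Th) by (unfold Th; generalize (tau_lt 0 (0 + P)); lra).
  assert (EC : cos (tau 0 + Th) = cos (tau 0)) by (rewrite <- ETh, <- !HX1; apply (oval_pX1 H)).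
  assert (ES : sin (tau 0 + Th) = sin (tau 0)) by (rewrite <- ETh, <- !HY1; apply (oval_pY1 H)).
  assert (T := sin2_cos2 (tau 0)). unfold Rsqr in T.
  assert (C1 : cos Th = 1).
  { replace Th with (tau 0 + Th - tau 0) by ring. rewrite cos_minus, EC, ES. lra. }
  assert (S0 : sin Th = 0).
  { replace Th with (tau 0 + Th - tau 0) by ring. rewrite sin_minus, EC, ES. ring. }
  rewrite ETh. f_equal.
  destruct (Rtotal_order Th (2 * PI)) as [h|[h|h]]; [|exact h|]; exfalso.
  - assert (0 < sin (Th / 2)) by (apply sin_gt_0; lra).
    replace Th with (2 * (Th / 2)) in C1 by field. rewrite cos_2a_sin in C1. nra.
  - destruct (double_point (fun a => X (zeta a)) (fun a => Y (zeta a)) (fun a => / k (zeta a))) with Th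
      as (a & b & Hab & E1 & E2); auto.
    + intros a. apply is_derive_eq with (/ k (zeta a) * X1 (zeta a)); [|rewrite HX1, tau_zeta; reflexivity].
      apply (is_derive_comp X zeta); [apply (oval_dX H)|apply zeta_derive].
    + intros a. apply is_derive_eq with (/ k (zeta a) * Y1 (zeta a)); [|rewrite HY1, tau_zeta; reflexivity].
      apply (is_derive_comp Y zeta); [apply (oval_dY H)|apply zeta_derive].
    + intros a. apply Rinv_0_lt_compat, kpos.
    + intros a. assert (Z : zeta (a + Th) = zeta a + P) by (apply tau_inj; rewrite ETh, !tau_zeta; reflexivity).
      rewrite Z, (oval_pX H), (oval_pY H). auto.
    + assert (Z : zeta (a + Th) = zeta a + P) by (apply tau_inj; rewrite ETh, !tau_zeta; reflexivity).
      apply (oval_simple H (s := zeta a) (t := zeta b)); auto.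
      rewrite <- Z. split; apply zeta_lt; lra.
Qed.

(** This and [dot_chord s t] are the chord length times sine and cosine of the angle from the
    tangent at [s] to the chord. For a bounce from [s] to [t] with angles [phi], [psi], the values
    at [(s, t)] are [L sin phi] and [L cos phi], those at [(t, s)] are [L sin psi] and
    [- L cos psi]. *)
Definition cross_chord (s t : R) : R := X1 s * (Y t - Y s) - Y1 s * (X t - X s).
Definition dot_chord (s t : R) : R := X1 s * (X t - X s) + Y1 s * (Y t - Y s).

Lemma cr_derive_sin (s t : R) : is_derive (cross_chord s) t (sin (tau t - tau s)).
Proof.
  apply is_derive_eq with (X1 s * Y1 t - Y1 s * X1 t).
  - unfold cross_chord.
    curve_derive H. ring.
  - rewrite !HX1, !HY1, sin_minus. ring.
Qed.

(** The height over the tangent at [s] has derivative [sin (tau t - tau s)]: it rises from 0 during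
    the first half turn and falls back to 0 at [s + P] during the second, the total turning being
    [2 PI]. *)
Lemma cr_pos (s t : R) : s < t < s + P -> 0 < cross_chord s t.
Proof.
  intros Hst. assert (Hpi := PI_RGT_0).
  assert (T1 := tau_lt s t ltac:(lra)). assert (T2 := tau_lt t (s + P) ltac:(lra)).
  rewrite turning in T2.
  destruct (Rle_dec (tau t) (tau s + PI)) as [h|h].
  - replace 0 with (cross_chord s s) by (unfold cross_chord; ring).
    apply (strictly_increasing (cross_chord s) (fun t => sin (tau t - tau s))); [lra|apply cr_derive_sin|].
    intros c Hc. assert (A1 := tau_lt s c ltac:(lra)). assert (A2 := tau_lt c t ltac:(lra)).
    apply sin_gt_0; lra.
  - assert (E : cross_chord s (s + P) = 0) by (unfold cross_chord; rewrite (oval_pX H), (oval_pY H); ring).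
    rewrite <- E. apply Ropp_lt_cancel.
    apply (strictly_increasing (fun t => - cross_chord s t) (fun t => - sin (tau t - tau s))); [lra| |].
    + intros u. apply (is_derive_opp (cross_chord s)), cr_derive_sin.
    + intros c Hc. assert (A1 := tau_lt t c ltac:(lra)). assert (A2 := tau_lt c (s + P) ltac:(lra)).
      rewrite turning in A2. assert (sin (tau c - tau s) < 0) by (apply sin_lt_0; lra). lra.
Qed.

End Turning.

(** * Chords *)

Lemma periodic_shift_Z (f : R -> R) (P : R) (n : Z) (t : R) :
  (forall t, f (t + P) = f t) -> f (t + IZR n * P) = f t.
Proof.
  intros Hf.
  assert (Hn : forall m t, f (t + INR m * P) = f t).
  { induction m as [|m IH]; intros u; [rewrite Rmult_0_l, Rplus_0_r; reflexivity|].
    rewrite S_INR. replace (u + (INR m + 1) * P) with (u + INR m * P + P) by ring.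
    rewrite Hf. apply IH. }
  destruct (Z_le_gt_dec 0 n) as [h|h].
  - rewrite <- (Z2Nat.id n) by exact h. rewrite <- INR_IZR_INZ. apply Hn.
  - rewrite <- (Hn (Z.to_nat (- n)) (t + IZR n * P)). f_equal.
    rewrite INR_IZR_INZ, Z2Nat.id by lia. rewrite opp_IZR. ring.
Qed.

Lemma reduce_mod (P t : R) : 0 < P -> exists n : Z, 0 <= t + IZR n * P < P.
Proof.
  intros HP. destruct (archimed (t / P)) as [A1 A2].
  exists (1 - up (t / P))%Z. rewrite minus_IZR.
  assert (E : t = t / P * P) by (field; lra).
  set (q := t / P) in *. rewrite E. split; nra.
Qed.

Lemma periodic_bounded (f : R -> R) (P : R) :
  0 < P -> (forall t, continuous f t) -> (forall t, f (t + P) = f t) ->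
  exists M, 0 < M /\ forall t, Rabs (f t) <= M.
Proof.
  intros HP Cf Pf.
  destruct (continuity_ab_maj (fun t => Rabs (f t)) 0 P) as [m [Hm _]]; [lra| |].
  { intros c _. apply continuity_pt_filterlim. apply (continuous_comp f Rabs); [apply Cf|apply continuous_Rabs]. }
  exists (Rabs (f m) + 1). split; [generalize (Rabs_pos (f m)); lra|]. intros t.
  destruct (reduce_mod P t HP) as [n Hn].
  rewrite <- (periodic_shift_Z f P n t Pf). specialize (Hm (t + IZR n * P)). lra.
Qed.

Lemma continuity_2d_pt_lipschitz (g : R -> R -> R) (s r C d : R) :
  0 < C -> 0 < d -> 
  (forall s' r', Rabs (r' - r) < d -> Rabs (g s' r' - g s r) <= C * Rabs (r' - r)) ->
  continuity_2d_pt g s r.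
Proof.
  intros HC Hd Hg eps.
  assert (He : 0 < eps / C) by (apply Rdiv_lt_0_compat; [apply cond_pos|exact HC]).
  exists (mkposreal _ (Rmin_stable_in_posreal (mkposreal _ Hd) (mkposreal _ He))); simpl.
  intros u v _ Hv.
  assert (H1 := Rlt_le_trans _ _ _ Hv (Rmin_l _ _)). assert (H2 := Rlt_le_trans _ _ _ Hv (Rmin_r _ _)).
  simpl in H1, H2. eapply Rle_lt_trans; [apply Hg, H1|].
  apply Rlt_div_r in H2; [|exact HC]. lra.
Qed.

Lemma cos_ge_half (x : R) : Rabs x <= 1 -> / 2 <= cos x.
Proof.
  intros Hx. assert (Hpi := PI2_3_2).
  assert (E : cos x = cos (Rabs x)) by (unfold Rabs; destruct (Rcase_abs x); [rewrite cos_neg|]; reflexivity).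
  rewrite E. replace (/ 2) with (cos (PI / 3)) by (rewrite cos_PI3; lra).
  apply cos_decr_1; generalize (Rabs_pos x); lra.
Qed.

Lemma Rabs_sin_le (x : R) : Rabs (sin x) <= Rabs x.
Proof.
  assert (Hp : forall y, 0 <= y -> Rabs (sin y) <= y).
  { intros y Hy. destruct (Req_dec y 0) as [->|Hn]; [rewrite sin_0, Rabs_R0; lra|].
    apply Rabs_le. split.
    - destruct (Rle_dec y PI); [|generalize (SIN_bound y) PI2_3_2; lra].
      generalize (sin_ge_0 y Hy r). lra.
    - left. apply sin_lt_x. lra. }
  unfold Rabs at 2. destruct (Rcase_abs x) as [h|h]; [|apply Hp; lra].
  rewrite <- (Rabs_Ropp (sin x)), <- sin_neg. apply Hp. lra.
Qed.

Section Chords.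

Context {P kmin : R} {X Y X1 Y1 k tau : R -> R}.
Context (H : oval P kmin X Y X1 Y1 k) (A : tangent_angle X1 Y1 k tau).

Notation cr := (@cross_chord X Y X1 Y1).
Notation dt := (@dot_chord X Y X1 Y1).
Notation len := (Lchord X Y).

Let Htau := angle_derive A.
Let HX1 := angle_X1 A.
Let HY1 := angle_Y1 A.
Let HP := oval_P H.
Let dX := oval_dX H.
Let dY := oval_dY H.
Let dX1 := oval_dX1 H.
Let dY1 := oval_dY1 H.
Let pX := oval_pX H.
Let pY := oval_pY H.
Let pX1 := oval_pX1 H.
Let pY1 := oval_pY1 H.

Lemma X_cont (t : R) : continuous X t. Proof. exact (is_derive_continuous (dX t)). Qed.
Lemma Y_cont (t : R) : continuous Y t. Proof. exact (is_derive_continuous (dY t)). Qed.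
Lemma X1_cont (t : R) : continuous X1 t. Proof. exact (is_derive_continuous (dX1 t)). Qed.
Lemma Y1_cont (t : R) : continuous Y1 t. Proof. exact (is_derive_continuous (dY1 t)). Qed.

Lemma cr_pos_r (s t : R) : s < t < s + P -> 0 < cr s t.
Proof. exact (cr_pos H A s t). Qed.

Lemma cr_shift_r (s t : R) : cr s (t + P) = cr s t.
Proof. unfold cross_chord. rewrite pX, pY. reflexivity. Qed.

Lemma cr_shift_l (s t : R) : cr (s + P) t = cr s t.
Proof. unfold cross_chord. rewrite pX, pY, pX1, pY1. reflexivity. Qed.

Lemma dt_shift_r (s t : R) : dt s (t + P) = dt s t.
Proof. unfold dot_chord. rewrite pX, pY. reflexivity. Qed.

Lemma dt_shift_l (s t : R) : dt (s + P) t = dt s t.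
Proof. unfold dot_chord. rewrite pX, pY, pX1, pY1. reflexivity. Qed.

Lemma len_shift_r (s t : R) : len s (t + P) = len s t.
Proof. unfold Lchord. rewrite pX, pY. reflexivity. Qed.

Lemma len_shift_l (s t : R) : len (s + P) t = len s t.
Proof. unfold Lchord. rewrite pX, pY. reflexivity. Qed.

Lemma cr_pos_l (s t : R) : s < t < s + P -> 0 < cr t s.
Proof. intros Hst. rewrite <- cr_shift_r. apply cr_pos_r. lra. Qed.

Lemma len_sym (s t : R) : len s t = len t s.
Proof. unfold Lchord. f_equal. ring. Qed.

Lemma len_nonneg (s t : R) : 0 <= len s t.
Proof. apply sqrt_pos. Qed.

Lemma len_sqr (s t : R) : len s t * len s t = (X t - X s) * (X t - X s) + (Y t - Y s) * (Y t - Y s).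
Proof.
  unfold Lchord. rewrite sqrt_sqrt; [ring|]. apply Rplus_le_le_0_compat; apply pow2_ge_0.
Qed.

Lemma len_frame (s t : R) : len s t * len s t = cr s t * cr s t + dt s t * dt s t.
Proof.
  rewrite len_sqr. unfold cross_chord, dot_chord.
  set (a := X t - X s). set (b := Y t - Y s). assert (U := oval_unit H s).
  transitivity ((X1 s * X1 s + Y1 s * Y1 s) * (a * a + b * b)); [rewrite U|]; ring.
Qed.

Lemma len_pos (s t : R) : s < t < s + P -> 0 < len s t.
Proof.
  intros Hst. assert (C := cr_pos_r s t Hst). assert (F := len_frame s t). assert (N := len_nonneg s t).
  destruct N as [N|N]; [exact N|]. rewrite <- N in F.
  assert (0 < cr s t * cr s t) by (apply Rmult_lt_0_compat; exact C).
  assert (Q := Rle_0_sqr (dt s t)). unfold Rsqr in Q. lra.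
Qed.

(** Addition formulas in disguise: the tangents at [s] and [t] differ by the angle [phi + psi], and
    the right sides here and in the next lemma are [- cos (phi + psi)] and [sin (phi + psi)] times
    the squared length. *)
Lemma two_frames (s t : R) :
  cr s t * cr t s + dt s t * dt t s = - (X1 s * X1 t + Y1 s * Y1 t) * (len s t * len s t).
Proof. rewrite len_sqr. unfold cross_chord, dot_chord. ring. Qed.

Lemma two_frames_cross (s t : R) :
  cr t s * dt s t - cr s t * dt t s = (Y1 t * X1 s - X1 t * Y1 s) * (len s t * len s t).
Proof. rewrite len_sqr. unfold cross_chord, dot_chord. ring. Qed.

(* The coordinate u = - cos phi of the chord from s to s + r. *)
Definition slope (s r : R) : R :=
  if Rle_dec r 0 then -1 else if Rle_dec P r then 1 else - dt s (s + r) / len s (s + r).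

(* The density of the invariant measure in the coordinates (s, r). *)
Definition dens (s r : R) : R :=
  if Rle_dec r 0 then 0 else if Rle_dec P r then 0 else
  cr s (s + r) * cr (s + r) s / len s (s + r) ^ 3.

Lemma slope_in (s r : R) : 0 < r < P -> slope s r = - dt s (s + r) / len s (s + r).
Proof. intros Hr. unfold slope. destruct (Rle_dec r 0); [lra|]. destruct (Rle_dec P r); [lra|]. reflexivity. Qed.

Lemma slope_lo (s r : R) : r <= 0 -> slope s r = -1.
Proof. intros Hr. unfold slope. destruct (Rle_dec r 0); [reflexivity|lra]. Qed.

Lemma slope_hi (s r : R) : P <= r -> slope s r = 1.
Proof. intros Hr. unfold slope. destruct (Rle_dec r 0); [lra|]. destruct (Rle_dec P r); [reflexivity|lra]. Qed.

Lemma dens_in (s r : R) : 0 < r < P -> dens s r = cr s (s + r) * cr (s + r) s / len s (s + r) ^ 3.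
Proof. intros Hr. unfold dens. destruct (Rle_dec r 0); [lra|]. destruct (Rle_dec P r); [lra|]. reflexivity. Qed.

Lemma dens_lo (s r : R) : r <= 0 -> dens s r = 0.
Proof. intros Hr. unfold dens. destruct (Rle_dec r 0); [reflexivity|lra]. Qed.

Lemma dens_hi (s r : R) : P <= r -> dens s r = 0.
Proof. intros Hr. unfold dens. destruct (Rle_dec r 0); [reflexivity|]. destruct (Rle_dec P r); [reflexivity|lra]. Qed.

Lemma dens_pos (s r : R) : 0 < r < P -> 0 < dens s r.
Proof.
  intros Hr. rewrite dens_in by exact Hr.
  apply Rdiv_lt_0_compat; [|apply pow_lt, len_pos; lra].
  apply Rmult_lt_0_compat; [apply cr_pos_r|apply cr_pos_l]; lra.
Qed.

Lemma dens_nonneg (s r : R) : 0 <= dens s r.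
Proof.
  destruct (Rle_dec r 0); [rewrite dens_lo; lra|]. destruct (Rle_dec P r); [rewrite dens_hi; lra|].
  left. apply dens_pos. lra.
Qed.

Lemma slope_shift (s r : R) : slope (s + P) r = slope s r.
Proof.
  unfold slope. replace (s + P + r) with (s + r + P) by ring.
  rewrite dt_shift_l, dt_shift_r, len_shift_l, len_shift_r. reflexivity.
Qed.

Lemma dens_shift (s r : R) : dens (s + P) r = dens s r.
Proof.
  unfold dens. replace (s + P + r) with (s + r + P) by ring.
  rewrite !cr_shift_l, !cr_shift_r, len_shift_l, len_shift_r. reflexivity.
Qed.

Lemma dens_reverse (s r : R) : dens (s + r) (P - r) = dens s r.
Proof.
  unfold dens. replace (s + r + (P - r)) with (s + P) by ring.
  rewrite cr_shift_l, cr_shift_r, len_shift_r, (len_sym (s + r) s).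
  destruct (Rle_dec (P - r) 0); destruct (Rle_dec r 0); try lra;
  destruct (Rle_dec P (P - r)); destruct (Rle_dec P r); try lra.
Qed.

Lemma kmax_exists : exists kmax, 0 < kmax /\ forall t, k t <= kmax.
Proof.
  destruct (periodic_bounded k P HP (oval_ck H) (oval_pk H)) as [M [HM B]].
  exists M. split; [exact HM|]. intros t. generalize (Rle_abs (k t)) (B t). lra.
Qed.

Lemma tau_lipschitz (kmax : R) : (forall t, k t <= kmax) ->
  forall s t, Rabs (tau t - tau s) <= kmax * Rabs (t - s).
Proof.
  intros Hk s t.
  destruct (mean_value tau k s t Htau) as [c [_ ->]].
  rewrite Rabs_mult. apply Rmult_le_compat_r; [apply Rabs_pos|].
  rewrite Rabs_right; [apply Hk|]. generalize (kpos H c). lra.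
Qed.

Lemma dt_derive_cos (s t : R) : is_derive (dt s) t (cos (tau t - tau s)).
Proof.
  apply is_derive_eq with (X1 s * X1 t + Y1 s * Y1 t).
  - unfold dot_chord. curve_derive H. ring.
  - rewrite !HX1, !HY1, cos_minus. ring.
Qed.

Lemma between_Rabs (s q c : R) : Rmin s (s + q) <= c <= Rmax s (s + q) -> Rabs (c - s) <= Rabs q.
Proof.
  unfold Rmin, Rmax. destruct (Rle_dec s (s + q)); intros Hc.
  - rewrite !Rabs_right; lra.
  - rewrite (Rabs_left1 q), (Rabs_left1 (c - s)); lra.
Qed.

Lemma cr_small (kmax : R) : 0 < kmax -> (forall t, k t <= kmax) ->
  forall s q, Rabs (cr s (s + q)) <= kmax * (Rabs q * Rabs q).
Proof.
  intros Hk0 Hk s q.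
  destruct (mean_value (cr s) _ s (s + q) (cr_derive_sin H A s)) as [c [Hc E]].
  replace (cr s s) with 0 in E by (unfold cross_chord; ring).
  replace (cr s (s + q)) with (sin (tau c - tau s) * q) by (rewrite Rminus_0_r in E; rewrite E; ring).
  rewrite Rabs_mult, <- Rmult_assoc. apply Rmult_le_compat_r; [apply Rabs_pos|].
  eapply Rle_trans; [apply Rabs_sin_le|]. eapply Rle_trans; [apply (tau_lipschitz kmax Hk)|].
  apply Rmult_le_compat_l; [lra|]. apply between_Rabs, Hc.
Qed.

Lemma dt_large (kmax : R) : 0 < kmax -> (forall t, k t <= kmax) ->
  forall s q, kmax * Rabs q <= 1 -> exists c, / 2 <= c /\ dt s (s + q) = c * q.
Proof.
  intros Hk0 Hk s q Hq.
  destruct (mean_value (dt s) _ s (s + q) (dt_derive_cos s)) as [c [Hc E]].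
  exists (cos (tau c - tau s)). split.
  - apply cos_ge_half. eapply Rle_trans; [apply (tau_lipschitz kmax Hk)|].
    eapply Rle_trans; [apply Rmult_le_compat_l; [lra|apply between_Rabs, Hc]|exact Hq].
  - replace (dt s s) with 0 in E by (unfold dot_chord; ring). lra.
Qed.

(** Near the diagonal [cross_chord] is quadratic and [dot_chord] linear in [q]; this gives Lipschitz
    control of [slope] and [dens] at the edges of the strip. Negative [q] describes chords with [r]
    near [P], whence the sign [q / Rabs q]. *)
Lemma short_chord (kmax : R) : 0 < kmax -> (forall t, k t <= kmax) ->
  forall s q, kmax * Rabs q <= 1 -> q <> 0 ->
  Rabs (q / Rabs q * (dt s (s + q) / len s (s + q)) - 1) <= 4 * kmax * Rabs q /\
  Rabs (cr s (s + q) * cr (s + q) s / len s (s + q) ^ 3) <= 8 * kmax * kmax * Rabs q.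
Proof.
  intros Hk0 Hk s q Hq Hn.
  destruct (dt_large kmax Hk0 Hk s q Hq) as [c [Hc Ec]].
  assert (C1 := cr_small kmax Hk0 Hk s q).
  assert (C2 := cr_small kmax Hk0 Hk (s + q) (- q)). rewrite Rabs_Ropp in C2.
  replace (s + q + - q) with s in C2 by ring.
  assert (Aq : 0 < Rabs q) by (apply Rabs_pos_lt, Hn).
  assert (N := len_nonneg s (s + q)). assert (F := len_frame s (s + q)).
  set (l := len s (s + q)) in *. set (d := dt s (s + q)) in *. set (u := cr s (s + q)) in *.
  set (v := cr (s + q) s) in *. set (a := Rabs q) in *.
  assert (Ed : Rabs d = c * a) by (rewrite Ec, Rabs_mult, (Rabs_right c) by lra; reflexivity).
  assert (Hd : a / 2 <= Rabs d) by (rewrite Ed; nra).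
  assert (Hdd : d * d = Rabs d * Rabs d) by (rewrite <- Rabs_mult, Rabs_right; nra).
  assert (Hu : u * u = Rabs u * Rabs u) by (rewrite <- Rabs_mult, Rabs_right; nra).
  assert (Hl : Rabs d <= l).
  { destruct (Rle_dec (Rabs d) l) as [h|h]; [exact h|]. nra. }
  assert (Hl2 : a / 2 <= l) by lra. assert (Hlp : 0 < l) by lra.
  split.
  - assert (Es : q / a * (d / l) = Rabs d / l).
    { rewrite Ed, Ec. replace (q / a * (c * q / l)) with (c / l * ((q * q) / a)) by (field; lra).
      replace (q * q) with (a * a); [field; lra|]. unfold a. rewrite <- Rabs_mult, Rabs_right; nra. }
    rewrite Es. rewrite Rabs_left1; [|apply Rle_minus, Rle_div_l; lra].
    (* [1 - |d| / l] equals [(l - |d|) l / l^2], and [(l - |d|) l <= l^2 - d^2 = u^2]. *)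
    apply Rle_trans with ((u * u) / (l * l)).
    + apply Rle_div_r; [apply Rmult_lt_0_compat; exact Hlp|].
      replace (- (Rabs d / l - 1) * (l * l)) with ((l - Rabs d) * l) by (field; lra). nra.
    + apply Rle_div_l; [apply Rmult_lt_0_compat; exact Hlp|]. rewrite Hu.
      assert (0 <= Rabs u) by apply Rabs_pos.
      assert (Rabs u * Rabs u <= kmax * (a * a) * (kmax * (a * a))) by (apply Rmult_le_compat; assumption).
      assert (a / 2 * (a / 2) <= l * l) by (apply Rmult_le_compat; lra).
      assert (kmax * a * (kmax * (a * a * a)) <= 1 * (kmax * (a * a * a))).
      { apply Rmult_le_compat_r; [|exact Hq]. apply Rmult_le_pos; [lra|]. apply Rmult_le_pos; [apply Rmult_le_pos|]; lra. }
      assert (4 * kmax * a * (a / 2 * (a / 2)) <= 4 * kmax * a * (l * l)).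
      { apply Rmult_le_compat_l; [|assumption]. apply Rmult_le_pos; lra. }
      lra.
  - unfold Rdiv. rewrite Rabs_mult, Rabs_mult, Rabs_inv, (Rabs_right (l ^ 3)) by (apply Rle_ge, pow_le; lra).
    apply Rle_div_l; [apply pow_lt; exact Hlp|].
    assert (Rabs u * Rabs v <= kmax * (a * a) * (kmax * (a * a))).
    { apply Rmult_le_compat; auto using Rabs_pos. }
    assert (L3 : (a / 2) ^ 3 <= l ^ 3) by (apply pow_incr; lra).
    assert (8 * kmax * kmax * a * (a / 2) ^ 3 <= 8 * kmax * kmax * a * l ^ 3).
    { apply Rmult_le_compat_l; [|exact L3]. repeat apply Rmult_le_pos; lra. }
    replace (8 * kmax * kmax * a * (a / 2) ^ 3) with (kmax * (a * a) * (kmax * (a * a))) in H1 by field.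
    lra.
Qed.

Lemma len_continuity (s t : R) : continuity_2d_pt len s t.
Proof.
  unfold Lchord. cont2; first [apply X_cont|apply Y_cont].
Qed.

Lemma interior_locally (s r : R) (Q : R -> R -> Prop) : 0 < r < P ->
  (forall s r, 0 < r < P -> Q s r) -> locally_2d Q s r.
Proof.
  intros Hr HQ. assert (Hd : 0 < Rmin r (P - r)) by (apply Rmin_glb_lt; lra).
  exists (mkposreal _ Hd). simpl. intros u v _ Hv. apply HQ.
  apply Rabs_def2 in Hv. generalize (Rmin_l r (P - r)) (Rmin_r r (P - r)). lra.
Qed.

(** Gluing across [r = 0] and [r = P]: the edge values do not depend on [s] and the bound there is
    uniform in [s], so a Lipschitz estimate in [r] alone yields joint continuity. *)
Lemma strip_continuity (g h : R -> R -> R) (C d : R) :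
  0 < C -> 0 < d -> d <= P ->
  (forall s r, r <= 0 -> g s r = g 0 0) -> (forall s r, P <= r -> g s r = g 0 P) ->
  (forall s r, 0 < r < P -> g s r = h s r) ->
  (forall s r, 0 < r < P -> continuity_2d_pt h s r) ->
  (forall s r, 0 < r < d -> Rabs (g s r - g 0 0) <= C * Rabs r) ->
  (forall s r, P - d < r < P -> Rabs (g s r - g 0 P) <= C * Rabs (r - P)) ->
  forall s r, continuity_2d_pt g s r.
Proof.
  intros HC Hd HdP Hlo Hhi Hin Ch Hl Hr s r.
  destruct (Rle_dec r 0) as [h1|h1]; [|destruct (Rle_dec P r) as [h2|h2]].
  - apply (continuity_2d_pt_lipschitz g s r C d HC Hd). intros u v Hv. apply Rabs_def2 in Hv.
    rewrite (Hlo s r h1). destruct (Rle_dec v 0).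
    + rewrite (Hlo u v), Rminus_diag, Rabs_R0 by lra. apply Rmult_le_pos; [lra|apply Rabs_pos].
    + eapply Rle_trans; [apply Hl; lra|]. apply Rmult_le_compat_l; [lra|]. rewrite !Rabs_right; lra.
  - apply (continuity_2d_pt_lipschitz g s r C d HC Hd). intros u v Hv. apply Rabs_def2 in Hv.
    rewrite (Hhi s r h2). destruct (Rle_dec P v).
    + rewrite (Hhi u v), Rminus_diag, Rabs_R0 by lra. apply Rmult_le_pos; [lra|apply Rabs_pos].
    + eapply Rle_trans; [apply Hr; lra|]. apply Rmult_le_compat_l; [lra|]. rewrite !Rabs_left; lra.
  - apply (continuity_2d_pt_ext_loc h); [|apply Ch; lra].
    apply interior_locally; [lra|]. intros u v Huv. symmetry. apply Hin, Huv.
Qed.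

Lemma short_chords : exists km d, 0 < km /\ 0 < d /\ d <= P /\ forall s q, Rabs q < d -> q <> 0 ->
  Rabs (q / Rabs q * (dt s (s + q) / len s (s + q)) - 1) <= 4 * km * Rabs q /\
  Rabs (cr s (s + q) * cr (s + q) s / len s (s + q) ^ 3) <= 8 * km * km * Rabs q.
Proof.
  destruct kmax_exists as [km [Hk0 Hk]].
  assert (Hik : 0 < / km) by (apply Rinv_0_lt_compat, Hk0).
  exists km, (Rmin (/ km) P). split; [exact Hk0|].
  split; [apply Rmin_glb_lt; lra|split; [apply Rmin_r|]]. intros s q Hq.
  apply (short_chord km Hk0 Hk). assert (Rabs q <= / km) by (generalize (Rmin_l (/ km) P); lra).
  apply Rle_trans with (km * / km); [apply Rmult_le_compat_l; lra|]. right. field. lra.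
Qed.

Lemma slope_continuity (s r : R) : continuity_2d_pt slope s r.
Proof.
  destruct short_chords as (km & d & Hk & Hd & HdP & Sm).
  apply (strip_continuity slope (fun s r => - dt s (s + r) / len s (s + r)) (4 * km) d); try lra.
  - intros. rewrite !slope_lo; lra.
  - intros; rewrite !slope_hi; lra.
  - apply slope_in.
  - intros u v Huv. unfold dot_chord. cont2; try (first [apply X_cont|apply Y_cont|apply X1_cont|apply Y1_cont]).
    + apply len_continuity. + assert (L := len_pos u (u + v)). lra.
  - intros u v Hv. rewrite slope_in, (slope_lo 0 0) by lra.
    destruct (Sm u v) as [S _]; [rewrite Rabs_right; lra|lra|].
    rewrite (Rabs_right v) in S at 1 by lra. replace (v / v) with 1 in S by (field; lra).
    rewrite <- Rabs_Ropp. replace (- (- dt u (u + v) / len u (u + v) - -1)) with (1 * (dt u (u + v) / len u (u + v)) - 1);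
    [exact S|]. unfold Rdiv; ring.
  - intros u v Hv. rewrite slope_in, (slope_hi 0 P) by lra.
    destruct (Sm u (v - P)) as [S _]; [rewrite Rabs_left; lra|lra|].
    rewrite (Rabs_left (v - P)) in S at 1 by lra. replace ((v - P) / - (v - P)) with (-1) in S by (field; lra).
    rewrite <- (dt_shift_r u (u + (v - P))), <- (len_shift_r u (u + (v - P))) in S.
    replace (u + (v - P) + P) with (u + v) in S by ring.
    replace (- dt u (u + v) / len u (u + v) - 1) with (-1 * (dt u (u + v) / len u (u + v)) - 1);
    [exact S|]. unfold Rdiv; ring.
Qed.

Lemma dens_continuity (s r : R) : continuity_2d_pt dens s r.
Proof.
  destruct short_chords as (km & d & Hk & Hd & HdP & Sm).
  apply (strip_continuity dens (fun s r => cr s (s + r) * cr (s + r) s / len s (s + r) ^ 3) (8 * km * km) d); try lra.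
  - nra.
  - intros. rewrite !dens_lo; lra.
  - intros; rewrite !dens_hi; lra.
  - apply dens_in.
  - intros u v Huv. unfold cross_chord. cont2; try (first [apply X_cont|apply Y_cont|apply X1_cont|apply Y1_cont|apply len_continuity]).
    assert (L := len_pos u (u + v)). apply pow_nonzero. lra.
  - intros u v Hv. rewrite dens_in, (dens_lo 0 0), Rminus_0_r by lra.
    apply Sm; [rewrite Rabs_right; lra|lra].
  - intros u v Hv. rewrite dens_in, (dens_hi 0 P), Rminus_0_r by lra.
    destruct (Sm u (v - P)) as [_ S]; [rewrite Rabs_left; lra|lra|].
    rewrite <- (cr_shift_r u (u + (v - P))), <- (cr_shift_l (u + (v - P))), <- (len_shift_r u (u + (v - P))) in S.
    replace (u + (v - P) + P) with (u + v) in S by ring. exact S.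
Qed.

Lemma len_derive (s t : R) : 0 < len s t -> is_derive (len s) t (- dt t s / len s t).
Proof.
  intros Hl.
  assert (Hs : 0 < (X s - X t) ^ 2 + (Y s - Y t) ^ 2).
  { apply Rlt_le_trans with (len s t * len s t); [apply Rmult_lt_0_compat; exact Hl|].
    rewrite len_sqr. right. ring. }
  unfold Lchord. curve_derive H. unfold dot_chord.
  replace ((X s + - X t) * ((X s + - X t) * 1) + (Y s + - Y t) * ((Y s + - Y t) * 1))
    with ((X s - X t) ^ 2 + (Y s - Y t) ^ 2) by ring.
  field. apply Rgt_not_eq, sqrt_lt_R0, Hs.
Qed.

(** This identifies [dens] as the density: with [u = - cos phi] one has [du = sin phi dphi], and a
    chord with fixed foot turns at the rate [dphi / dr = sin psi / L]. *)
Lemma slope_derive (s r : R) : 0 < r < P -> is_derive (slope s) r (dens s r).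
Proof.
  intros Hr. assert (Hl : 0 < len s (s + r)) by (apply len_pos; lra).
  apply (is_derive_ext_loc (fun r => - dt s (s + r) / len s (s + r))).
  { assert (L := interior_locally s r (fun s r => - dt s (s + r) / len s (s + r) = slope s r) Hr).
    apply (locally_2d_1d_const_x (fun s r => - dt s (s + r) / len s (s + r) = slope s r) s r). apply L. intros u v Huv. symmetry. apply slope_in, Huv. }
  rewrite dens_in by exact Hr.
  assert (D1 : is_derive (fun r => dt s (s + r)) r (X1 s * X1 (s + r) + Y1 s * Y1 (s + r))).
  { apply is_derive_eq with (1 * cos (tau (s + r) - tau s)).
    - apply (is_derive_comp (dt s) (fun r => s + r)); [apply dt_derive_cos|]. auto_derive; [exact I|ring].
    - rewrite !HX1, !HY1, cos_minus. ring. }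
  assert (D2 : is_derive (fun r => len s (s + r)) r (- dt (s + r) s / len s (s + r))).
  { apply is_derive_eq with (1 * (- dt (s + r) s / len s (s + r))); [|ring].
    apply (is_derive_comp (len s) (fun r => s + r)); [apply len_derive, Hl|]. auto_derive; [exact I|ring]. }
  assert (T := two_frames s (s + r)).
  apply is_derive_eq with
   ((- (X1 s * X1 (s + r) + Y1 s * Y1 (s + r)) * len s (s + r)
      - - dt s (s + r) * (- dt (s + r) s / len s (s + r))) / len s (s + r) ^ 2).
  - apply (is_derive_div (fun r => - dt s (s + r)) (fun r => len s (s + r)) r
      (- (X1 s * X1 (s + r) + Y1 s * Y1 (s + r))) (- dt (s + r) s / len s (s + r))); [|exact D2|lra].
    apply (is_derive_opp (fun r => dt s (s + r))), D1.
  - set (l := len s (s + r)) in *. set (c := X1 s * X1 (s + r) + Y1 s * Y1 (s + r)) in *.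
    replace (cr s (s + r) * cr (s + r) s) with (- c * (l * l) - dt s (s + r) * dt (s + r) s) by lra.
    field. lra.
Qed.

Lemma slope_mono (s a b : R) : 0 <= a -> a < b -> b <= P -> slope s a < slope s b.
Proof.
  intros Ha Hab Hb. apply (strictly_increasing_open (slope s) (dens s)); auto.
  - intros x Hx. apply slope_derive; lra. - intros x Hx. apply dens_pos; lra.
  - intros x _. apply continuity_2d_pt_section_r, slope_continuity.
Qed.

Lemma slope_bounds (s r : R) : -1 <= slope s r <= 1.
Proof.
  destruct (Rle_dec r 0); [rewrite slope_lo; lra|]. destruct (Rle_dec P r); [rewrite slope_hi; lra|].
  assert (S1 := slope_mono s 0 r). assert (S2 := slope_mono s r P).
  rewrite (slope_lo s 0) in S1 by lra. rewrite (slope_hi s P) in S2 by lra. lra.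
Qed.

Lemma reach_exists (s u : R) : exists r, 0 <= r <= P /\ slope s r = clamp (-1) 1 u.
Proof.
  assert (C := clamp_in (-1) 1 u ltac:(lra)).
  apply intermediate_value; [|lra|rewrite (slope_lo s 0), (slope_hi s P) by lra; lra].
  intros x. apply continuity_2d_pt_section_r, slope_continuity.
Qed.

(* Arclength to the next bounce point, as a function of s and u = - cos phi. *)
Definition reach (s u : R) : R := choose (reach_exists s u).

Lemma reach_spec (s u : R) : 0 <= reach s u <= P /\ slope s (reach s u) = clamp (-1) 1 u.
Proof. exact (choose_spec (reach_exists s u)). Qed.

Lemma slope_inj (s a b : R) : 0 <= a <= P -> 0 <= b <= P -> slope s a = slope s b -> a = b.
Proof.
  intros Ha Hb E. destruct (Rtotal_order a b) as [h|[h|h]]; [|exact h|].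
  - assert (T := slope_mono s a b). lra. - assert (T := slope_mono s b a). lra.
Qed.

Lemma reach_slope (s r : R) : 0 <= r <= P -> reach s (slope s r) = r.
Proof.
  intros Hr. destruct (reach_spec s (slope s r)) as [R1 R2].
  rewrite clamp_id in R2 by apply slope_bounds. apply (slope_inj s); assumption.
Qed.

Lemma reach_lo (s : R) : reach s (-1) = 0.
Proof. rewrite <- (slope_lo s 0) by lra. apply reach_slope. lra. Qed.

Lemma reach_hi (s : R) : reach s 1 = P.
Proof. rewrite <- (slope_hi s P) by lra. apply reach_slope. lra. Qed.

Lemma reach_shift (s u : R) : reach (s + P) u = reach s u.
Proof.
  destruct (reach_spec s u) as [R1 R2]. destruct (reach_spec (s + P) u) as [R3 R4].
  apply (slope_inj s); auto. rewrite <- slope_shift. congruence.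
Qed.

Lemma reach_continuity (s u : R) : continuity_2d_pt reach s u.
Proof.
  apply continuity_2d_pt_filterlim.
  apply (continuous_root (T := prod_UniformSpace R_UniformSpace R_UniformSpace)
    (fun z => reach (fst z) (snd z)) (fun z r => slope (fst z) r - clamp (-1) 1 (snd z)) 0 P (s, u)).
  - apply filter_forall. intros [s' u']. simpl. destruct (reach_spec s' u') as [R1 R2].
    split; [exact R1|]. intros r Hr. rewrite <- R2. split; intros Hlt.
    + assert (T := slope_mono s' r (reach s' u')). lra.
    + assert (T := slope_mono s' (reach s' u') r). lra.
  - intros r.
    apply (continuity_2d_pt_filterlim (fun s u => slope s r - clamp (-1) 1 u) s u).
    cont2; [apply slope_continuity|apply clamp_continuous].
Qed.

Lemma int_slope (h : R -> R) (s : R) : (forall u, continuous h u) ->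
  int h (-1) 1 = int (fun r => h (slope s r) * dens s r) 0 P.
Proof.
  intros Ch.
  assert (Cs : forall r, continuous (slope s) r) by (intros; apply continuity_2d_pt_section_r, slope_continuity).
  rewrite (int_derive_open (fun r => int h (-1) (slope s r)) (fun r => h (slope s r) * dens s r) 0 P).
  - rewrite (slope_lo s 0), (slope_hi s P), int_refl by lra. ring.
  - lra.
  - intros r Hr. apply is_derive_eq with (dens s r * h (slope s r)); [|ring].
    apply (is_derive_comp (int h (-1)) (slope s)); [apply int_is_derive, Ch|apply slope_derive, Hr].
  - intros r _. apply (continuous_comp (slope s) (int h (-1))); [apply Cs|].
    apply (is_derive_continuous (int_is_derive h (-1) _ Ch)).
  - intros r _. apply (continuous_mult (fun r => h (slope s r)) (dens s)).
    + apply (continuous_comp (slope s) h); [apply Cs|apply Ch].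
    + apply continuity_2d_pt_section_r, dens_continuity.
Qed.

End Chords.

(** * The billiard map preserves the measure *)

Lemma int_comp_sub (g : R -> R) (c a b : R) :
  (forall x, continuous g x) -> a <= b ->
  int (fun x => g (c - x)) a b = int g (c - b) (c - a).
Proof.
  intros Cg Hab.
  assert (D : forall x, is_derive (fun x => - int g (c - b) (c - x)) x (g (c - x))).
  { intros x. apply is_derive_eq with (- (-1 * g (c - x))); [|ring].
    apply (is_derive_opp (fun x => int g (c - b) (c - x))).
    apply (is_derive_comp (int g (c - b)) (fun x => c - x)); [apply int_is_derive, Cg|].
    auto_derive; [exact I|ring]. }
  rewrite (int_derive_open (fun x => - int g (c - b) (c - x)) (fun x => g (c - x)) a b Hab).
  - rewrite int_refl. ring.
  - intros; apply D.
  - intros x _. apply (is_derive_continuous (D x)).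
  - intros x _. cont1. apply Cg.
Qed.

Lemma int_period_shift (g : R -> R) (P r : R) :
  0 < P -> (forall x, continuous g x) -> (forall x, g (x + P) = g x) ->
  int (fun s => g (s + r)) 0 P = int g 0 P.
Proof.
  intros HP Cg Pg.
  assert (D : forall c x, is_derive (fun x => int g 0 (x + c)) x (g (x + c))).
  { intros c x. apply is_derive_eq with (1 * g (x + c)); [|ring].
    apply (is_derive_comp (int g 0) (fun x => x + c)); [apply int_is_derive, Cg|]. auto_derive; [exact I|ring]. }
  rewrite (int_derive_open (fun s => int g 0 (s + r)) (fun s => g (s + r)) 0 P); [|lra| | |].
  - assert (E : int g 0 (r + P) - int g 0 r = int g 0 (0 + P) - int g 0 0).
    { apply (constant_of_derive_zero (fun r => int g 0 (r + P) - int g 0 r)). intros x.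
      apply is_derive_eq with (g (x + P) - g x); [|rewrite Pg; ring].
      apply is_derive_sub; [apply D|apply int_is_derive, Cg]. }
    rewrite int_refl in E. rewrite Rplus_0_l in E. rewrite Rplus_0_l, (Rplus_comm P r). lra.
  - intros; apply D.
  - intros x _. apply (is_derive_continuous (D r x)).
  - intros x _. cont1. apply Cg.
Qed.

Section Invariance.

Context {P kmin : R} {X Y X1 Y1 k tau : R -> R}.
Context (H : oval P kmin X Y X1 Y1 k) (A : tangent_angle X1 Y1 k tau).

Notation slope := (@slope P X Y X1 Y1).
Notation dens := (@dens P X Y X1 Y1).
Notation reach := (reach H A).

Let HP := oval_P H.

Definition phase_int (F : R -> R -> R) : R := int (fun s => int (F s) (-1) 1) 0 P.

(* Composition with the billiard map in the coordinates (s, u), u = - cos phi; at the arrival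
   point - cos psi is minus the slope of the reversed chord. *)
Definition bounce_pullback (F : R -> R -> R) (s u : R) : R :=
  F (s + reach s u) (- slope (s + reach s u) (P - reach s u)).

Let slope_c := slope_continuity H A.
Let dens_c := dens_continuity H A.
Let reach_c := reach_continuity H A.

Lemma after_bounce_continuity (F : R -> R -> R) :
  (forall s u, continuity_2d_pt F s u) -> forall s u, continuity_2d_pt (bounce_pullback F) s u.
Proof.
  intros CF s u. unfold bounce_pullback. cont2; auto.
Qed.

Lemma after_bounce_shift (F : R -> R -> R) :
  (forall s u, F (s + P) u = F s u) -> forall s u, bounce_pullback F (s + P) u = bounce_pullback F s u.
Proof.
  intros PF s u. unfold bounce_pullback. rewrite reach_shift.
  replace (s + P + reach s u) with (s + reach s u + P) by ring.
  rewrite PF, (slope_shift H). reflexivity.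
Qed.

Lemma phase_int_slope (F : R -> R -> R) :
  (forall s u, continuity_2d_pt F s u) ->
  phase_int F = int (fun s => int (fun r => F s (slope s r) * dens s r) 0 P) 0 P.
Proof.
  intros CF. unfold phase_int. apply int_ext; [lra|]. intros s _.
  apply (int_slope H A).
  intros u. apply continuity_2d_pt_section_r, CF.
Qed.

(** In the coordinates [(s, r)] the arrival point is [s + r]; for fixed [r] this is a translation of
    [s], absorbed by periodicity after exchanging the integrals. The remaining substitutions of
    [P - r] for [r] and [- u] for [u] undo the reversal of the chord. *)
Lemma phase_int_after_bounce (F : R -> R -> R) :
  (forall s u, continuity_2d_pt F s u) -> (forall s u, F (s + P) u = F s u) ->
  phase_int (bounce_pullback F) = phase_int F.
Proof.
  intros CF PF.
  rewrite phase_int_slope by (apply after_bounce_continuity, CF).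
  set (G := fun s r => F s (- slope s (P - r)) * dens s (P - r)).
  assert (CG : forall s r, continuity_2d_pt G s r) by (intros; unfold G; cont2; auto).
  transitivity (int (fun s => int (fun r => G (s + r) r) 0 P) 0 P).
  { apply int_ext; [lra|]. intros s _. apply int_ext; [lra|]. intros r Hr.
    unfold bounce_pullback, G. rewrite reach_slope, (dens_reverse H) by lra. reflexivity. }
  rewrite (Fubini (fun s r => G (s + r) r) 0 P 0 P); [|lra|lra|].
  2:{ intros s r _ _. apply (continuity_2d_pt_comp G (fun s r => s + r) (fun _ r => r)); [apply CG|cont2|cont2]. }
  transitivity (int (fun r => int (fun s => G s r) 0 P) 0 P).
  { apply int_ext; [lra|]. intros r _. apply (int_period_shift (fun s => G s r)); [exact HP| |].
    - intros s. apply (continuity_2d_pt_section_l G), CG.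
    - intros s. unfold G. rewrite PF, (slope_shift H), (dens_shift H). reflexivity. }
  rewrite <- (Fubini G 0 P 0 P) by (auto; lra).
  unfold phase_int. apply int_ext; [lra|]. intros s _.
  assert (CFs : forall u, continuous (F s) u) by (intros; apply continuity_2d_pt_section_r, CF).
  transitivity (int (fun r => F s (- slope s r) * dens s r) 0 P).
  { unfold G. rewrite (int_comp_sub (fun r => F s (- slope s r) * dens s r) P 0 P); [|intros r|lra].
    - rewrite Rminus_diag, Rminus_0_r. reflexivity.
    - apply (continuity_2d_pt_section_r (fun s' r => F s (- slope s' r) * dens s' r) s).
      apply (continuity_2d_pt_mult (fun s' r => F s (- slope s' r)) dens); [|apply dens_c].
      apply (continuity_2d_pt_comp1 (F s) (fun s r => - slope s r)); [apply CFs|cont2; apply slope_c]. }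
  rewrite <- (int_slope H A (fun u => F s (- u))).
  - rewrite (int_ext (fun u => F s (- u)) (fun u => F s (0 - u))); [|lra|intros; f_equal; ring].
    rewrite (int_comp_sub (F s)); [|exact CFs|lra]. f_equal; ring.
  - intros u. cont1. apply CFs.
Qed.

End Invariance.

(** * Santalo's formula and the isoperimetric inequality *)

Section Area.

Context {P kmin : R} {X Y X1 Y1 k tau : R -> R}.
Context (H : oval P kmin X Y X1 Y1 k) (A : tangent_angle X1 Y1 k tau).

Notation cr := (@cross_chord X Y X1 Y1).
Notation dt := (@dot_chord X Y X1 Y1).
Notation len := (Lchord X Y).
Notation slope := (@slope P X Y X1 Y1).
Notation dens := (@dens P X Y X1 Y1).

Let HP := oval_P H.

(** The form [x dy - y dx]. Half its integral over a period is taken as the area; agreement with the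
    outer measure of [inside] is established separately. *)
Definition area_form (w : R) : R := X w * Y1 w - Y w * X1 w.
Definition sweep (t : R) : R := int area_form 0 t.
Definition area : R := / 2 * sweep P.

(* Area between the arc from s to t and its chord. *)
Definition segment (s t : R) : R := / 2 * (sweep t - sweep s - X s * Y t + Y s * X t).

(** Kept free of square roots so that the derivatives of the turning speeds are rational
    expressions. *)
Definition sqd (s t : R) : R := (X t - X s) * (X t - X s) + (Y t - Y s) * (Y t - Y s).

Lemma area_form_continuous (w : R) : continuous area_form w.
Proof.
  unfold area_form. cont1; first [apply (X_cont H)|apply (Y_cont H)|apply (X1_cont H)|apply (Y1_cont H)].
Qed.

Lemma sweep_derive (t : R) : is_derive sweep t (area_form t).
Proof. exact (int_is_derive area_form 0 t area_form_continuous). Qed.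

Lemma sweep_shift (t : R) : sweep (t + P) - sweep t = 2 * area.
Proof.
  assert (E : sweep (t + P) - sweep t = sweep (0 + P) - sweep 0).
  { apply (constant_of_derive_zero (fun t => sweep (t + P) - sweep t)). intros x.
    apply is_derive_eq with (1 * area_form (x + P) - area_form x).
    - apply is_derive_sub; [|apply sweep_derive].
      apply (is_derive_comp sweep (fun t => t + P)); [apply sweep_derive|]. auto_derive; [exact I|ring].
    - unfold area_form. rewrite (oval_pX H), (oval_pY H), (oval_pX1 H), (oval_pY1 H). ring. }
  rewrite E, Rplus_0_l. unfold area. unfold sweep at 2. rewrite int_refl. field.
Qed.

Ltac area_derive := curve_derive H; use_derivative sweep_derive.

(* Speeds at which the direction of the chord from s to s + r turns with s and with r.  The form
   [segment] * d(direction) has exterior derivative sin phi sin psi dr ds; it vanishes at r = 0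
   and is [area] * d tau at r = P. *)
Definition turn_s (s r : R) : R := (cr s (s + r) + cr (s + r) s) / sqd s (s + r).
Definition turn_r (s r : R) : R := cr (s + r) s / sqd s (s + r).

(** Together with [flux_s], the two partial derivatives entering the exterior derivative of the
    form, expanded by the product and quotient rules. *)
Definition flux_r (s r : R) : R :=
  / 2 * cr (s + r) s * turn_s s r + segment s (s + r) *
  (((X1 s * Y1 (s + r) - Y1 s * X1 (s + r) - k (s + r) * dt (s + r) s) * sqd s (s + r)
    + 2 * (cr s (s + r) + cr (s + r) s) * dt (s + r) s) / sqd s (s + r) ^ 2).

Definition flux_s (s r : R) : R :=
  / 2 * (cr (s + r) s - cr s (s + r)) * turn_r s r + segment s (s + r) *
  (((X1 (s + r) * Y1 s - Y1 (s + r) * X1 s - k (s + r) * dt (s + r) s) * sqd s (s + r)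
    + 2 * cr (s + r) s * (dt (s + r) s + dt s (s + r))) / sqd s (s + r) ^ 2).

Lemma sqd_len (s t : R) : sqd s t = len s t * len s t.
Proof. rewrite len_sqr. reflexivity. Qed.

Lemma sqd_pos (s r : R) : 0 < r < P -> 0 < sqd s (s + r).
Proof. intros Hr. rewrite sqd_len. assert (L := len_pos H A s (s + r)). nra. Qed.

Lemma flux_r_derive (s r : R) : 0 < r < P ->
  is_derive (fun r => segment s (s + r) * turn_s s r) r (flux_r s r).
Proof.
  intros Hr. assert (L := sqd_pos s r Hr).
  unfold segment, turn_s, flux_r, turn_s, segment, cross_chord, dot_chord, sqd in *. area_derive; [simpl in L |- *; lra|].
  unfold area_form. field. lra.
Qed.

Lemma flux_s_derive (s r : R) : 0 < r < P ->
  is_derive (fun s => segment s (s + r) * turn_r s r) s (flux_s s r).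
Proof.
  intros Hr. assert (L := sqd_pos s r Hr).
  unfold segment, turn_r, flux_s, turn_r, segment, cross_chord, dot_chord, sqd in *. area_derive; [simpl in L |- *; lra|].
  unfold area_form. field. lra.
Qed.

(** The terms carrying [segment] cancel because the chord direction is a function whose mixed
    derivatives agree; algebraically this is [two_frames_cross]. What remains comes from
    differentiating [segment] itself. *)
Lemma flux_difference (s r : R) : 0 < r < P ->
  flux_r s r - flux_s s r = cr s (s + r) * cr (s + r) s / sqd s (s + r).
Proof.
  intros Hr. assert (L := sqd_pos s r Hr). assert (T := @two_frames_cross X Y X1 Y1 s (s + r)).
  rewrite <- sqd_len in T. unfold flux_r, flux_s, turn_s, turn_r.
  set (S := segment s (s + r)). set (u := cr s (s + r)) in *. set (v := cr (s + r) s) in *.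
  set (a := dt s (s + r)) in *. set (b := dt (s + r) s) in *. set (q := sqd s (s + r)) in *.
  set (m := Y1 (s + r) * X1 s - X1 (s + r) * Y1 s) in *.
  replace (X1 s * Y1 (s + r) - Y1 s * X1 (s + r)) with m by (unfold m; ring).
  replace (X1 (s + r) * Y1 s - Y1 (s + r) * X1 s) with (- m) by (unfold m; ring).
  transitivity (u * v / q + S * 2 * ((m * q - (v * a - u * b)) / q ^ 2)).
  - field. lra. - rewrite T. field. lra.
Qed.

Lemma segment_continuity (s t : R) : continuity_2d_pt segment s t.
Proof.
  unfold segment. cont2; first [apply (X_cont H)|apply (Y_cont H)|apply (is_derive_continuous (sweep_derive _))].
Qed.

Lemma cr_continuity (s t : R) : continuity_2d_pt cr s t.
Proof. unfold cross_chord. cont2; first [apply (X_cont H)|apply (Y_cont H)|apply (X1_cont H)|apply (Y1_cont H)]. Qed.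

Lemma dt_continuity (s t : R) : continuity_2d_pt dt s t.
Proof. unfold dot_chord. cont2; first [apply (X_cont H)|apply (Y_cont H)|apply (X1_cont H)|apply (Y1_cont H)]. Qed.

Lemma sqd_continuity (s t : R) : continuity_2d_pt sqd s t.
Proof. unfold sqd. cont2; first [apply (X_cont H)|apply (Y_cont H)]. Qed.

Lemma turn_s_continuity (s r : R) : 0 < r < P -> continuity_2d_pt turn_s s r.
Proof.
  intros Hr. assert (L := sqd_pos s r Hr). unfold turn_s.
  cont2; first [apply cr_continuity|apply sqd_continuity|lra].
Qed.

Lemma flux_r_continuity (s r : R) : 0 < r < P -> continuity_2d_pt flux_r s r.
Proof.
  intros Hr. assert (L := sqd_pos s r Hr). unfold flux_r.
  cont2; first [apply cr_continuity|apply sqd_continuity|apply dt_continuity|apply segment_continuity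
    |apply (turn_s_continuity s r Hr)|apply (X1_cont H)|apply (Y1_cont H)|apply (oval_ck H)|idtac].
  apply pow_nonzero. lra.
Qed.

Lemma flux_s_continuity (s r : R) : 0 < r < P -> continuity_2d_pt flux_s s r.
Proof.
  intros Hr. assert (L := sqd_pos s r Hr). unfold flux_s, turn_r.
  cont2; first [apply cr_continuity|apply sqd_continuity|apply dt_continuity|apply segment_continuity
    |apply (X1_cont H)|apply (Y1_cont H)|apply (oval_ck H)|lra|idtac].
  apply pow_nonzero. lra.
Qed.

Lemma segment_shift (s r : R) : segment (s + P) (s + P + r) = segment s (s + r).
Proof.
  unfold segment. replace (s + P + r) with (s + r + P) by ring.
  rewrite !(oval_pX H), !(oval_pY H). generalize (sweep_shift s) (sweep_shift (s + r)). lra.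
Qed.

Lemma turn_r_shift (s r : R) : turn_r (s + P) r = turn_r s r.
Proof.
  unfold turn_r, sqd. replace (s + P + r) with (s + r + P) by ring.
  rewrite (cr_shift_l H), (cr_shift_r H), !(oval_pX H), !(oval_pY H). reflexivity.
Qed.

Definition flux (r : R) : R := int (fun s => segment s (s + r) * turn_s s r) 0 P.

(** Green's theorem on the strip between [r1] and [r2]; the [s]-derivative integrates to zero over a
    period. The edges are avoided because the turning speeds are quotients by the squared chord
    length. *)
Lemma flux_increment (r1 r2 : R) : 0 < r1 -> r1 <= r2 -> r2 < P ->
  int (fun s => int (fun r => cr s (s + r) * cr (s + r) s / sqd s (s + r)) r1 r2) 0 P = flux r2 - flux r1.
Proof.
  intros H1 H12 H2.
  assert (Cr : forall s r, 0 <= s <= P -> r1 <= r <= r2 -> continuity_2d_pt flux_r s r)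
    by (intros; apply flux_r_continuity; lra).
  assert (Cs : forall s r, 0 <= s <= P -> r1 <= r <= r2 -> continuity_2d_pt flux_s s r)
    by (intros; apply flux_s_continuity; lra).
  transitivity (int (fun s => int (flux_r s) r1 r2 - int (flux_s s) r1 r2) 0 P).
  { apply int_ext; [lra|]. intros s Hs.
    rewrite <- int_minus.
    - apply int_ext; [exact H12|]. intros r Hr. symmetry. apply flux_difference. lra.
    - apply ex_int_cont_on; [|exact H12]. intros r Hr. apply continuity_2d_pt_section_r, Cr; lra.
    - apply ex_int_cont_on; [|exact H12]. intros r Hr. apply continuity_2d_pt_section_r, Cs; lra. }
  rewrite int_minus by (apply ex_int_param; auto; lra).
  rewrite (Fubini flux_s 0 P r1 r2) by (auto; lra).
  assert (Z : int (fun r => int (fun s => flux_s s r) 0 P) r1 r2 = 0).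
  { rewrite (int_ext _ (fun _ => 0)); [rewrite int_const; ring|exact H12|]. intros r Hr.
    rewrite (int_derive_open (fun s => segment s (s + r) * turn_r s r) (fun s => flux_s s r) 0 P).
    - assert (E1 := segment_shift 0 r). assert (E2 := turn_r_shift 0 r).
      rewrite (Rplus_0_l P) in E1, E2. rewrite E1, E2. ring.
    - lra.
    - intros s Hs. apply flux_s_derive. lra.
    - intros s Hs. apply (is_derive_continuous (flux_s_derive s r ltac:(lra))).
    - intros s Hs. apply (continuity_2d_pt_section_l flux_s). apply Cs; lra. }
  rewrite Z, Rminus_0_r. unfold flux.
  assert (Ct : forall s r, 0 < r < P -> continuity_2d_pt (fun s r => segment s (s + r) * turn_s s r) s r).
  { intros s r Hr. apply (continuity_2d_pt_mult (fun s r => segment s (s + r)) turn_s);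
    [cont2; apply segment_continuity|apply turn_s_continuity, Hr]. }
  rewrite <- int_minus.
  - apply int_ext; [lra|]. intros s Hs.
    apply (int_derive_open (fun r => segment s (s + r) * turn_s s r) (flux_r s) r1 r2 H12).
    + intros r Hr. apply flux_r_derive. lra.
    + intros r Hr. apply (is_derive_continuous (flux_r_derive s r ltac:(lra))).
    + intros r Hr. apply continuity_2d_pt_section_r. apply Cr; lra.
  - apply ex_int_cont. intros s. apply (continuity_2d_pt_section_l (fun s r => segment s (s + r) * turn_s s r)), Ct. lra.
  - apply ex_int_cont. intros s. apply (continuity_2d_pt_section_l (fun s r => segment s (s + r) * turn_s s r)), Ct. lra.
Qed.

Lemma acos_derive (f : R -> R) (x l : R) : -1 < f x < 1 -> is_derive f x l ->
  is_derive (fun t => acos (f t)) x (- l / sqrt (1 - f x * f x)).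
Proof.
  intros Hf D. apply is_derive_eq with (l * (-1 / sqrt (1 - (f x)²))); [|unfold Rdiv, Rsqr; ring].
  apply (is_derive_comp acos f); [|exact D]. apply is_derive_Reals.
  rewrite <- (derive_pt_acos (f x) Hf). apply derive_pt_eq_1 with (derivable_pt_acos (f x) Hf). reflexivity.
Qed.

Lemma sqrt_one_minus_cosine (s r : R) : 0 < r < P ->
  sqrt (1 - dt s (s + r) / len s (s + r) * (dt s (s + r) / len s (s + r))) = cr s (s + r) / len s (s + r).
Proof.
  intros Hr. assert (L := len_pos H A s (s + r) ltac:(lra)). assert (C := cr_pos_r H A s (s + r) ltac:(lra)).
  assert (F := len_frame H s (s + r)).
  set (l := len s (s + r)) in *. set (d := dt s (s + r)) in *. set (u := cr s (s + r)) in *.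
  replace (1 - d / l * (d / l)) with (u / l * (u / l)).
  - apply sqrt_square. left. apply Rdiv_lt_0_compat; assumption.
  - apply Rminus_diag_uniq. replace (u / l * (u / l) - (1 - d / l * (d / l))) with ((u * u + d * d - l * l) / (l * l)) by (field; lra).
    rewrite F. unfold Rdiv. ring.
Qed.

Lemma cosine_strict (s r : R) : 0 < r < P -> -1 < dt s (s + r) / len s (s + r) < 1.
Proof.
  intros Hr. assert (L := len_pos H A s (s + r) ltac:(lra)). assert (C := cr_pos_r H A s (s + r) ltac:(lra)).
  assert (F := len_frame H s (s + r)). split; [apply Rlt_div_r|apply Rlt_div_l]; nra.
Qed.

(* tau s + phi is the direction of the chord, hence the term - k s. *)
Lemma chord_direction_derive (s r : R) : 0 < r < P ->
  is_derive (fun s => acos (dt s (s + r) / len s (s + r))) s (turn_s s r - k s).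
Proof.
  intros Hr. assert (L := len_pos H A s (s + r) ltac:(lra)). assert (C := cr_pos_r H A s (s + r) ltac:(lra)).
  assert (F := len_frame H s (s + r)). assert (T := @two_frames X Y X1 Y1 s (s + r)).
  assert (D1 : is_derive (fun s => dt s (s + r)) s
     (k s * cr s (s + r) + (X1 s * X1 (s + r) + Y1 s * Y1 (s + r)) - 1)).
  { rewrite <- (oval_unit H s). unfold dot_chord, cross_chord. curve_derive H. ring. }
  assert (D2 : is_derive (fun s => len s (s + r)) s (- (dt (s + r) s + dt s (s + r)) / len s (s + r))).
  { assert (S := sqd_pos s r Hr). unfold sqd in S. unfold Lchord in *. curve_derive H; [simpl in S |- *; lra|].
    unfold dot_chord.
    replace ((X s + - X (s + r)) * ((X s + - X (s + r)) * 1) + (Y s + - Y (s + r)) * ((Y s + - Y (s + r)) * 1))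
      with ((X s - X (s + r)) ^ 2 + (Y s - Y (s + r)) ^ 2) by ring.
      field. lra. }
  assert (D3 := is_derive_div (fun s => dt s (s + r)) (fun s => len s (s + r)) s _ _ D1 D2 ltac:(lra)).
  assert (D4 := acos_derive _ s _ (cosine_strict s r Hr) D3). cbv beta in D4.
  eapply is_derive_eq; [exact D4|].
  rewrite (sqrt_one_minus_cosine s r Hr). unfold turn_s. rewrite sqd_len.
  set (l := len s (s + r)) in *. set (d := dt s (s + r)) in *. set (u := cr s (s + r)) in *.
  set (v := cr (s + r) s) in *. set (b := dt (s + r) s) in *. set (c := X1 s * X1 (s + r) + Y1 s * Y1 (s + r)) in *.
  transitivity (- ((k s * u) * (l * l) + (c * (l * l) + d * b) - (l * l - d * d)) / (u * (l * l))).
  - field. lra.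
  - replace (c * (l * l) + d * b) with (- (u * v)) by lra. rewrite F. replace (u * u + d * d - d * d) with (u * u) by ring.
    field. rewrite <- F. split; nra.
Qed.

(** The chord direction is [tau s + phi] with [phi] given by [acos], a single-valued periodic
    function of [s]; over a period it gains exactly what [tau] gains. *)
Lemma total_chord_turning (r : R) : 0 < r < P -> int (fun s => turn_s s r) 0 P = 2 * PI.
Proof.
  intros Hr.
  assert (D : forall s, is_derive (fun s => tau s + acos (dt s (s + r) / len s (s + r))) s (turn_s s r)).
  { intros s. apply is_derive_eq with (k s + (turn_s s r - k s)); [|ring].
    apply (is_derive_plus tau (fun s => acos (dt s (s + r) / len s (s + r)))); [apply (angle_derive A)|].
    apply chord_direction_derive, Hr. }
  rewrite (int_derive_open _ _ 0 P (Rlt_le _ _ HP) (fun x _ => D x)).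
  - assert (T := turning H A 0). rewrite Rplus_0_l in T. rewrite T.
    replace (dt P (P + r)) with (dt 0 (0 + r)).
    + replace (len P (P + r)) with (len 0 (0 + r)); [ring|].
      replace (P + r) with (0 + r + P) by ring. rewrite <- (Rplus_0_l P) at 1.
      rewrite (len_shift_l H), (len_shift_r H). reflexivity.
    + replace (P + r) with (0 + r + P) by ring. rewrite <- (Rplus_0_l P) at 1.
      rewrite (dt_shift_l H), (dt_shift_r H). reflexivity.
  - intros s _. apply (is_derive_continuous (D s)).
  - intros s _. apply (continuity_2d_pt_section_l turn_s). apply turn_s_continuity, Hr.
Qed.

Lemma turn_s_pos (s r : R) : 0 < r < P -> 0 < turn_s s r.
Proof.
  intros Hr. apply Rdiv_lt_0_compat; [|apply sqd_pos, Hr].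
  generalize (cr_pos_r H A s (s + r)) (cr_pos_l H A s (s + r)). lra.
Qed.

Lemma segment_derive (s r : R) : is_derive (fun r => segment s (s + r)) r (/ 2 * cr (s + r) s).
Proof.
  unfold segment, cross_chord. area_derive. unfold area_form. field.
Qed.

Lemma segment_0 (s : R) : segment s (s + 0) = 0.
Proof. unfold segment. rewrite Rplus_0_r. ring. Qed.

Lemma segment_P (s : R) : segment s (s + P) = area.
Proof. unfold segment. rewrite (oval_pX H), (oval_pY H). generalize (sweep_shift s). lra. Qed.

Lemma cr_bounded : exists C, 0 < C /\ forall s t, Rabs (cr s t) <= C.
Proof.
  destruct (periodic_bounded X P HP (X_cont H) (oval_pX H)) as [M1 [HM1 B1]].
  destruct (periodic_bounded Y P HP (Y_cont H) (oval_pY H)) as [M2 [HM2 B2]].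
  exists (2 * M2 + 2 * M1). split; [lra|]. intros s t. unfold cross_chord.
  assert (U := oval_unit H s).
  assert (U1 : Rabs (X1 s) <= 1) by (apply Rabs_le; nra).
  assert (U2 : Rabs (Y1 s) <= 1) by (apply Rabs_le; nra).
  assert (E1 : Rabs (X1 s * (Y t - Y s)) <= 1 * (2 * M2)).
  { rewrite Rabs_mult. apply Rmult_le_compat; auto using Rabs_pos.
    eapply Rle_trans; [apply Rabs_triang|]. rewrite Rabs_Ropp. generalize (B2 t) (B2 s). lra. }
  assert (E2 : Rabs (Y1 s * (X t - X s)) <= 1 * (2 * M1)).
  { rewrite Rabs_mult. apply Rmult_le_compat; auto using Rabs_pos.
    eapply Rle_trans; [apply Rabs_triang|]. rewrite Rabs_Ropp. generalize (B1 t) (B1 s). lra. }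
  eapply Rle_trans; [apply Rabs_triang|]. rewrite Rabs_Ropp. lra.
Qed.

Lemma segment_lipschitz : exists C, 0 < C /\ forall s r r', Rabs (segment s (s + r') - segment s (s + r)) <= C * Rabs (r' - r).
Proof.
  destruct cr_bounded as [C [HC B]]. exists C. split; [exact HC|]. intros s r r'.
  destruct (mean_value _ _ r r' (segment_derive s)) as [c [_ ->]].
  rewrite Rabs_mult. apply Rmult_le_compat_r; [apply Rabs_pos|].
  rewrite Rabs_mult, (Rabs_right (/ 2)) by lra. generalize (B (s + c) s) (Rabs_pos (cr (s + c) s)). lra.
Qed.

(** [flux r] averages segment areas against the positive weight [turn_s] of total mass [2 PI];
    uniform closeness of the areas to [a] therefore suffices, whatever the size of [turn_s] near the
    edges. *)
Lemma flux_near (C e r a : R) : 0 < r < P -> 0 <= C ->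
  (forall s, Rabs (segment s (s + r) - a) <= C * e) -> Rabs (flux r - 2 * PI * a) <= C * e * (2 * PI).
Proof.
  intros Hr HC Hs.
  assert (Ct : forall s, continuous (fun s => turn_s s r) s).
  { intros s. apply (continuity_2d_pt_section_l turn_s), turn_s_continuity, Hr. }
  assert (Cf : forall s, continuous (fun s => segment s (s + r) * turn_s s r) s).
  { intros s. apply (continuity_2d_pt_section_l (fun s r => segment s (s + r) * turn_s s r)).
    apply (continuity_2d_pt_mult (fun s r => segment s (s + r)) turn_s);
    [cont2; apply segment_continuity|apply turn_s_continuity, Hr]. }
  assert (Cc : forall c s, continuous (fun s => c * turn_s s r) s).
  { intros c s. apply (continuous_mult (fun _ => c)); [apply continuous_const|apply Ct]. }
  assert (Up : flux r <= (a + C * e) * (2 * PI)).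
  { rewrite <- (total_chord_turning r Hr), <- int_scal by (apply ex_int_cont, Ct).
    apply int_le; [lra|apply ex_int_cont, Cf|apply ex_int_cont, Cc|]. intros s _.
    apply Rmult_le_compat_r; [left; apply turn_s_pos, Hr|]. specialize (Hs s). apply Rabs_le_between in Hs. lra. }
  assert (Lo : (a - C * e) * (2 * PI) <= flux r).
  { rewrite <- (total_chord_turning r Hr), <- int_scal by (apply ex_int_cont, Ct).
    apply int_le; [lra|apply ex_int_cont, Cc|apply ex_int_cont, Cf|]. intros s _.
    apply Rmult_le_compat_r; [left; apply turn_s_pos, Hr|]. specialize (Hs s). apply Rabs_le_between in Hs. lra. }
  apply Rabs_le. lra.
Qed.

Lemma len_dens_in (s r : R) : 0 < r < P ->
  len s (s + r) * dens s r = cr s (s + r) * cr (s + r) s / sqd s (s + r).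
Proof.
  intros Hr. rewrite dens_in by exact Hr. rewrite sqd_len.
  assert (L := len_pos H A s (s + r) ltac:(lra)). field. lra.
Qed.

(** The product is [sin phi sin psi], so a strip of width [e] along an edge contributes at most [e]
    for each [s]. *)
Lemma len_dens_bounds (s r : R) : 0 <= len s (s + r) * dens s r <= 1.
Proof.
  split; [apply Rmult_le_pos; [apply len_nonneg|apply (dens_nonneg H A)]|].
  destruct (Rle_dec r 0); [rewrite dens_lo by assumption; lra|].
  destruct (Rle_dec P r); [rewrite dens_hi by assumption; lra|].
  rewrite len_dens_in by lra. assert (S := sqd_pos s r ltac:(lra)).
  apply Rle_div_l; [exact S|]. rewrite Rmult_1_l.
  assert (F1 := len_frame H s (s + r)). assert (F2 := len_frame H (s + r) s).
  rewrite (len_sym (s + r) s) in F2. rewrite <- sqd_len in F1, F2.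
  assert (Q := Rle_0_sqr (cr s (s + r) - cr (s + r) s)). unfold Rsqr in Q.
  assert (Q1 := Rle_0_sqr (dt s (s + r))). assert (Q2 := Rle_0_sqr (dt (s + r) s)). unfold Rsqr in Q1, Q2. lra.
Qed.

Lemma len_dens_continuity (s r : R) : continuity_2d_pt (fun s r => len s (s + r) * dens s r) s r.
Proof. cont2; [apply (len_continuity H)|apply (dens_continuity H A)]. Qed.

(* Santalo's formula. *)
Lemma int_len_dens : int (fun s => int (fun r => len s (s + r) * dens s r) 0 P) 0 P = 2 * PI * area.
Proof.
  destruct segment_lipschitz as [C [HC B]]. assert (Hpi := PI_RGT_0).
  (* The two edge strips cost [2 P e], and the flux at [r = e] and at [r = P - e] is off by at most
     [2 PI C e] each. *)
  apply (eq_of_small_difference _ _ (2 * P + 4 * PI * C) (P / 2)); [lra|]. intros e He.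
  set (f := fun s r => len s (s + r) * dens s r).
  assert (Cf : forall s r, continuity_2d_pt f s r) by (intros; apply len_dens_continuity).
  assert (Ef : forall s a b, ex_RInt (f s) a b) by (intros; apply ex_int_section, Cf).
  assert (Bd : forall s a b, a <= b -> 0 <= int (f s) a b <= b - a).
  { intros s a b Hab. split.
    - apply (RInt_ge_0 (f s)); auto. intros r _. apply len_dens_bounds.
    - replace (b - a) with (int (fun _ => 1) a b) by (rewrite int_const; ring).
      apply int_le; auto; [apply ex_int_const|]. intros r _. apply len_dens_bounds. }
  assert (Em : int (fun s => int (f s) e (P - e)) 0 P = flux (P - e) - flux e).
  { rewrite <- (flux_increment e (P - e)) by lra. apply int_ext; [lra|]. intros s _.
    apply int_ext; [lra|]. intros r Hr. apply len_dens_in. lra. }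
  assert (Ci : forall a b s, a <= b -> continuous (fun s => int (f s) a b) s).
  { intros a b s Hab. apply continuous_int_param; assumption. }
  assert (D1 : int (fun s => int (f s) e (P - e)) 0 P <= int (fun s => int (f s) 0 P) 0 P).
  { apply int_le; [lra|apply ex_int_cont; intros; apply Ci; lra|apply ex_int_cont; intros; apply Ci; lra|].
    intros s _. rewrite (int_Chasles (f s) 0 e P), (int_Chasles (f s) e (P - e) P) by auto.
    generalize (Bd s 0 e) (Bd s (P - e) P). lra. }
  assert (D2 : int (fun s => int (f s) 0 P) 0 P <= int (fun s => int (f s) e (P - e)) 0 P + P * (2 * e)).
  { replace (P * (2 * e)) with (int (fun _ => 2 * e) 0 P) by (rewrite int_const; ring).
    rewrite <- int_plus; [|apply ex_int_cont; intros; apply Ci; lra|apply ex_int_const].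
    apply int_le; [lra|apply ex_int_cont; intros; apply Ci; lra| |].
    - apply ex_int_cont. intros s. apply (continuous_plus (fun s => int (f s) e (P - e)) (fun _ => 2 * e));
      [apply Ci; lra|apply continuous_const].
    - intros s _. rewrite (int_Chasles (f s) 0 e P), (int_Chasles (f s) e (P - e) P) by auto.
      generalize (Bd s 0 e) (Bd s (P - e) P). lra. }
  assert (N1 : Rabs (flux e - 2 * PI * 0) <= C * e * (2 * PI)).
  { apply flux_near; [lra|lra|]. intros s. rewrite <- (segment_0 s).
    assert (B' := B s 0 e). rewrite Rminus_0_r, (Rabs_right e) in B' by lra. exact B'. }
  assert (N2 : Rabs (flux (P - e) - 2 * PI * area) <= C * e * (2 * PI)).
  { apply flux_near; [lra|lra|]. intros s. rewrite <- (segment_P s).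
    assert (B' := B s P (P - e)). replace (P - e - P) with (- e) in B' by ring.
    rewrite Rabs_Ropp, (Rabs_right e) in B' by lra. exact B'. }
  apply Rabs_le_between in N1. apply Rabs_le_between in N2. apply Rabs_le.
  change (fun s => int (fun r => len s (s + r) * dens s r) 0 P) with (fun s => int (f s) 0 P).
  rewrite Em in D1, D2. lra.
Qed.

(** The chord from the fixed point [s] sweeps out the whole domain, at the areal rate
    [cross_chord (s + r) s / 2]. *)
Lemma int_cr : forall s, int (fun r => cr (s + r) s) 0 P = 2 * area.
Proof.
  intros s. rewrite (int_derive_open (fun r => 2 * segment s (s + r)) (fun r => cr (s + r) s) 0 P).
  - rewrite segment_0, segment_P. ring.
  - lra.
  - intros r _. apply is_derive_eq with (2 * (/ 2 * cr (s + r) s)); [|field].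
    apply (is_derive_scal (fun r => segment s (s + r)) r 2), segment_derive.
  - intros r _. cont1. apply continuity_2d_pt_section_r, segment_continuity.
  - intros r _. cont1. apply cr_continuity.
Qed.

Lemma area_pos : 0 < area.
Proof.
  assert (E := int_cr 0).
  assert (0 < int (fun r => cr (0 + r) 0) 0 P); [|lra].
  apply (RInt_gt_0 (fun r => cr (0 + r) 0)); [exact HP| |].
  - intros r Hr. apply (cr_pos_l H A). lra.
  - intros r _. cont1. apply cr_continuity.
Qed.

Lemma int_half_circle : int (fun u => sqrt (1 - u * u)) (-1) 1 = PI / 2.
Proof.
  assert (Hpi := PI_RGT_0).
  assert (Cc : forall u, continuous (fun u => sqrt (1 - u * u)) u).
  { intros u. cont1. }
  assert (E := RInt_comp (V := R_CompleteNormedModule) (fun u => sqrt (1 - u * u)) (fun x => - cos x) sin 0 PI).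
  cbv beta in E. rewrite cos_0, cos_PI in E. replace (- (1)) with (-1) in E by ring. replace (- (-1)) with 1 in E by ring. unfold int. rewrite <- E.
  - change (int (fun y => sin y * sqrt (1 - - cos y * - cos y)) 0 PI = PI / 2).
    rewrite (int_derive_open (fun y => / 2 * (y - sin y * cos y)) (fun y => sin y * sqrt (1 - - cos y * - cos y)) 0 PI).
    + rewrite sin_PI, sin_0. field.
    + lra.
    + intros y Hy. apply is_derive_eq with (/ 2 * (1 - (cos y * cos y - sin y * sin y))).
      * auto_derive; [exact I|ring].
      * assert (T := sin2_cos2 y). unfold Rsqr in T.
        replace (1 - - cos y * - cos y) with (sin y * sin y) by lra.
        rewrite sqrt_square by (apply sin_ge_0; lra). lra.
    + intros y _. apply (@ex_derive_continuous R_AbsRing R_NormedModule). auto_derive. exact I.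
    + intros y _. cont1; first [apply continuous_sin|apply continuous_cos].
  - intros x _. apply Cc.
  - intros x _. split; [auto_derive; [exact I|ring]|apply continuous_sin].
Qed.

(* Cauchy-Schwarz for chord length against sin phi on the phase space, whose mean square is known
   because chords from a fixed boundary point sweep out the domain. *)
Lemma isoperimetric : 4 * PI * area <= P ^ 2.
Proof.
  assert (Ha := area_pos). assert (Hpi := PI_RGT_0).
  (* The value that optimizes the quadratic inequality after integration. For a circle it is the
     diameter, the chord length is [la sin phi], and the pointwise inequality is sharp. *)
  set (la := 4 * area / P).
  set (f1 := fun s r => cr (s + r) s). set (f2 := fun s r => len s (s + r) * dens s r).
  set (f3 := fun s r => sqrt (1 - slope s r * slope s r) * dens s r).
  assert (C1 : forall s r, continuity_2d_pt f1 s r) by (intros; unfold f1; cont2; apply cr_continuity).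
  assert (C2 : forall s r, continuity_2d_pt f2 s r) by (intros; apply len_dens_continuity).
  assert (C3 : forall s r, continuity_2d_pt f3 s r).
  { intros s r. unfold f3. apply (continuity_2d_pt_mult (fun s r => sqrt (1 - slope s r * slope s r)) dens); [|apply (dens_continuity H A)].
    apply (continuity_2d_pt_comp1 (fun u => sqrt (1 - u * u)) slope); [|apply (slope_continuity H A)].
    cont1. }
  assert (I3 : forall s, int (f3 s) 0 P = PI / 2).
  { intros s. rewrite <- int_half_circle. symmetry. apply (int_slope H A (fun u => sqrt (1 - u * u))).
    intros u. cont1. }
  assert (Pt : forall s r, 0 < r < P -> 2 * la * f2 s r <= f1 s r + la * la * f3 s r).
  { intros s r Hr. unfold f1, f2, f3. rewrite len_dens_in by exact Hr. rewrite slope_in, dens_in by exact Hr.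
    replace (1 - - dt s (s + r) / len s (s + r) * (- dt s (s + r) / len s (s + r)))
      with (1 - dt s (s + r) / len s (s + r) * (dt s (s + r) / len s (s + r))) by (unfold Rdiv; ring).
    rewrite sqrt_one_minus_cosine by exact Hr. rewrite sqd_len.
    assert (L := len_pos H A s (s + r) ltac:(lra)). assert (V := cr_pos_l H A s (s + r) ltac:(lra)).
    set (l := len s (s + r)) in *. set (u := cr s (s + r)) in *. set (v := cr (s + r) s) in *.
    apply Rminus_le_0.
    replace (v + la * la * (u / l * (u * v / l ^ 3)) - 2 * la * (u * v / (l * l)))
      with (v * ((1 - la * u / (l * l)) * (1 - la * u / (l * l)))) by (field; lra).
    apply Rmult_le_pos; [lra|]. apply Rle_0_sqr. }
  assert (Es : forall f s a b, (forall s r, continuity_2d_pt f s r) -> ex_RInt (f s) a b).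
  { intros f s a b Cf. apply ex_int_section, Cf. }
  assert (Row : forall s, 2 * la * int (f2 s) 0 P <= 2 * area + la * la * (PI / 2)).
  { intros s. rewrite <- (int_cr s), <- (I3 s), <- !int_scal, <- int_plus; auto.
    - apply int_le; [lra| | |].
      + apply (ex_RInt_scal (f2 s)), Es, C2.
      + apply (ex_RInt_plus (f1 s) (fun r => la * la * f3 s r)); [apply Es, C1|apply (ex_RInt_scal (f3 s)), Es, C3].
      + intros r Hr. apply Pt, Hr.
    - apply (Es f1 s 0 P C1).
    - apply (ex_RInt_scal (f3 s)), Es, C3. }
  assert (T : 2 * la * (2 * PI * area) <= P * (2 * area + la * la * (PI / 2))).
  { rewrite <- int_len_dens. fold f2.
    rewrite <- int_scal by (apply ex_int_row; [exact C2|lra]).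
    replace (P * (2 * area + la * la * (PI / 2))) with (int (fun _ => 2 * area + la * la * (PI / 2)) 0 P)
      by (rewrite int_const; ring).
    apply int_le; [lra| | |].
    - apply ex_int_cont. intros s. apply (continuous_mult (fun _ => 2 * la)); [apply continuous_const|].
      apply continuous_int_param; [lra|exact C2].
    - apply ex_int_const.
    - intros s _. apply Row. }
  unfold la in T. apply Rminus_le_0. apply Rmult_le_reg_l with (2 * area / P); [apply Rdiv_lt_0_compat; lra|].
  rewrite Rmult_0_r.
  replace (2 * area / P * (P ^ 2 - 4 * PI * area)) with
   (P * (2 * area + 4 * area / P * (4 * area / P) * (PI / 2)) - 2 * (4 * area / P) * (2 * PI * area)); [lra|].
  field. lra.
Qed.

End Area.

(** * The domain bounded by the curve *)

Section Slices.

Context {P kmin : R} {X Y X1 Y1 k tau : R -> R}.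
Context (H : oval P kmin X Y X1 Y1 k) (A : tangent_angle X1 Y1 k tau).

Notation area := (@area P X Y X1 Y1).
Notation sweep := (@sweep X Y X1 Y1).

Let HP := oval_P H.

(** Here and at [t_right] the tangent is vertical. Between them the curve runs to the right along
    its lower arc, and from [t_right] to [t_left + P] back along the upper one. *)
Definition t_left : R := zeta H A (- (PI / 2)).
Definition t_right : R := zeta H A (PI / 2).

Lemma left_lt_right : t_left < t_right.
Proof. apply (zeta_lt H A). generalize PI_RGT_0. lra. Qed.

Lemma left_shift : t_left + P = zeta H A (3 * (PI / 2)).
Proof.
  apply (tau_inj H A). rewrite (turning H A). unfold t_left. rewrite !(tau_zeta H A). field.
Qed.

Lemma right_lt_left_shift : t_right < t_left + P.
Proof. rewrite left_shift. apply (zeta_lt H A). generalize PI_RGT_0. lra. Qed.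

Lemma X1_pos (t : R) : t_left < t < t_right -> 0 < X1 t.
Proof.
  intros Ht. rewrite (angle_X1 A).
  assert (T1 := tau_lt H A _ _ (proj1 Ht)). assert (T2 := tau_lt H A _ _ (proj2 Ht)).
  unfold t_left, t_right in T1, T2. rewrite (tau_zeta H A) in T1, T2. apply cos_gt_0; assumption.
Qed.

Lemma X1_neg (t : R) : t_right < t < t_left + P -> X1 t < 0.
Proof.
  intros Ht. rewrite (angle_X1 A).
  assert (T1 := tau_lt H A _ _ (proj1 Ht)). assert (T2 := tau_lt H A _ _ (proj2 Ht)).
  rewrite left_shift in T2. unfold t_right in T1. rewrite (tau_zeta H A) in T1, T2. apply cos_lt_0; assumption.
Qed.

Lemma X_incr (s t : R) : t_left <= s -> s < t -> t <= t_right -> X s < X t.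
Proof.
  intros H1 H2 H3. apply (strictly_increasing X X1 s t H2 (oval_dX H)).
  intros x Hx. apply X1_pos. lra.
Qed.

Lemma X_decr (s t : R) : t_right <= s -> s < t -> t <= t_left + P -> X t < X s.
Proof.
  intros H1 H2 H3. apply Ropp_lt_cancel.
  apply (strictly_increasing (fun t => - X t) (fun t => - X1 t) s t H2).
  - intros x. apply (is_derive_opp X), (oval_dX H).
  - intros x Hx. assert (N := X1_neg x). lra.
Qed.

Notation x_min := (X t_left).
Notation x_max := (X t_right).

Lemma x_min_lt_max : x_min < x_max.
Proof. apply X_incr; generalize left_lt_right; lra. Qed.

Lemma X_range (t : R) : t_left <= t <= t_left + P -> x_min <= X t <= x_max.
Proof.
  intros Ht. assert (L1 := left_lt_right). assert (L2 := right_lt_left_shift).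
  assert (E := oval_pX H t_left). assert (L3 := x_min_lt_max).
  destruct (Rtotal_order t t_right) as [h|[->|h]]; [|lra|].
  - assert (T1 := X_incr t t_right). destruct (Req_dec t t_left) as [->|]; [lra|]. assert (T2 := X_incr t_left t). lra.
  - assert (T1 := X_decr t_right t). destruct (Req_dec t (t_left + P)) as [->|]; [lra|].
    assert (T2 := X_decr t (t_left + P)). lra.
Qed.

Lemma lower_exists (x : R) : exists t, t_left <= t <= t_right /\ X t = clamp x_min x_max x.
Proof.
  assert (C := clamp_in x_min x_max x ltac:(generalize x_min_lt_max; lra)).
  assert (L := left_lt_right).
  apply intermediate_value; [apply (X_cont H)|lra|lra].
Qed.

Lemma upper_exists (x : R) : exists t, t_right <= t <= t_left + P /\ X t = clamp x_min x_max x.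
Proof.
  assert (C := clamp_in x_min x_max x ltac:(generalize x_min_lt_max; lra)).
  assert (L := right_lt_left_shift).
  apply intermediate_value; [apply (X_cont H)|lra|rewrite (oval_pX H); lra].
Qed.

Definition t_low (x : R) : R := choose (lower_exists x).
Definition t_up (x : R) : R := choose (upper_exists x).

Lemma t_low_spec (x : R) : t_left <= t_low x <= t_right /\ X (t_low x) = clamp x_min x_max x.
Proof. exact (choose_spec (lower_exists x)). Qed.

Lemma t_up_spec (x : R) : t_right <= t_up x <= t_left + P /\ X (t_up x) = clamp x_min x_max x.
Proof. exact (choose_spec (upper_exists x)). Qed.

(** Through the clamp in [t_low] and [t_up] both graphs extend to the line by constants and coincide
    outside the projection of the curve, so the region between them pinches off at both ends. *)
Definition lower (x : R) : R := Y (t_low x).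
Definition upper (x : R) : R := Y (t_up x).

Lemma lower_continuous (x : R) : continuous lower x.
Proof.
  apply (continuous_comp t_low Y); [|apply (Y_cont H)].
  apply (continuous_root t_low (fun q r => X r - clamp x_min x_max q) t_left t_right).
  - apply filter_forall. intros q. destruct (t_low_spec q) as [T1 T2]. split; [exact T1|].
    intros r Hr. rewrite <- T2. split; intros Hlt.
    + assert (T := X_incr r (t_low q)). lra. + assert (T := X_incr (t_low q) r). lra.
  - intros r. cont1. apply clamp_continuous.
Qed.

Lemma upper_continuous (x : R) : continuous upper x.
Proof.
  apply (continuous_comp t_up Y); [|apply (Y_cont H)].
  apply (continuous_root t_up (fun q r => clamp x_min x_max q - X r) t_right (t_left + P)).
  - apply filter_forall. intros q. destruct (t_up_spec q) as [T1 T2]. split; [exact T1|].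
    intros r Hr. rewrite <- T2. split; intros Hlt.
    + assert (T := X_decr r (t_up q)). lra. + assert (T := X_decr (t_up q) r). lra.
  - intros r. cont1. apply clamp_continuous.
Qed.

Lemma lower_X (t : R) : t_left <= t <= t_right -> lower (X t) = Y t.
Proof.
  intros Ht. unfold lower. f_equal. destruct (t_low_spec (X t)) as [T1 T2].
  assert (Hb := X_range t ltac:(generalize right_lt_left_shift; lra)).
  rewrite clamp_id in T2 by exact Hb.
  destruct (Rtotal_order (t_low (X t)) t) as [h|[h|h]]; [|exact h|].
  - assert (T := X_incr (t_low (X t)) t). lra. - assert (T := X_incr t (t_low (X t))). lra.
Qed.

Lemma upper_X (t : R) : t_right <= t <= t_left + P -> upper (X t) = Y t.
Proof.
  intros Ht. unfold upper. f_equal. destruct (t_up_spec (X t)) as [T1 T2].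
  assert (Hb := X_range t ltac:(generalize left_lt_right; lra)).
  rewrite clamp_id in T2 by exact Hb.
  destruct (Rtotal_order (t_up (X t)) t) as [h|[h|h]]; [|exact h|].
  - assert (T := X_decr (t_up (X t)) t). lra. - assert (T := X_decr t (t_up (X t))). lra.
Qed.

Lemma lower_eq_upper_min (x : R) : x <= x_min -> lower x = upper x.
Proof.
  intros Hx. assert (L := x_min_lt_max). assert (L1 := left_lt_right). assert (L2 := right_lt_left_shift).
  assert (E1 : lower x = lower x_min).
  { unfold lower. destruct (t_low_spec x) as [S1 S2]. destruct (t_low_spec x_min) as [S3 S4].
    rewrite clamp_lo in S2, S4 by lra. fold (lower x_min). 
    rewrite <- S2 at 1. symmetry. apply lower_X, S1. }
  assert (E2 : upper x = upper x_min).
  { unfold upper. destruct (t_up_spec x) as [S1 S2]. rewrite clamp_lo in S2 by lra. fold (upper x_min).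
    rewrite <- S2 at 1. symmetry. apply upper_X, S1. }
  rewrite E1, E2, (lower_X t_left) by lra. rewrite <- (oval_pX H t_left), (upper_X (t_left + P)) by lra.
  symmetry. apply (oval_pY H).
Qed.

Lemma lower_eq_upper_max (x : R) : x_max <= x -> lower x = upper x.
Proof.
  intros Hx. assert (L := x_min_lt_max). assert (L1 := left_lt_right). assert (L2 := right_lt_left_shift).
  assert (E1 : lower x = lower x_max).
  { unfold lower. destruct (t_low_spec x) as [S1 S2]. rewrite clamp_hi in S2 by lra. fold (lower x_max).
    rewrite <- S2 at 1. symmetry. apply lower_X, S1. }
  assert (E2 : upper x = upper x_max).
  { unfold upper. destruct (t_up_spec x) as [S1 S2]. rewrite clamp_hi in S2 by lra. fold (upper x_max).
    rewrite <- S2 at 1. symmetry. apply upper_X, S1. }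
  rewrite E1, E2, (lower_X t_right), (upper_X t_right) by lra. reflexivity.
Qed.

(** For two points on one vertical line, positivity of [cross_chord] taken at the point of the lower
    arc says that [X1] times the difference of heights is positive, and [X1 > 0] inside that arc. *)
Lemma lower_le_upper (x : R) : lower x <= upper x.
Proof.
  destruct (Rle_dec x x_min); [rewrite lower_eq_upper_min; lra|].
  destruct (Rle_dec x_max x); [rewrite lower_eq_upper_max; lra|].
  destruct (t_low_spec x) as [S1 S2]. destruct (t_up_spec x) as [S3 S4]. rewrite clamp_id in S2, S4 by lra.
  assert (t_low x <> t_left) by (intros E; rewrite E in S2; lra).
  assert (t_low x <> t_right) by (intros E; rewrite E in S2; lra).
  assert (t_up x <> t_left + P) by (intros E; rewrite E, (oval_pX H) in S4; lra).
  assert (C := cr_pos_r H A (t_low x) (t_up x)).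
  assert (V := X1_pos (t_low x)). assert (L2 := right_lt_left_shift).
  unfold cross_chord in C. rewrite S2, S4 in C. fold (lower x) (upper x) in C.
  destruct (Rle_dec (lower x) (upper x)); [assumption|].
  assert (0 < X1 (t_low x) * (upper x - lower x) - Y1 (t_low x) * (x - x)) by (apply C; lra).
  assert (0 < X1 (t_low x)) by (apply V; lra). nra.
Qed.

Lemma onCurve_graph (p q : R) :
  onCurve X Y p q -> x_min <= p <= x_max /\ (q = lower p \/ q = upper p).
Proof.
  intros [s [Hs1 Hs2]].
  destruct (reduce_mod P (s - t_left) HP) as [n Hn].
  set (t := s + IZR n * P). assert (Ht : t_left <= t < t_left + P) by (unfold t; lra).
  assert (E1 : X t = p) by (rewrite <- Hs1; apply periodic_shift_Z, (oval_pX H)).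
  assert (E2 : Y t = q) by (rewrite <- Hs2; apply periodic_shift_Z, (oval_pY H)).
  rewrite <- E1, <- E2. split; [apply X_range; lra|].
  destruct (Rle_dec t t_right); [left; rewrite lower_X|right; rewrite upper_X]; first [reflexivity|lra].
Qed.

Lemma graph_onCurve (p q : R) :
  x_min <= p <= x_max -> q = lower p \/ q = upper p -> onCurve X Y p q.
Proof.
  intros Hp [->| ->].
  - exists (t_low p). destruct (t_low_spec p) as [_ S]. rewrite clamp_id in S by exact Hp. auto.
  - exists (t_up p). destruct (t_up_spec p) as [_ S]. rewrite clamp_id in S by exact Hp. auto.
Qed.

(** Substituting [X] along the two arcs gives minus the integral of [Y X1] over a period, and [Y X1]
    differs from [- area_form / 2] by the derivative of the periodic function [X Y / 2]. *)
Lemma int_upper_minus_lower : int (fun x => upper x - lower x) x_min x_max = area.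
Proof.
  assert (L1 := left_lt_right). assert (L2 := right_lt_left_shift). assert (L3 := x_min_lt_max).
  set (g := fun t => Y t * X1 t).
  assert (Cg : forall t, continuous g t).
  { intros t. apply (continuous_mult Y X1); [apply (Y_cont H)|apply (X1_cont H)]. }
  assert (I1 : int g t_left t_right = int lower x_min x_max).
  { rewrite (int_derive_open (fun t => int lower x_min (X t)) g t_left t_right); [rewrite int_refl; ring|lra| | |auto].
    - intros t Ht. apply is_derive_eq with (X1 t * lower (X t)).
      + apply (is_derive_comp (int lower x_min) X); [apply int_is_derive, lower_continuous|apply (oval_dX H)].
      + rewrite lower_X by lra. unfold g. ring.
    - intros t _. apply (continuous_comp X (int lower x_min)); [apply (X_cont H)|].
      apply (is_derive_continuous (int_is_derive lower x_min _ lower_continuous)). }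
  assert (I2 : int g t_right (t_left + P) = - int upper x_min x_max).
  { rewrite (int_derive_open (fun t => int upper x_min (X t)) g t_right (t_left + P));
      [rewrite (oval_pX H), int_refl; ring|lra| | |auto].
    - intros t Ht. apply is_derive_eq with (X1 t * upper (X t)).
      + apply (is_derive_comp (int upper x_min) X); [apply int_is_derive, upper_continuous|apply (oval_dX H)].
      + rewrite upper_X by lra. unfold g. ring.
    - intros t _. apply (continuous_comp X (int upper x_min)); [apply (X_cont H)|].
      apply (is_derive_continuous (int_is_derive upper x_min _ upper_continuous)). }
  assert (I3 : int g t_left (t_left + P) = - area).
  { rewrite (int_derive_open (fun t => / 2 * (X t * Y t - sweep t)) g t_left (t_left + P)); [|lra| | |auto].
    - rewrite (oval_pX H), (oval_pY H). generalize (sweep_shift H t_left). lra.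
    - intros t _. curve_derive H; use_derivative (sweep_derive H). unfold area_form, g. field.
    - intros t _. cont1; first [apply (X_cont H)|apply (Y_cont H)|apply (is_derive_continuous (sweep_derive H _))]. }
  rewrite (int_Chasles g t_left t_right) in I3 by (apply ex_int_cont; auto).
  rewrite int_minus by (apply ex_int_cont; first [apply lower_continuous|apply upper_continuous]). lra.
Qed.

Lemma continuity_path (c : R -> R) : continuity c -> forall t, continuous c t.
Proof. intros Hc t. apply continuity_pt_filterlim, Hc. Qed.

Lemma graph_bounded : exists M, 0 < M /\ (forall t, Rabs (X t) <= M) /\ forall t, Rabs (Y t) <= M.
Proof.
  destruct (periodic_bounded X P HP (X_cont H) (oval_pX H)) as [M1 [HM1 B1]].
  destruct (periodic_bounded Y P HP (Y_cont H) (oval_pY H)) as [M2 [HM2 B2]].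
  exists (M1 + M2). split; [lra|]. split; intros t; [generalize (B1 t)|generalize (B2 t)]; lra.
Qed.

Lemma sqrt_sum_le (a b : R) : sqrt (a ^ 2 + b ^ 2) <= Rabs a + Rabs b.
Proof.
  assert (Pa := Rabs_pos a). assert (Pb := Rabs_pos b).
  rewrite <- (sqrt_square (Rabs a + Rabs b)) by lra. apply sqrt_le_1_alt.
  rewrite <- (pow2_abs a), <- (pow2_abs b). nra.
Qed.

(* A path in the complement of the curve cannot leave the open region between the graphs: the
   minimum of the four defining functions vanishes only on the curve. *)
Lemma between_inside (p q : R) :
  x_min < p < x_max -> lower p < q < upper p -> inside X Y p q.
Proof.
  intros Hp Hq. split.
  - intros HC. destruct (onCurve_graph p q HC) as [_ [E|E]]; lra.
  - destruct graph_bounded as [M [HM [BX BY]]]. exists (2 * M).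
    intros cx cy Ccx Ccy Ex Ey Hav.
    set (m := fun t => Rmin (Rmin (cx t - x_min) (x_max - cx t)) (Rmin (cy t - lower (cx t)) (upper (cx t) - cy t))).
    assert (Cm : forall t, continuous m t).
    { intros t. unfold m. cont1; first [apply lower_continuous|apply upper_continuous|apply continuity_path; assumption]. }
    assert (Hm0 : forall t, 0 <= t <= 1 -> m t <> 0).
    { intros t Ht E. apply (Hav t Ht). unfold m in E.
      assert (B1 : 0 <= cx t - x_min) by (rewrite <- E; eapply Rle_trans; [apply Rmin_l|apply Rmin_l]).
      assert (B2 : 0 <= x_max - cx t) by (rewrite <- E; eapply Rle_trans; [apply Rmin_l|apply Rmin_r]).
      assert (B3 : 0 <= cy t - lower (cx t)) by (rewrite <- E; eapply Rle_trans; [apply Rmin_r|apply Rmin_l]).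
      assert (B4 : 0 <= upper (cx t) - cy t) by (rewrite <- E; eapply Rle_trans; [apply Rmin_r|apply Rmin_r]).
      assert (M1 := lower_eq_upper_min (cx t)). assert (M2 := lower_eq_upper_max (cx t)).
      apply graph_onCurve; [lra|].
      unfold Rmin in E.
      destruct (Rle_dec (cx t - x_min) (x_max - cx t));
      destruct (Rle_dec (cy t - lower (cx t)) (upper (cx t) - cy t));
      match type of E with (if ?d then _ else _) = _ => destruct d end; lra. }
    assert (Pm0 : 0 < m 0) by (unfold m; rewrite Ex, Ey; repeat apply Rmin_glb_lt; lra).
    assert (Pm1 : 0 < m 1).
    { destruct (Rlt_dec 0 (m 1)) as [h|h]; [exact h|]. exfalso.
      destruct (intermediate_value m 0 1 0 Cm ltac:(lra) ltac:(lra)) as [t [Ht Et]]. exact (Hm0 t Ht Et). }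
    assert (B1 : m 1 <= cx 1 - x_min) by (eapply Rle_trans; [apply Rmin_l|apply Rmin_l]).
    assert (B2 : m 1 <= x_max - cx 1) by (eapply Rle_trans; [apply Rmin_l|apply Rmin_r]).
    assert (B3 : m 1 <= cy 1 - lower (cx 1)) by (eapply Rle_trans; [apply Rmin_r|apply Rmin_l]).
    assert (B4 : m 1 <= upper (cx 1) - cy 1) by (eapply Rle_trans; [apply Rmin_r|apply Rmin_r]).
    assert (B5 := BX t_left). assert (B6 := BX t_right).
    assert (B7 := BY (t_low (cx 1))). assert (B8 := BY (t_up (cx 1))). fold (lower (cx 1)) in B7. fold (upper (cx 1)) in B8.
    eapply Rle_trans; [apply sqrt_sum_le|].
    apply Rabs_le_between in B5. apply Rabs_le_between in B6. apply Rabs_le_between in B7. apply Rabs_le_between in B8.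
    assert (Rabs (cx 1) <= M) by (apply Rabs_le; lra). assert (Rabs (cy 1) <= M) by (apply Rabs_le; lra). lra.
Qed.

Lemma norm_ge_l (a b : R) : Rabs a <= sqrt (a ^ 2 + b ^ 2).
Proof.
  rewrite <- (sqrt_Rsqr_abs a). apply sqrt_le_1_alt. unfold Rsqr. assert (T := pow2_ge_0 b). simpl in T |- *. lra.
Qed.

Lemma norm_ge_r (a b : R) : Rabs b <= sqrt (a ^ 2 + b ^ 2).
Proof. rewrite Rplus_comm. apply norm_ge_l. Qed.

(** Moving along a ray that avoids the curve beats every bound [Rb]: some component of a unit vector
    is at least 1/2 in absolute value, so a displacement by [2 M] changes that coordinate by at
    least [M], which exceeds [Rb] plus the size of the starting point. *)
Lemma escape (p q vx vy : R) : vx * vx + vy * vy = 1 -> 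
  (forall t, 0 <= t -> ~ onCurve X Y (p + t * vx) (q + t * vy)) -> ~ inside X Y p q.
Proof.
  intros Hv Hav [_ [Rb HRb]].
  set (M := Rabs Rb + Rabs p + Rabs q + 1).
  assert (HM : 0 < M) by (unfold M; generalize (Rabs_pos Rb) (Rabs_pos p) (Rabs_pos q); lra).
  specialize (HRb (fun t => p + t * (M * 2) * vx) (fun t => q + t * (M * 2) * vy)).
  assert (C : forall a b, continuity (fun t => a + t * (M * 2) * b)).
  { intros a b t. apply continuity_pt_filterlim.
    change (continuous (fun t => a + t * (M * 2) * b) t). cont1. }
  specialize (HRb (C _ _) (C _ _) ltac:(cbv beta; ring) ltac:(cbv beta; ring)). cbv beta in HRb.
  assert (Hs : sqrt ((p + 1 * (M * 2) * vx) ^ 2 + (q + 1 * (M * 2) * vy) ^ 2) <= Rb).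
  { apply HRb. intros t Ht. apply Hav. apply Rmult_le_pos; lra. }
  assert (N1 := norm_ge_l (p + 1 * (M * 2) * vx) (q + 1 * (M * 2) * vy)).
  assert (N2 := norm_ge_r (p + 1 * (M * 2) * vx) (q + 1 * (M * 2) * vy)).
  assert (T1 := Rabs_triang (p + 1 * (M * 2) * vx) (- p)). assert (T2 := Rabs_triang (q + 1 * (M * 2) * vy) (- q)).
  rewrite Rabs_Ropp in T1, T2.
  replace (p + 1 * (M * 2) * vx + - p) with (M * (2 * vx)) in T1 by ring.
  replace (q + 1 * (M * 2) * vy + - q) with (M * (2 * vy)) in T2 by ring.
  assert (Hvv : 1 <= Rabs (2 * vx) \/ 1 <= Rabs (2 * vy)).
  { destruct (Rle_dec 1 (Rabs (2 * vx))); [left; assumption|]. destruct (Rle_dec 1 (Rabs (2 * vy))); [right; assumption|].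
    exfalso. assert (Rabs (2 * vx) < 1) by lra. assert (Rabs (2 * vy) < 1) by lra.
    apply Rabs_def2 in H0. apply Rabs_def2 in H1. nra. }
  assert (R1 := Rle_abs Rb). assert (Pp := Rabs_pos p). assert (Pq := Rabs_pos q).
  rewrite Rabs_mult, (Rabs_right M) in T1, T2 by lra.
  destruct Hvv as [h|h]; [assert (M * 1 <= M * Rabs (2 * vx)) by (apply Rmult_le_compat_l; lra)|
    assert (M * 1 <= M * Rabs (2 * vy)) by (apply Rmult_le_compat_l; lra)]; unfold M in *; lra.
Qed.

(** From a point outside the closed region some axis-parallel ray misses the curve. Closed
    inequalities here and strict ones in [between_inside] sandwich the domain, so the boundary never
    has to be measured. *)
Lemma inside_between (p q : R) :
  inside X Y p q -> x_min <= p <= x_max /\ lower p <= q <= upper p.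
Proof.
  intros HI.
  assert (Hp1 : x_min <= p).
  { destruct (Rle_dec x_min p); [assumption|]. exfalso. revert HI.
    apply (escape p q (-1) 0); [ring|]. intros t Ht HC. apply onCurve_graph in HC. lra. }
  assert (Hp2 : p <= x_max).
  { destruct (Rle_dec p x_max); [assumption|]. exfalso. revert HI.
    apply (escape p q 1 0); [ring|]. intros t Ht HC. apply onCurve_graph in HC. lra. }
  assert (L := lower_le_upper p).
  split; [lra|]. split.
  - destruct (Rle_dec (lower p) q); [assumption|]. exfalso. revert HI.
    apply (escape p q 0 (-1)); [ring|]. intros t Ht HC. apply onCurve_graph in HC.
    rewrite Rmult_0_r, Rplus_0_r in HC. lra.
  - destruct (Rle_dec q (upper p)); [assumption|]. exfalso. revert HI.
    apply (escape p q 0 1); [ring|]. intros t Ht HC. apply onCurve_graph in HC.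
    rewrite Rmult_0_r, Rplus_0_r in HC. lra.
Qed.

End Slices.

(** * Outer measure of the region between two graphs *)

Lemma infinite_sum_finite (f : nat -> R) (N : nat) :
  (forall i, (N < i)%nat -> f i = 0) -> infinite_sum f (sum_f_R0 f N).
Proof.
  intros Hf.
  assert (E : forall n, (N <= n)%nat -> sum_f_R0 f n = sum_f_R0 f N).
  { intros n Hn. induction Hn as [|n Hn IH]; [reflexivity|]. simpl. rewrite IH, Hf by lia. ring. }
  intros eps He. exists N. intros n Hn. rewrite E by exact Hn.
  unfold Rdist. rewrite Rminus_diag, Rabs_R0. exact He.
Qed.

Lemma int_grid (f : R -> R) (a h : R) (N : nat) :
  (forall x, continuous f x) ->
  int f a (a + INR (S N) * h) = sum_f_R0 (fun i => int f (a + INR i * h) (a + INR (S i) * h)) N.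
Proof.
  intros Cf. induction N as [|N IH].
  - simpl. f_equal; ring.
  - rewrite tech5, <- IH. apply int_Chasles; apply ex_int_cont; exact Cf.
Qed.

Section RegionBetweenGraphs.

Variables (f g : R -> R) (a b : R).
Hypothesis Cf : forall x, continuous f x.
Hypothesis Cg : forall x, continuous g x.
Hypothesis Hab : a < b.
Hypothesis Hfg : forall x, f x <= g x.
Variable E : R -> R -> Prop.

(** An explicit cover by vertical strips, so narrow that [f] and [g] vary by less than [e] on
    each. *)
Lemma cover_of_region (m : R) :
  (forall x y, E x y -> a <= x <= b /\ f x <= y <= g x) ->
  outer_measure_is lebesgue_w E m -> m <= int (fun x => g x - f x) a b.
Proof.
  intros HE [Hm _]. apply le_epsilon. intros e0 He0.
  (* With [f] and [g] taken at its left end, a strip has height [g - f + 2 e] while the integrand on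
     it is at least [g - f - 2 e]; a surplus of [4 e] over the width [b - a] is [e0]. *)
  set (e := e0 / (4 * (b - a))). assert (He : 0 < e) by (apply Rdiv_lt_0_compat; lra).
  assert (U : forall h : R -> R, (forall x, continuous h x) -> exists d : posreal, forall x y,
    a <= x <= b -> a <= y <= b -> Rabs (y - x) < d -> Rabs (h y - h x) < e).
  { intros h Ch. destruct (uniform_continuity_2d (fun u _ => h u) a b 0 0) with (mkposreal _ He) as [d Hd].
    - intros x y _ _. apply continuity_2d_pt_comp1; [apply Ch|apply continuity_2d_pt_id1].
    - exists d. intros x y Hx Hy Hxy. apply (Hd x 0 y 0); auto; try lra. rewrite Rminus_diag, Rabs_R0. apply cond_pos. }
  destruct (U f Cf) as [d1 U1]. destruct (U g Cg) as [d2 U2].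
  set (d := Rmin d1 d2). assert (Hd : 0 < d) by (apply Rmin_glb_lt; apply cond_pos).
  destruct (archimed ((b - a) / d)) as [Ar _].
  set (N := Z.to_nat (up ((b - a) / d))).
  assert (HN : (b - a) / d < INR (S N)).
  { assert (0 < (b - a) / d) by (apply Rdiv_lt_0_compat; lra).
    rewrite S_INR, INR_IZR_INZ. unfold N. rewrite Z2Nat.id; [lra|]. apply le_IZR. lra. }
  set (h := (b - a) / INR (S N)). assert (HS : 0 < INR (S N)) by (apply lt_0_INR; lia).
  assert (Hh : 0 < h) by (apply Rdiv_lt_0_compat; lra).
  assert (Hhd : h < d).
  { apply Rlt_div_l; [exact HS|]. apply Rlt_div_l in HN; [|exact Hd]. lra. }
  assert (Eb : a + INR (S N) * h = b) by (unfold h; field; lra).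
  set (p := fun i => a + INR i * h).
  assert (Hp : forall i, (i <= S N)%nat -> a <= p i <= b).
  { intros i Hi. apply le_INR in Hi. unfold p. assert (0 <= INR i) by apply pos_INR. split; [nra|]. rewrite <- Eb. nra. }
  assert (Hps : forall i, p (S i) = p i + h) by (intros i; unfold p; rewrite S_INR; ring).
  (* A cover is an infinite sequence: after index [N] the rectangles degenerate to the origin and
     have weight 0. *)
  set (c1 := fun i => if le_dec i N then p i else 0).
  set (c2 := fun i => if le_dec i N then p (S i) else 0).
  set (c3 := fun i => if le_dec i N then f (p i) - e else 0).
  set (c4 := fun i => if le_dec i N then g (p i) + e else 0).
  assert (Near : forall i x, (i <= N)%nat -> p i <= x <= p (S i) ->
    f (p i) - e <= f x <= f (p i) + e /\ g (p i) - e <= g x <= g (p i) + e).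
  { intros i x Hi Hx. rewrite Hps in Hx. assert (P1 := Hp i ltac:(lia)). assert (P2 := Hp (S i) ltac:(lia)). rewrite Hps in P2.
    assert (Rabs (x - p i) < d1 /\ Rabs (x - p i) < d2).
    { rewrite Rabs_right by lra. generalize (Rmin_l d1 d2) (Rmin_r d1 d2). fold d. lra. }
    assert (F1 := U1 (p i) x P1 ltac:(lra) ltac:(tauto)). assert (F2 := U2 (p i) x P1 ltac:(lra) ltac:(tauto)).
    apply Rabs_def2 in F1. apply Rabs_def2 in F2. lra. }
  set (l := sum_f_R0 (fun i => lebesgue_w (c1 i) (c2 i) (c3 i) (c4 i)) N).
  assert (Hml : m <= l).
  { apply (Hm c1 c2 c3 c4).
    - split.
      + intros i. unfold c1, c2, c3, c4. destruct (le_dec i N); [|lra]. rewrite Hps. generalize (Hfg (p i)). lra.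
      + intros x y Hxy. destruct (HE x y Hxy) as [Hx Hy].
        destruct (archimed ((x - a) / h)) as [A1 A2].
        set (z := (up ((x - a) / h) - 1)%Z).
        assert (Ez : IZR z = IZR (up ((x - a) / h)) - 1) by (unfold z; rewrite minus_IZR; reflexivity).
        assert (Hq : 0 <= (x - a) / h) by (apply Rdiv_le_0_compat; lra).
        assert (Hz : (0 <= z)%Z) by (apply Z.lt_succ_r, lt_IZR; rewrite succ_IZR; lra).
        set (j := Z.to_nat z). assert (Ej : INR j = IZR z) by (unfold j; rewrite INR_IZR_INZ, Z2Nat.id by exact Hz; reflexivity).
        assert (Exa : x = a + (x - a) / h * h) by (field; lra).
        assert (Hj1 : p j <= x).
        { unfold p. rewrite Exa at 1. apply Rplus_le_compat_l, Rmult_le_compat_r; lra. }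
        assert (Hj2 : x <= p (S j)).
        { unfold p. rewrite Exa at 1. apply Rplus_le_compat_l, Rmult_le_compat_r; [lra|]. rewrite S_INR. lra. }
        destruct (le_dec j N) as [HjN|HjN].
        * exists j. unfold c1, c2, c3, c4. destruct (le_dec j N); [|tauto].
          destruct (Near j x HjN (conj Hj1 Hj2)). lra.
        (* Only the right endpoint gets a cell number beyond [N]; it belongs to the last strip. *)
        * assert (x = b).
          { assert (INR (S N) <= INR j) by (apply le_INR; lia). unfold p in Hj1.
            assert (INR (S N) * h <= INR j * h) by (apply Rmult_le_compat_r; lra). lra. }
          exists N. unfold c1, c2, c3, c4. destruct (le_dec N N); [|lia].
          assert (En : p (S N) = b) by exact Eb.
          assert (Hb : p N <= x <= p (S N)) by (rewrite En; generalize (Hps N); lra).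
          destruct (Near N x ltac:(lia) Hb). lra.
    - unfold l. apply (infinite_sum_finite (fun i => lebesgue_w (c1 i) (c2 i) (c3 i) (c4 i)) N).
      intros i Hi. unfold lebesgue_w, c1, c2. destruct (le_dec i N); [lia|ring]. }
  assert (Hint : l - e0 <= int (fun x => g x - f x) a b).
  { rewrite <- Eb at 1. rewrite int_grid.
    - replace (l - e0) with (sum_f_R0 (fun i => lebesgue_w (c1 i) (c2 i) (c3 i) (c4 i) - h * (4 * e)) N).
      + apply sum_Rle. intros i Hi. unfold lebesgue_w, c1, c2, c3, c4. destruct (le_dec i N); [|lia].
        replace ((p (S i) - p i) * (g (p i) + e - (f (p i) - e)) - h * (4 * e))
          with (int (fun _ => g (p i) - f (p i) - 2 * e) (p i) (p (S i))) by (rewrite int_const, Hps; ring).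
        change (a + INR i * h) with (p i). change (a + INR (S i) * h) with (p (S i)).
        apply int_le.
        * rewrite Hps. lra.
        * apply ex_int_const.
        * ex_int.
        * intros x Hx. destruct (Near i x Hi ltac:(lra)). lra.
      + rewrite minus_sum, sum_cte. unfold l. f_equal. unfold e, h. rewrite S_INR in HS |- *. field. lra.
    - intros x. cont1; auto. }
  lra.
Qed.

(** The continuous function [w] is positive only strictly between the graphs and equals 1 at
    vertical distance at least [e] from them, so [cover_bound] applies with [c = 1]. Since the
    graphs meet at [a] and [b], [w] vanishes on the two end verticals, which the open region
    misses. *)
Lemma region_le_cover (m : R) :
  f a = g a -> f b = g b ->
  (forall x y, a < x < b -> f x < y < g x -> E x y) ->
  outer_measure_is lebesgue_w E m -> int (fun x => g x - f x) a b <= m.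
Proof.
  intros Ha Hb HE [_ Hm]. apply Hm. intros p q u v l [Hord Hcov] Hsum.
  apply le_epsilon. intros e0 He0.
  set (e := e0 / (2 * (b - a))). assert (He : 0 < e) by (apply Rdiv_lt_0_compat; lra).
  set (w := fun x y => Rmax 0 (Rmin 1 (Rmin (y - f x) (g x - y) / e))).
  assert (Cw : forall x y, continuity_2d_pt w x y).
  { intros x y. unfold w. cont2; auto. }
  assert (Bw : forall x y, 0 <= w x y <= 1).
  { intros x y. unfold w. split; [apply Rmax_l|]. apply Rmax_lub; [lra|apply Rmin_l]. }
  destruct (continuity_ab_maj g a b) as [x1 [Mg _]]; [lra|intros; apply continuity_pt_filterlim, Cg|].
  destruct (continuity_ab_maj (fun x => - f x) a b) as [x2 [Mf _]];
    [lra|intros; apply continuity_pt_filterlim, (continuous_opp f), Cf|].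
  set (C := f x2). set (D := g x1).
  assert (HCD : forall x, a <= x <= b -> C <= f x /\ g x <= D).
  { intros x Hx. specialize (Mg x Hx). specialize (Mf x Hx). unfold C, D. lra. }
  assert (HCD' : C <= D) by (generalize (HCD a) (Hfg a); lra).
  assert (Ub : int (fun x => int (w x) C D) a b <= 1 * l).
  { apply (cover_bound w a b C D 1 l p q u v); auto; try lra.
    - intros x y _ _. apply Bw.
    - intros x y Hx Hy Hw. apply Hcov.
      assert (Hpos : 0 < Rmin (y - f x) (g x - y)).
      { destruct (Rlt_dec 0 (Rmin (y - f x) (g x - y))) as [h|h]; [exact h|]. exfalso.
        unfold w in Hw. rewrite Rmax_left in Hw; [lra|]. eapply Rle_trans; [apply Rmin_r|].
        apply Rle_div_l; lra. }
      assert (H1 := Rlt_le_trans _ _ _ Hpos (Rmin_l _ _)). assert (H2 := Rlt_le_trans _ _ _ Hpos (Rmin_r _ _)).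
      apply HE; [|lra].
      destruct (Req_dec x a) as [->|]; [lra|]. destruct (Req_dec x b) as [->|]; lra. }
  assert (Lb : forall x, a <= x <= b -> g x - f x - 2 * e <= int (w x) C D).
  { intros x Hx. destruct (HCD x Hx) as [C1 C2].
    assert (Ew : forall c d, ex_RInt (w x) c d) by (intros; apply ex_int_section, Cw).
    assert (Pw : forall c d, c <= d -> 0 <= int (w x) c d).
    { intros c d Hcd. apply (RInt_ge_0 (w x)); auto. intros y _. apply Bw. }
    destruct (Rle_dec (f x + e) (g x - e)) as [h|h].
    - rewrite (int_Chasles (w x) C (f x + e) D), (int_Chasles (w x) (f x + e) (g x - e) D) by auto.
      assert (I1 := Pw C (f x + e) ltac:(lra)). assert (I2 := Pw (g x - e) D ltac:(lra)).
      assert (I3 : int (w x) (f x + e) (g x - e) = g x - e - (f x + e)).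
      { rewrite (int_ext _ (fun _ => 1)); [rewrite int_const; ring|exact h|]. intros y Hy. unfold w.
        assert (1 <= Rmin (y - f x) (g x - y) / e).
        { apply Rle_div_r; [exact He|]. apply Rmin_glb; lra. }
        rewrite Rmin_left by assumption. apply Rmax_right; lra. }
      lra.
    - assert (I1 := Pw C D HCD'). lra. }
  assert (Lb2 : int (fun x => g x - f x) a b - e0 <= int (fun x => int (w x) C D) a b).
  { assert (Cgf : forall x, continuous (fun x => g x - f x) x) by (intros; cont1; auto).
    replace (int (fun x => g x - f x) a b - e0) with (int (fun x => g x - f x - 2 * e) a b).
    - apply int_le; [lra| | |].
      + ex_int.
      + apply ex_int_row; (assumption || lra).
      + intros x Hx. apply Lb. lra.
    - rewrite (int_minus (fun x => g x - f x) (fun _ => 2 * e)), int_const.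
      + f_equal. unfold e. field. lra.
      + apply ex_int_cont, Cgf. + apply ex_int_const. }
  lra.
Qed.

End RegionBetweenGraphs.

Section EnclosedArea.

Context {P kmin : R} {X Y X1 Y1 k tau : R -> R}.
Context (H : oval P kmin X Y X1 Y1 k) (A : tangent_angle X1 Y1 k tau).

Lemma outer_measure_inside (m : R) :
  outer_measure_is lebesgue_w (inside X Y) m -> m = @area P X Y X1 Y1.
Proof.
  intros Hm. rewrite <- (int_upper_minus_lower H A). apply Rle_antisym.
  - apply (cover_of_region (lower H A) (upper H A) _ _ (lower_continuous H A) (upper_continuous H A)
      (x_min_lt_max H A) (lower_le_upper H A) (inside X Y)); [|exact Hm].
    intros x y. apply (inside_between H A).
  - apply (region_le_cover (lower H A) (upper H A) _ _ (lower_continuous H A) (upper_continuous H A)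
      (x_min_lt_max H A) (lower_le_upper H A) (inside X Y)); [| | |exact Hm].
    + apply (lower_eq_upper_min H A). lra.
    + apply (lower_eq_upper_max H A). lra.
    + intros x y. apply (between_inside H A).
Qed.

End EnclosedArea.

(** * Second variation along m-orbits *)

Section Dynamics.

Context {P kmin : R} {X Y X1 Y1 k tau : R -> R}.
Context (H : oval P kmin X Y X1 Y1 k) (A : tangent_angle X1 Y1 k tau).

Notation cr := (@cross_chord X Y X1 Y1).
Notation dt := (@dot_chord X Y X1 Y1).
Notation len := (Lchord X Y).
Notation slope := (@slope P X Y X1 Y1).
Notation dens := (@dens P X Y X1 Y1).
Notation reach := (reach H A).
Notation after_bounce := (bounce_pullback H A).
Notation phase_int := (@phase_int P).
Notation area := (@area P X Y X1 Y1).
Notation bounce := (bounce X Y X1 Y1).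

Let HP := oval_P H.

(** Reads the reflection law as a statement about the chord: at [y] the tangential component of the
    direction is [cos psi], and the normal component is reversed. *)
Lemma bounce_frame (x phi y psi : R) : bounce x phi y psi ->
  0 < len x y /\ cr x y = len x y * sin phi /\ dt x y = len x y * cos phi /\
  cr y x = len x y * sin psi /\ dt y x = - (len x y * cos psi).
Proof.
  intros (Hphi & Hpsi & Hne & (s & Hs & Ex & Ey & _) & R1 & R2).
  set (c := cos phi) in *. set (n := sin phi) in *. set (c' := cos psi) in *. set (n' := sin psi) in *.
  assert (Ux := oval_unit H x). assert (Uy := oval_unit H y).
  assert (Ec : c * c + n * n = 1) by (generalize (sin2_cos2 phi); unfold Rsqr, c, n; lra).
  set (vx := c * X1 x - n * Y1 x) in *. set (vy := c * Y1 x + n * X1 x) in *.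
  assert (V : vx * vx + vy * vy = 1).
  { transitivity ((c * c + n * n) * (X1 x * X1 x + Y1 x * Y1 x)); [unfold vx, vy; ring|rewrite Ec, Ux; ring]. }
  assert (Hl : len x y = s).
  { apply Rsqr_inj; [apply len_nonneg|lra|]. unfold Rsqr. rewrite len_sqr.
    replace (X y - X x) with (s * vx) by lra. replace (Y y - Y x) with (s * vy) by lra.
    transitivity (s * s * (vx * vx + vy * vy)); [ring|rewrite V; ring]. }
  rewrite Hl. unfold cross_chord, dot_chord.
  replace (X y - X x) with (s * vx) by lra. replace (Y y - Y x) with (s * vy) by lra.
  replace (X x - X y) with (- (s * vx)) by lra. replace (Y x - Y y) with (- (s * vy)) by lra.
  set (tx := X1 y) in *. set (ty := Y1 y) in *.
  assert (Q1 : vx * tx + vy * ty = c').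
  { replace c' with (c' * (tx * tx + ty * ty)) by (rewrite Uy; ring).
    transitivity ((c' * tx + n' * - ty) * tx + (c' * ty + n' * tx) * ty); [rewrite R1, R2; ring|ring]. }
  assert (Q2 : vx * ty - vy * tx = n').
  { replace n' with (n' * (tx * tx + ty * ty)) by (rewrite Uy; ring).
    transitivity (- (c' * tx + n' * - ty) * ty + (c' * ty + n' * tx) * tx + 2 * 0); [|ring].
    rewrite R1, R2. set (d := vx * - ty + vy * tx).
    replace (vx * ty - vy * tx) with (- d) by (unfold d; ring).
    transitivity (d * (2 * 1 - 1) - 2 * d + 0); [ring|].
    transitivity (d - 2 * d * (tx * tx + ty * ty)); [rewrite Uy; ring|unfold d; ring]. }
  split; [exact Hs|]. repeat split.
  - transitivity (s * n * (X1 x * X1 x + Y1 x * Y1 x)); [unfold vx, vy; ring|rewrite Ux; ring].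
  - transitivity (s * c * (X1 x * X1 x + Y1 x * Y1 x)); [unfold vx, vy; ring|rewrite Ux; ring].
  - rewrite <- Q2. ring.
  - rewrite <- Q1. ring.
Qed.

(** Lifts in a configuration are arbitrary modulo [P], so [y] agrees with the point given by [reach]
    up to a multiple of [P]. The reduced difference has slope [- cos phi], and [slope] is injective
    on a period. *)
Lemma bounce_reach (x phi y psi : R) : bounce x phi y psi ->
  exists n : Z, y = x + reach x (- cos phi) + IZR n * P /\
    - slope (x + reach x (- cos phi)) (P - reach x (- cos phi)) = - cos psi /\
    len x (x + reach x (- cos phi)) = len x y.
Proof.
  intros B. destruct (bounce_frame x phi y psi B) as (L & _ & B2 & _ & B4).
  destruct B as (_ & _ & Hne & _).
  destruct (reduce_mod P (y - x) HP) as [n Hn].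
  set (r := y - x + IZR n * P) in *.
  assert (Ey : x + r = y + IZR n * P) by (unfold r; ring).
  assert (Hr0 : r <> 0).
  { intros E. rewrite E, Rplus_0_r in Ey. apply Hne. rewrite Ey.
    rewrite (periodic_shift_Z X P n y (oval_pX H)), (periodic_shift_Z Y P n y (oval_pY H)). auto. }
  assert (E1 : dt x (x + r) = dt x y).
  { rewrite Ey. apply (periodic_shift_Z (dt x)). intros t. apply (dt_shift_r H). }
  assert (E2 : dt (x + r) x = dt y x).
  { rewrite Ey. apply (periodic_shift_Z (fun t => dt t x)). intros t. apply (dt_shift_l H). }
  assert (E3 : len x (x + r) = len x y).
  { rewrite Ey. apply (periodic_shift_Z (len x)). intros t. apply (len_shift_r H). }
  assert (E4 : slope x r = - cos phi).
  { rewrite slope_in by lra. rewrite E1, E3, B2. field. lra. }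
  rewrite <- E4, (reach_slope H A) by lra.
  exists (- n)%Z. split; [|split; [|exact E3]].
  - rewrite opp_IZR, Ey. ring.
  - rewrite slope_in by lra. replace (x + r + (P - r)) with (x + P) by ring.
    rewrite (dt_shift_r H), (len_shift_r H), E2, (len_sym (x + r)), E3, B4. field. lra.
Qed.

Lemma after_bounce_bounce (F : R -> R -> R) (x phi y psi : R) :
  (forall s u, F (s + P) u = F s u) -> bounce x phi y psi ->
  after_bounce F x (- cos phi) = F y (- cos psi).
Proof.
  intros PF B. destruct (bounce_reach x phi y psi B) as [n [E1 [E2 _]]].
  unfold bounce_pullback. rewrite E2, E1. symmetry.
  apply (periodic_shift_Z (fun s => F s (- cos psi))). auto.
Qed.

(** The Hessian of the chord length at a bounce, evaluated on [(al, be)]: mixed derivative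
    [sin phi sin psi / L], pure derivatives [sin^2 / L - k sin]. *)
Definition chord_variation (x phi y psi al be : R) : R :=
  (al * sin phi + be * sin psi) ^ 2 / len x y - k x * al ^ 2 * sin phi - k y * be ^ 2 * sin psi.

(** Mirrors the derivative clause of [m_config]: a first derivative near 0, a second one only at
    0. *)
Definition twice_derivable (f : R -> R) (l : R) : Prop :=
  exists eps d1, 0 < eps /\ (forall t, Rabs t < eps -> is_derive f t (d1 t)) /\ is_derive d1 0 l.

Lemma twice_derivable_plus (f g : R -> R) (l m : R) :
  twice_derivable f l -> twice_derivable g m -> twice_derivable (fun t => f t + g t) (l + m).
Proof.
  intros (e1 & d1 & He1 & D1 & D1') (e2 & d2 & He2 & D2 & D2').
  exists (Rmin e1 e2), (fun t => d1 t + d2 t). split; [apply Rmin_glb_lt; assumption|]. split.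
  - intros t Ht. apply (is_derive_plus f g).
    + apply D1. generalize (Rmin_l e1 e2). lra. + apply D2. generalize (Rmin_r e1 e2). lra.
  - apply (is_derive_plus d1 d2); assumption.
Qed.

Lemma chord_twice_derivable (x phi y psi al be : R) : bounce x phi y psi ->
  twice_derivable (fun t => len (x + t * al) (y + t * be)) (chord_variation x phi y psi al be).
Proof.
  intros B. destruct (bounce_frame x phi y psi B) as (L & B1 & B2 & B3 & B4).
  set (f := fun t => len (x + t * al) (y + t * be)).
  set (num := fun t => (X (x + t * al) - X (y + t * be)) * (al * X1 (x + t * al) - be * X1 (y + t * be)) +
                       (Y (x + t * al) - Y (y + t * be)) * (al * Y1 (x + t * al) - be * Y1 (y + t * be))).
  assert (Cf : continuous f 0).
  { unfold f. cont1. apply (len_continuity H). }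
  assert (F0 : f 0 = len x y) by (unfold f; rewrite !Rmult_0_l, !Rplus_0_r; reflexivity).
  destruct (positive_near f 0 Cf) as [e [He Pe]]; [rewrite F0; exact L|].
  exists e, (fun t => num t / f t). split; [exact He|].
  assert (Df : forall t, Rabs t < e -> is_derive f t (num t / f t)).
  { intros t Ht. assert (Pf : 0 < f t) by (apply Pe; rewrite Rminus_0_r; exact Ht).
    assert (Pq : 0 < (X (x + t * al) - X (y + t * be)) ^ 2 + (Y (x + t * al) - Y (y + t * be)) ^ 2).
    { assert (S := len_sqr (X := X) (Y := Y) (x + t * al) (y + t * be)). fold (f t) in S.
      apply Rlt_le_trans with (f t * f t); [apply Rmult_lt_0_compat; exact Pf|]. rewrite S. right. ring. }
    unfold f, num, Lchord in *. curve_derive H.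
    apply Rgt_not_eq in Pf.
    replace ((X (x + t * al) + - X (y + t * be)) * ((X (x + t * al) + - X (y + t * be)) * 1) +
        (Y (x + t * al) + - Y (y + t * be)) * ((Y (x + t * al) + - Y (y + t * be)) * 1))
    with ((X (x + t * al) - X (y + t * be)) ^ 2 + (Y (x + t * al) - Y (y + t * be)) ^ 2) by ring.
    field. exact Pf. }
  split; [exact Df|].
  assert (Dn : is_derive num 0 (al ^ 2 + be ^ 2 - 2 * al * be * (X1 x * X1 y + Y1 x * Y1 y)
     - k x * al ^ 2 * cr x y - k y * be ^ 2 * cr y x)).
  { rewrite <- (Rmult_1_r (al ^ 2)) at 1. rewrite <- (Rmult_1_r (be ^ 2)) at 1.
    rewrite <- (oval_unit H x) at 1. rewrite <- (oval_unit H y) at 1.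
    assert (Ex : x + 0 * al = x) by ring. assert (Ey : y + 0 * be = y) by ring.
    unfold num. curve_derive H. rewrite Ex, Ey. unfold cross_chord. ring. }
  assert (D0 := Df 0 ltac:(rewrite Rabs_R0; exact He)).
  assert (Dq := is_derive_div num f 0 _ _ Dn D0 ltac:(rewrite F0; lra)).
  eapply is_derive_eq; [exact Dq|].
  assert (N0 : num 0 = - (al * dt x y) - be * dt y x).
  { unfold num. rewrite !Rmult_0_l, !Rplus_0_r. unfold dot_chord. ring. }
  assert (T := @two_frames X Y X1 Y1 x y). rewrite B1, B2, B3, B4 in T.
  rewrite F0, N0, B1, B2, B3, B4. unfold chord_variation.
  set (l := len x y) in *. set (c := cos phi) in *. set (n := sin phi) in *.
  set (c' := cos psi) in *. set (n' := sin psi) in *.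
  assert (Ec : c * c = 1 - n * n) by (generalize (sin2_cos2 phi); unfold Rsqr, c, n; lra).
  assert (Ec' : c' * c' = 1 - n' * n') by (generalize (sin2_cos2 psi); unfold Rsqr, c', n'; lra).
  (* The tangents at the two ends enclose the angle [phi + psi]. *)
  assert (Et : X1 x * X1 y + Y1 x * Y1 y = c * c' - n * n').
  { apply (Rmult_eq_reg_r (l * l)); [|apply Rgt_not_eq, Rmult_lt_0_compat; exact L]. lra. }
  rewrite Et. apply Rminus_diag_uniq.
  transitivity ((al ^ 2 * (1 - n * n - c * c) + be ^ 2 * (1 - n' * n' - c' * c')) / l).
  - field. lra.
  - rewrite Ec, Ec'. field. lra.
Qed.

Lemma action_twice_derivable (xs phis xi : Z -> R) (n : nat) (M : Z) :
  billiard_config X Y X1 Y1 xs phis ->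
  twice_derivable
    (fun t => sumZ M n (fun j => len (xs j + t * xi j) (xs (j + 1)%Z + t * xi (j + 1)%Z)))
    (sumZ M n (fun j => chord_variation (xs j) (phis j) (xs (j + 1)%Z) (phis (j + 1)%Z) (xi j) (xi (j + 1)%Z))).
Proof.
  intros HB. revert M. induction n as [|n IH]; intros M; simpl.
  - exists 1, (fun _ => 0). split; [lra|]. split; intros; apply (is_derive_const (V := R_NormedModule) 0).
  - apply (twice_derivable_plus (fun t => len (xs M + t * xi M) (xs (M + 1)%Z + t * xi (M + 1)%Z))); [|apply IH].
    apply chord_twice_derivable, HB.
Qed.

Lemma twice_derivable_unique (f g' : R -> R) (eps l m : R) :
  twice_derivable f l -> 0 < eps ->
  (forall t, Rabs t < eps -> derivable_pt_lim f t (g' t)) -> derivable_pt_lim g' 0 m -> m = l.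
Proof.
  intros (e & d1 & He & D1 & D1') Heps Dg Dg'.
  apply is_derive_Reals in Dg'.
  assert (Hm : 0 < Rmin e eps) by (apply Rmin_glb_lt; assumption).
  assert (D2 : is_derive d1 0 m).
  { apply (is_derive_ext_loc g'); [|exact Dg']. exists (mkposreal _ Hm). intros t Ht.
    change (Rabs (t - 0) < Rmin e eps) in Ht. rewrite Rminus_0_r in Ht.
    assert (H1 := Rlt_le_trans _ _ _ Ht (Rmin_l _ _)). assert (H2 := Rlt_le_trans _ _ _ Ht (Rmin_r _ _)).
    apply Dg in H2. apply D1 in H1. apply is_derive_Reals in H1. apply (uniqueness_limite f t); assumption. }
  rewrite <- (is_derive_unique _ _ _ D2). apply is_derive_unique, D1'.
Qed.

Lemma m_config_variation (xs phis xi : Z -> R) (N : nat) :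
  billiard_config X Y X1 Y1 xs phis -> m_config X Y xs -> (0 < N)%nat ->
  xi 0%Z = 0 -> xi (Z.of_nat N) = 0 -> (exists n, (0 < n < Z.of_nat N)%Z /\ xi n <> 0) ->
  sumZ 0 N (fun j => chord_variation (xs j) (phis j) (xs (j + 1)%Z) (phis (j + 1)%Z) (xi j) (xi (j + 1)%Z)) < 0.
Proof.
  intros HB HM HN H0 H1 H2.
  destruct (HM 0%Z (Z.of_nat N) ltac:(lia) xi H0 H1 H2) as (eps & g' & c & He & D1 & D2 & Hc).
  rewrite <- (twice_derivable_unique _ g' eps _ c (action_twice_derivable xs phis xi N 0 HB) He); [exact Hc| |exact D2].
  intros t Ht. specialize (D1 t Ht). unfold action in D1.
  rewrite Z.sub_0_r, Nat2Z.id in D1. exact D1.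
Qed.

(** * Birkhoff sums of the linearized second variation *)

Variables (w : R -> R) (a K c : R).
Hypothesis Cw : forall s, continuous w s.
Hypothesis Pw : forall s, w (s + P) = w s.
Hypothesis Hw : forall s, 0 < w s.
(** [K] controls the two end terms created by cutting the variation off, while [c] bounds the
    summand on the whole phase space. *)
Hypothesis HK : forall s, k s * (w s * w s) <= K.
Hypothesis Hc : forall s, 2 * (2 * a * w s - k s * (w s * w s)) <= c.
Hypothesis Hc0 : 0 < c.

(* z^2 / l >= 2 a z - a^2 l linearizes the second variation for xi_n = w (x_n); [excess] is the
   resulting lower bound for the contribution of one chord. *)
Definition weight (s u : R) : R := (2 * a * w s - k s * (w s * w s)) * sqrt (1 - u * u).

Definition excess (s u : R) : R :=
  weight s u + after_bounce weight s u - a * a * len s (s + reach s u).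

Lemma weight_continuity (s u : R) : continuity_2d_pt weight s u.
Proof.
  unfold weight. cont2; first [apply Cw|apply (oval_ck H)].
Qed.

Lemma weight_shift (s u : R) : weight (s + P) u = weight s u.
Proof. unfold weight. rewrite Pw, (oval_pk H). reflexivity. Qed.

Lemma excess_continuity (s u : R) : continuity_2d_pt excess s u.
Proof.
  unfold excess. cont2; auto.
  - apply weight_continuity.
  - apply (after_bounce_continuity H A), weight_continuity.
  - apply (len_continuity H).
  - apply (reach_continuity H A).
Qed.

Lemma excess_shift (s u : R) : excess (s + P) u = excess s u.
Proof.
  unfold excess. rewrite weight_shift, (after_bounce_shift H A) by apply weight_shift.
  rewrite (reach_shift H A). replace (s + P + reach s u) with (s + reach s u + P) by ring.
  rewrite (len_shift_l H), (len_shift_r H). reflexivity.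
Qed.

Lemma weight_le (s u : R) : weight s u <= c / 2.
Proof.
  unfold weight. assert (S0 := sqrt_pos (1 - u * u)).
  assert (S1 : sqrt (1 - u * u) <= 1).
  { rewrite <- sqrt_1 at 2. apply sqrt_le_1_alt. generalize (Rle_0_sqr u). unfold Rsqr. lra. }
  specialize (Hc s). set (q := 2 * a * w s - k s * (w s * w s)) in *. nra.
Qed.

Lemma excess_le (s u : R) : excess s u <= c.
Proof.
  unfold excess, bounce_pullback.
  assert (T1 := weight_le s u).
  assert (T2 := weight_le (s + reach s u) (- slope (s + reach s u) (P - reach s u))).
  assert (T3 : 0 <= a * a * len s (s + reach s u)) by (apply Rmult_le_pos; [apply Rle_0_sqr|apply len_nonneg]).
  lra.
Qed.

Lemma chord_variation_ge (x phi y psi al be : R) : bounce x phi y psi ->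
  2 * a * (al * sin phi + be * sin psi) - a * a * len x y - k x * al ^ 2 * sin phi - k y * be ^ 2 * sin psi
  <= chord_variation x phi y psi al be.
Proof.
  intros B. destruct (bounce_frame x phi y psi B) as (L & _). unfold chord_variation.
  set (z := al * sin phi + be * sin psi). set (l := len x y) in *.
  assert (2 * a * z - a * a * l <= z ^ 2 / l).
  { apply Rminus_le_0. replace (z ^ 2 / l - (2 * a * z - a * a * l)) with ((z - a * l) * (z - a * l) / l) by (field; lra).
    apply Rdiv_le_0_compat; [apply Rle_0_sqr|exact L]. }
  lra.
Qed.

Lemma weight_cos (s phi : R) : 0 < phi < PI ->
  weight s (- cos phi) = (2 * a * w s - k s * (w s * w s)) * sin phi.
Proof.
  intros Hphi. unfold weight. f_equal.
  replace (1 - - cos phi * - cos phi) with (sin phi * sin phi)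
    by (generalize (sin2_cos2 phi); unfold Rsqr; lra).
  apply sqrt_square. left. apply sin_gt_0; lra.
Qed.

Lemma excess_bounce (x phi y psi : R) : bounce x phi y psi ->
  excess x (- cos phi) = (2 * a * w x - k x * (w x * w x)) * sin phi
    + (2 * a * w y - k y * (w y * w y)) * sin psi - a * a * len x y.
Proof.
  intros B. unfold excess. rewrite (after_bounce_bounce _ x phi y psi weight_shift B).
  destruct (bounce_reach x phi y psi B) as [n [_ [_ E]]]. rewrite E.
  destruct B as (B1 & B2 & _). rewrite !weight_cos by assumption. reflexivity.
Qed.

Lemma sumZ_last (f : Z -> R) (n : nat) (M : Z) : sumZ M (S n) f = sumZ M n f + f (M + Z.of_nat n)%Z.
Proof.
  revert M. induction n as [|n IH]; intros M.
  - simpl. rewrite Z.add_0_r. ring.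
  - change (sumZ M (S (S n)) f) with (f M + sumZ (M + 1) (S n) f). rewrite IH.
    change (sumZ M (S n) f) with (f M + sumZ (M + 1) n f).
    replace (M + 1 + Z.of_nat n)%Z with (M + Z.of_nat (S n))%Z by lia. ring.
Qed.

Lemma sumZ_le (f g : Z -> R) (n : nat) (M : Z) :
  (forall j, (M <= j < M + Z.of_nat n)%Z -> f j <= g j) -> sumZ M n f <= sumZ M n g.
Proof.
  revert M. induction n as [|n IH]; intros M Hfg; simpl; [lra|].
  apply Rplus_le_compat; [apply Hfg; lia|]. apply IH. intros j Hj. apply Hfg. lia.
Qed.

(* The test variation is w along the orbit segment, cut off at its ends. *)
Lemma excess_sum_bound (xs phis : Z -> R) (n : nat) :
  billiard_config X Y X1 Y1 xs phis -> m_config X Y xs ->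
  sumZ 1 (S n) (fun j => excess (xs j) (- cos (phis j))) <= 2 * K.
Proof.
  intros HB HM.
  (* With [N = n + 3] the variation lives on the vertices 1 to [n + 2]. Chords 1 to [n + 1] have
     both ends there and give the full terms; chords 0 and [n + 2] have one such end and contribute
     at least [- K] each. *)
  set (N := S (S (S n))).
  set (xi := fun j : Z => if Z_lt_dec 0 j then if Z_lt_dec j (Z.of_nat N) then w (xs j) else 0 else 0).
  assert (X0 : forall j, (j <= 0)%Z -> xi j = 0).
  { intros j Hj. unfold xi. destruct (Z_lt_dec 0 j); [lia|reflexivity]. }
  assert (XN : forall j, (Z.of_nat N <= j)%Z -> xi j = 0).
  { intros j Hj. unfold xi. destruct (Z_lt_dec 0 j); [|reflexivity]. destruct (Z_lt_dec j (Z.of_nat N)); [lia|reflexivity]. }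
  assert (XI : forall j, (0 < j < Z.of_nat N)%Z -> xi j = w (xs j)).
  { intros j Hj. unfold xi. destruct (Z_lt_dec 0 j); [|lia]. destruct (Z_lt_dec j (Z.of_nat N)); [reflexivity|lia]. }
  set (W := fun j => chord_variation (xs j) (phis j) (xs (j + 1)%Z) (phis (j + 1)%Z) (xi j) (xi (j + 1)%Z)).
  assert (Neg : sumZ 0 N W < 0).
  { apply (m_config_variation xs phis xi N HB HM); [unfold N; lia|apply X0; lia|apply XN; lia|].
    exists 1%Z. split; [unfold N; lia|]. rewrite (XI 1%Z); [apply Rgt_not_eq, Hw|]. unfold N. lia. }
  assert (Low : forall j, - (k (xs j) * xi j ^ 2) - k (xs (j + 1)%Z) * xi (j + 1)%Z ^ 2 <= W j).
  { intros j. assert (B := HB j). destruct (bounce_frame _ _ _ _ B) as (L & _).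
    destruct B as (B1 & B2 & _). unfold W, chord_variation.
    assert (S1 : sin (phis j) <= 1) by apply SIN_bound. assert (S2 : sin (phis (j + 1)%Z) <= 1) by apply SIN_bound.
    assert (0 <= (xi j * sin (phis j) + xi (j + 1)%Z * sin (phis (j + 1)%Z)) ^ 2 / len (xs j) (xs (j + 1)%Z))
      by (apply Rdiv_le_0_compat; [apply pow2_ge_0|exact L]).
    assert (Q1 : 0 <= k (xs j) * xi j ^ 2) by (apply Rmult_le_pos; [left; apply (kpos H)|apply pow2_ge_0]).
    assert (Q2 : 0 <= k (xs (j + 1)%Z) * xi (j + 1)%Z ^ 2) by (apply Rmult_le_pos; [left; apply (kpos H)|apply pow2_ge_0]).
    assert (k (xs j) * xi j ^ 2 * sin (phis j) <= k (xs j) * xi j ^ 2 * 1) by (apply Rmult_le_compat_l; assumption).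
    assert (k (xs (j + 1)%Z) * xi (j + 1)%Z ^ 2 * sin (phis (j + 1)%Z) <= k (xs (j + 1)%Z) * xi (j + 1)%Z ^ 2 * 1)
      by (apply Rmult_le_compat_l; assumption). lra. }
  assert (First : - K <= W 0%Z).
  { specialize (Low 0%Z). rewrite X0 in Low by lia. rewrite (XI (0 + 1)%Z) in Low by (unfold N; lia).
    specialize (HK (xs (0 + 1)%Z)). lra. }
  assert (Last : - K <= W (Z.of_nat (S (S n)))).
  { specialize (Low (Z.of_nat (S (S n)))). rewrite (XN (Z.of_nat (S (S n)) + 1)%Z) in Low by (unfold N; lia).
    rewrite XI in Low by (unfold N; lia). specialize (HK (xs (Z.of_nat (S (S n))))). lra. }
  assert (Mid : sumZ 1 (S n) (fun j => excess (xs j) (- cos (phis j))) <= sumZ 1 (S n) W).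
  { apply sumZ_le. intros j Hj. assert (B := HB j).
    rewrite (excess_bounce _ _ _ _ B). eapply Rle_trans; [|apply chord_variation_ge, B].
    rewrite !XI by (unfold N; lia). right. ring. }
  change (sumZ 0 N W) with (W 0%Z + sumZ (0 + 1) (S (S n)) W) in Neg.
  rewrite sumZ_last in Neg. replace (0 + 1 + Z.of_nat (S n))%Z with (Z.of_nat (S (S n))) in Neg by lia.
  change (0 + 1)%Z with 1%Z in Neg. lra.
Qed.

Fixpoint after_bounces (n : nat) (F : R -> R -> R) : R -> R -> R :=
  match n with O => F | S m => after_bounce (after_bounces m F) end.

Lemma after_bounces_continuity (n : nat) (F : R -> R -> R) :
  (forall s u, continuity_2d_pt F s u) -> forall s u, continuity_2d_pt (after_bounces n F) s u.
Proof. intros CF. induction n as [|n IH]; [exact CF|]. apply (after_bounce_continuity H A), IH. Qed.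

Lemma after_bounces_shift (n : nat) (F : R -> R -> R) :
  (forall s u, F (s + P) u = F s u) -> forall s u, after_bounces n F (s + P) u = after_bounces n F s u.
Proof. intros PF. induction n as [|n IH]; [exact PF|]. apply (after_bounce_shift H A), IH. Qed.

Lemma phase_int_after_bounces (n : nat) (F : R -> R -> R) :
  (forall s u, continuity_2d_pt F s u) -> (forall s u, F (s + P) u = F s u) ->
  phase_int (after_bounces n F) = phase_int F.
Proof.
  intros CF PF. induction n as [|n IH]; [reflexivity|]. simpl.
  rewrite (phase_int_after_bounce H A); [exact IH| |].
  - apply after_bounces_continuity, CF. - apply after_bounces_shift, PF.
Qed.

Lemma after_bounces_le (n : nat) (F : R -> R -> R) (m : R) :
  (forall s u, F s u <= m) -> forall s u, after_bounces n F s u <= m.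
Proof. intros HF. induction n as [|n IH]; [exact HF|]. intros s u. apply IH. Qed.

Lemma after_bounces_orbit (n : nat) (F : R -> R -> R) (xs phis : Z -> R) :
  (forall s u, F (s + P) u = F s u) -> billiard_config X Y X1 Y1 xs phis ->
  forall i : Z, after_bounces n F (xs i) (- cos (phis i)) =
    F (xs (i + Z.of_nat n)%Z) (- cos (phis (i + Z.of_nat n)%Z)).
Proof.
  intros PF HB. induction n as [|n IH]; intros i.
  - simpl. rewrite Z.add_0_r. reflexivity.
  - simpl after_bounces.
    rewrite (after_bounce_bounce _ _ _ _ _ (after_bounces_shift n F PF) (HB i)), IH.
    replace (i + 1 + Z.of_nat n)%Z with (i + Z.of_nat (S n))%Z by lia. reflexivity.
Qed.

(** On the edges [reach] is 0 or [P] and [u] is preserved, so the extended billiard map fixes each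
    point modulo the period. Edge points lie outside the phase space and a cover of [Delta_set] may
    miss them; hence the sums must be known there. *)
Lemma after_bounces_boundary (n : nat) (F : R -> R -> R) (s u : R) :
  (forall s u, F (s + P) u = F s u) -> u = -1 \/ u = 1 ->
  after_bounces n F s u = F s u.
Proof.
  intros PF Hu. revert s. induction n as [|n IH]; intros s; [reflexivity|]. simpl. unfold bounce_pullback.
  destruct Hu as [-> | ->].
  - rewrite (reach_lo H A). rewrite Rplus_0_r, Rminus_0_r, (slope_hi H s P (Rle_refl P)). apply IH.
  - rewrite (reach_hi H A), Rminus_diag, (slope_lo (s + P) 0 (Rle_refl 0)). replace (- (-1)) with 1 by ring. rewrite IH. apply PF.
Qed.

Lemma excess_boundary (s u : R) : u = -1 \/ u = 1 -> excess s u = 0.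
Proof.
  intros Hu.
  assert (W0 : forall s, weight s u = 0).
  { intros t. unfold weight. replace (1 - u * u) with 0 by (destruct Hu; subst u; ring). rewrite sqrt_0. ring. }
  assert (E := after_bounces_boundary 1 weight s u weight_shift Hu). simpl in E.
  unfold excess. rewrite E, !W0.
  assert (L0 : len s (s + reach s u) = 0).
  { assert (L : len s s = 0).
    { unfold Lchord. rewrite !Rminus_diag. replace (0 ^ 2 + 0 ^ 2) with 0 by ring. apply sqrt_0. }
    destruct Hu as [-> | ->].
    - rewrite (reach_lo H A), Rplus_0_r. exact L.
    - rewrite (reach_hi H A), (len_shift_r H). exact L. }
  rewrite L0. ring.
Qed.

(** Starts at the first iterate, because the cut-off variation vanishes at vertex 0 and full terms
    begin at vertex 1. *)
Definition excess_sum (n : nat) (s u : R) : R :=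
  sum_f_R0 (fun j => after_bounces (S j) excess s u) n.

Lemma excess_sum_continuity (n : nat) (s u : R) : continuity_2d_pt (excess_sum n) s u.
Proof.
  unfold excess_sum. induction n as [|n IH].
  - apply (after_bounces_continuity 1), excess_continuity.
  - apply (continuity_2d_pt_plus (fun s u => sum_f_R0 (fun j => after_bounces (S j) excess s u) n)
      (after_bounces (S (S n)) excess)); [exact IH|].
    apply after_bounces_continuity, excess_continuity.
Qed.

Lemma excess_sum_phase_int (n : nat) : phase_int (excess_sum n) = INR (S n) * phase_int excess.
Proof.
  induction n as [|n IH].
  - change (excess_sum 0) with (after_bounces 1 excess).
    rewrite phase_int_after_bounces by first [apply excess_continuity|apply excess_shift]. simpl. ring.
  - rewrite S_INR, Rmult_plus_distr_r, <- IH, Rmult_1_l.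
    rewrite <- (phase_int_after_bounces (S (S n)) excess excess_continuity excess_shift).
    assert (C1 := excess_sum_continuity n).
    assert (C2 := after_bounces_continuity (S (S n)) excess excess_continuity).
    unfold phase_int. rewrite <- int_plus by (apply ex_int_row; (assumption || lra)).
    apply int_ext; [lra|]. intros s _.
    apply (int_plus (excess_sum n s) (after_bounces (S (S n)) excess s));
    apply ex_int_cont; intros; apply continuity_2d_pt_section_r; auto.
Qed.

Lemma excess_sum_le (n : nat) (s u : R) : excess_sum n s u <= c * INR (S n).
Proof.
  unfold excess_sum. replace (c * INR (S n)) with (sum_f_R0 (fun _ => c) n) by (rewrite sum_cte; ring).
  apply sum_Rle. intros j _. apply after_bounces_le, excess_le.
Qed.

Lemma excess_sum_boundary (n : nat) (s u : R) : u = -1 \/ u = 1 -> excess_sum n s u = 0.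
Proof.
  intros Hu. unfold excess_sum. rewrite (sum_eq _ (fun _ => 0)); [rewrite sum_cte; ring|].
  intros j _. rewrite after_bounces_boundary by (auto using excess_shift). apply excess_boundary, Hu.
Qed.

Lemma excess_sum_m_orbit (n : nat) (x phi : R) :
  on_m_orbit P X Y X1 Y1 x phi -> excess_sum n x (- cos phi) <= 2 * K.
Proof.
  intros (xs & phis & HB & HM & [m E0] & E1).
  apply Rle_trans with (sumZ 1 (S n) (fun j => excess (xs j) (- cos (phis j)))); [|apply excess_sum_bound; assumption].
  right. unfold excess_sum.
  assert (Et : forall j, after_bounces (S j) excess x (- cos phi) =
    excess (xs (Z.of_nat (S j))) (- cos (phis (Z.of_nat (S j))))).
  { intros j. rewrite <- E1.
    rewrite <- (periodic_shift_Z (fun x => after_bounces (S j) excess x (- cos (phis 0%Z))) P m x)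
      by (intros; apply after_bounces_shift, excess_shift).
    rewrite <- E0. apply (after_bounces_orbit (S j) excess xs phis excess_shift HB 0%Z). }
  induction n as [|n IH].
  - simpl sum_f_R0. simpl sumZ. rewrite Rplus_0_r. apply (Et 0%nat).
  - rewrite tech5, IH, (sumZ_last _ (S n)), Et. f_equal.
    replace (1 + Z.of_nat (S n))%Z with (Z.of_nat (S (S n))) by lia. reflexivity.
Qed.

Lemma clampPI_mono (x y : R) : x <= y -> 0 <= clampPI x <= clampPI y /\ clampPI y <= PI.
Proof.
  intros Hxy. assert (Hpi := PI_RGT_0). unfold clampPI, Rmax, Rmin.
  destruct (Rle_dec x PI), (Rle_dec y PI);
  repeat match goal with |- context [Rle_dec 0 ?z] => destruct (Rle_dec 0 z) end; lra.
Qed.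

Lemma infinite_sum_cons (f : nat -> R) (l : R) :
  infinite_sum f l -> infinite_sum (fun i => match i with O => 0 | S j => f j end) l.
Proof.
  intros Hf eps He. destruct (Hf eps He) as [N HN]. exists (S N). intros n Hn.
  destruct n as [|n]; [lia|]. specialize (HN n ltac:(lia)).
  replace (sum_f_R0 (fun i => match i with O => 0 | S j => f j end) (S n)) with (sum_f_R0 f n); [exact HN|].
  clear. induction n as [|n IH]; [simpl; ring|]. rewrite tech5, IH, (tech5 _ (S n)). reflexivity.
Qed.

(** [cover_bound] is applied to [excess_sum n - 2 K], nonpositive on m-orbits and on the edges and
    at most [c (n + 1)] everywhere. By invariance the integral of the sum is also proportional to
    [n + 1], so dividing by [n + 1] removes the constant [4 P K] in the limit. *)
Lemma phase_int_excess_le_cover (p q u v : nat -> R) (l : R) :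
  rect_cover (Delta_set P X Y X1 Y1) p q u v ->
  infinite_sum (fun i => billiard_w (p i) (q i) (u i) (v i)) l ->
  phase_int excess <= c * l.
Proof.
  intros [Hord Hcov] Hsum. assert (Hpi := PI_RGT_0).
  (* Index 0 is reserved for the degenerate rectangle [s = P]: the phase space has [s] in [[0, P)],
     the integral runs over the closed interval. The others are the given rectangles in the
     coordinate [u = - cos phi], of area exactly [billiard_w]. *)
  set (p' := fun i => match i with O => P | S j => p j end).
  set (q' := fun i => match i with O => P | S j => q j end).
  set (u' := fun i => match i with O => -1 | S j => - cos (clampPI (u j)) end).
  set (v' := fun i => match i with O => 1 | S j => - cos (clampPI (v j)) end).
  assert (Main : forall n, INR (S n) * phase_int excess - 4 * P * K <= c * INR (S n) * l).
  { intros n.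
    assert (Hn : 0 < INR (S n)) by (apply lt_0_INR; lia).
    assert (Kpos : 0 <= K).
    { apply Rle_trans with (k 0 * (w 0 * w 0)); [|apply HK].
      apply Rmult_le_pos; [left; apply (kpos H)|]. generalize (Hw 0). nra. }
    set (g := fun s t => excess_sum n s t - 2 * K).
    assert (Cg : forall s t, continuity_2d_pt g s t).
    { intros s t. apply (continuity_2d_pt_minus (excess_sum n) (fun _ _ => 2 * K)); [apply excess_sum_continuity|cont2]. }
    assert (Ig : int (fun s => int (g s) (-1) 1) 0 P = INR (S n) * phase_int excess - 4 * P * K).
    { rewrite <- excess_sum_phase_int. unfold phase_int.
      assert (Cs := excess_sum_continuity n).
      replace (4 * P * K) with (int (fun _ => 4 * K) 0 P) by (rewrite int_const; ring).
      rewrite <- int_minus; [|apply ex_int_row; [exact Cs|lra]|apply ex_int_const].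
      apply int_ext; [lra|]. intros s _. unfold g.
      rewrite (int_minus (excess_sum n s) (fun _ => 2 * K)), int_const.
      - f_equal. ring.
      - apply ex_int_section, Cs.
      - apply ex_int_const. }
    rewrite <- Ig. apply (cover_bound g 0 P (-1) 1 (c * INR (S n)) l p' q' u' v'); auto; try lra.
    - apply Rmult_le_pos; lra.
    - intros s t _ _. unfold g. generalize (excess_sum_le n s t). lra.
    - intros [|j]; simpl; [lra|]. destruct (Hord j) as [O1 O2]. split; [exact O1|].
      destruct (clampPI_mono _ _ O2) as [M1 M2]. apply Ropp_le_contravar, cos_decr_1; lra.
    - intros s t Hs Ht Hg.
      destruct (Req_dec s P) as [->|Hs']; [exists 0%nat; simpl; lra|].
      assert (Ht' : -1 < t < 1).
      { split; [destruct (Req_dec t (-1)) as [E|E]|destruct (Req_dec t 1) as [E|E]]; try lra;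
        unfold g in Hg; rewrite excess_sum_boundary in Hg by auto; lra. }
      set (phi := acos (- t)).
      assert (Hphi : 0 < phi < PI) by (apply acos_bound_lt; lra).
      assert (Ecos : - cos phi = t) by (unfold phi; rewrite cos_acos by lra; ring).
      destruct (Hcov s phi) as [i [I1 I2]].
      { split; [split; lra|]. intros HM. apply (excess_sum_m_orbit n) in HM. unfold g in Hg. rewrite Ecos in HM. lra. }
      exists (S i). simpl. split; [exact I1|].
      assert (Ephi : clampPI phi = phi) by (unfold clampPI; rewrite Rmin_left, Rmax_right; lra).
      destruct (clampPI_mono _ _ (proj1 I2)) as [M1 M2]. destruct (clampPI_mono _ _ (proj2 I2)) as [M3 M4].
      rewrite Ephi in M1, M2, M3. rewrite <- Ecos.
      split; apply Ropp_le_contravar, cos_decr_1; lra.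
    - assert (S := infinite_sum_cons _ _ Hsum).
      intros eps He. destruct (S eps He) as [N HN]. exists N. intros j Hj. specialize (HN j Hj).
      rewrite (sum_eq _ (fun i => match i with O => 0 | S j => billiard_w (p j) (q j) (u j) (v j) end)); [exact HN|].
      intros [|i] _; simpl; [ring|]. unfold billiard_w. ring. }
  apply le_epsilon. intros e He.
  assert (HK0 : 0 <= K).
  { apply Rle_trans with (k 0 * (w 0 * w 0)); [|apply HK].
    apply Rmult_le_pos; [left; apply (kpos H)|]. generalize (Hw 0). nra. }
  destruct (archimed (4 * P * K / e)) as [Ar _].
  set (n := Z.to_nat (up (4 * P * K / e))).
  assert (Hn : 4 * P * K / e < INR (S n)).
  { assert (0 <= 4 * P * K / e) by (apply Rdiv_le_0_compat; [|exact He]; apply Rmult_le_pos; lra).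
    rewrite S_INR, INR_IZR_INZ. unfold n. rewrite Z2Nat.id; [lra|]. apply le_IZR. lra. }
  apply Rlt_div_l in Hn; [|exact He]. specialize (Main n).
  apply Rmult_le_reg_l with (INR (S n)); [apply lt_0_INR; lia|]. lra.
Qed.

(** [sqrt (1 - u * u)] integrates to [PI / 2], and the weight is counted twice because its pullback
    has the same integral; the length term is Santalo's formula. *)
Lemma phase_int_excess : phase_int excess =
  PI * int (fun s => 2 * a * w s - k s * (w s * w s)) 0 P - a * a * (2 * PI * area).
Proof.
  set (q := fun s => 2 * a * w s - k s * (w s * w s)).
  assert (Cq : forall s, continuous q s).
  { intros s. unfold q. cont1; first [apply Cw|apply (oval_ck H)]. }
  assert (Iw : phase_int weight = PI / 2 * int q 0 P).
  { unfold phase_int. rewrite <- int_scal by (apply ex_int_cont, Cq). apply int_ext; [lra|]. intros s _.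
    rewrite <- int_half_circle, (Rmult_comm _ (q s)). apply (int_scal (fun u => sqrt (1 - u * u)) (-1) 1 (q s)).
    ex_int. }
  set (ell := fun s u => len s (s + reach s u)).
  assert (Cl : forall s u, continuity_2d_pt ell s u).
  { intros s u. unfold ell. cont2; [apply (len_continuity H)|apply (reach_continuity H A)]. }
  assert (Il : phase_int ell = 2 * PI * area).
  { rewrite (phase_int_slope H A _ Cl), <- (int_len_dens H A).
    apply int_ext; [lra|]. intros s _. apply int_ext; [lra|]. intros r Hr. unfold ell.
    rewrite (reach_slope H A) by lra. reflexivity. }
  rewrite <- Il.
  assert (Ca := after_bounce_continuity H A weight weight_continuity).
  transitivity (phase_int weight + phase_int (after_bounce weight) - a * a * phase_int ell).
  - assert (Ex : forall F a b, (forall s u, continuity_2d_pt F s u) -> ex_RInt (fun s => int (F s) (-1) 1) a b).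
    { intros F a' b' CF. apply ex_int_row; [exact CF|lra]. }
    unfold phase_int. rewrite <- int_plus, <- int_scal, <- int_minus; auto.
    + apply int_ext; [lra|]. intros s _.
      assert (Es : forall F, (forall s u, continuity_2d_pt F s u) -> ex_RInt (F s) (-1) 1).
      { intros F CF. apply ex_int_section, CF. }
      unfold excess. rewrite <- (int_scal (ell s)), <- (int_plus (weight s)), <- (int_minus (fun x => weight s x + after_bounce weight s x)); auto.
      * apply (ex_RInt_plus (weight s) (after_bounce weight s)); auto using weight_continuity.
      * apply (ex_RInt_scal (ell s)). auto.
      * auto using weight_continuity.
    + apply (ex_RInt_plus (fun s => int (weight s) (-1) 1) (fun s => int (after_bounce weight s) (-1) 1)); auto using weight_continuity.
    + apply (ex_RInt_scal (fun s => int (ell s) (-1) 1)); auto.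
    + auto using weight_continuity.
  - rewrite (phase_int_after_bounce H A) by first [apply weight_continuity|apply weight_shift].
    rewrite Iw. field.
Qed.

Lemma defect_bound (m : R) : outer_measure_is billiard_w (Delta_set P X Y X1 Y1) m ->
  PI * int (fun s => 2 * a * w s - k s * (w s * w s)) 0 P - a * a * (2 * PI * area) <= c * m.
Proof.
  intros [_ Hm]. rewrite <- phase_int_excess.
  assert (T : phase_int excess / c <= m).
  { apply Hm. intros p q u v l Hcov Hsum. apply Rle_div_l; [exact Hc0|].
    rewrite Rmult_comm. eapply phase_int_excess_le_cover; eassumption. }
  apply Rle_div_l in T; [lra|exact Hc0].
Qed.

End Dynamics.

(** * The two estimates *)

Lemma periodic_derivative (f df : R -> R) (P : R) :
  (forall t, is_derive f t (df t)) -> (forall t, f (t + P) = f t) -> forall t, df (t + P) = df t.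
Proof.
  intros D Pf t. rewrite <- (is_derive_unique _ _ _ (D t)). symmetry. apply is_derive_unique.
  apply (is_derive_ext (fun t => f (t + P)) f); [exact Pf|].
  apply is_derive_eq with (1 * df (t + P)); [|ring].
  apply (is_derive_comp f (fun t => t + P)); [apply D|]. auto_derive; [exact I|ring].
Qed.

(** If the two reductions coincided, [t - s] would be an integer multiple of [P] strictly between 0
    and [P]. *)
Lemma simple_mod_period (X Y : R -> R) (P : R) :
  0 < P -> (forall t, X (t + P) = X t) -> (forall t, Y (t + P) = Y t) ->
  (forall s t, 0 <= s < P -> 0 <= t < P -> X s = X t -> Y s = Y t -> s = t) ->
  forall s t, s < t < s + P -> X s = X t -> Y s = Y t -> False.
Proof.
  intros HP PX PY Hs s t Hst EX EY.
  destruct (reduce_mod P s HP) as [n Hn]. destruct (reduce_mod P t HP) as [m Hm].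
  assert (E : s + IZR n * P = t + IZR m * P).
  { apply Hs; auto; rewrite !periodic_shift_Z; auto. }
  assert (E1 : t - s = IZR (n - m) * P) by (rewrite minus_IZR; lra).
  assert (L1 : IZR 0 < IZR (n - m)) by nra.
  assert (L2 : IZR (n - m) < IZR 1) by nra.
  apply lt_IZR in L1. apply lt_IZR in L2. lia.
Qed.

(** Differentiating the unit speed condition shows that the second derivative is orthogonal to the
    tangent, hence [curv] times the normal: Frenet's equations. Periodicity passes to all
    derivatives by induction. *)
Lemma curve_oval (P kmin : R) (Dx Dy : nat -> R -> R) :
  0 < P ->
  (forall n t, derivable_pt_lim (Dx n) t (Dx (S n) t)) ->
  (forall n t, derivable_pt_lim (Dy n) t (Dy (S n) t)) ->
  (forall t, Dx 0%nat (t + P) = Dx 0%nat t /\ Dy 0%nat (t + P) = Dy 0%nat t) ->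
  (forall s t, 0 <= s < P -> 0 <= t < P ->
     Dx 0%nat s = Dx 0%nat t -> Dy 0%nat s = Dy 0%nat t -> s = t) ->
  (forall t, Dx 1%nat t ^ 2 + Dy 1%nat t ^ 2 = 1) ->
  0 < kmin -> (forall t, kmin <= curv Dx Dy t) ->
  oval P kmin (Dx 0%nat) (Dy 0%nat) (Dx 1%nat) (Dy 1%nat) (curv Dx Dy).
Proof.
  intros HP DX DY Hper Hs Hu Hk0 Hk.
  assert (dX : forall n t, is_derive (Dx n) t (Dx (S n) t)) by (intros; apply is_derive_Reals, DX).
  assert (dY : forall n t, is_derive (Dy n) t (Dy (S n) t)) by (intros; apply is_derive_Reals, DY).
  assert (Pn : forall n t, Dx n (t + P) = Dx n t /\ Dy n (t + P) = Dy n t).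
  { induction n as [|n IH]; [exact Hper|]. intros t.
    split; [apply (periodic_derivative (Dx n))|apply (periodic_derivative (Dy n))]; auto; intros; apply IH. }
  assert (U : forall t, Dx 1%nat t * Dx 1%nat t + Dy 1%nat t * Dy 1%nat t = 1) by (intros t; specialize (Hu t); lra).
  assert (Orth : forall t, Dx 1%nat t * Dx 2%nat t + Dy 1%nat t * Dy 2%nat t = 0).
  { intros t.
    assert (D : is_derive (fun t => Dx 1%nat t * Dx 1%nat t + Dy 1%nat t * Dy 1%nat t) t
      (2 * (Dx 1%nat t * Dx 2%nat t + Dy 1%nat t * Dy 2%nat t))).
    { auto_derive; [repeat split|]; use_derivative (dX 1%nat); use_derivative (dY 1%nat). ring. }
    apply (is_derive_ext _ (fun _ => 1)) in D; [|exact U].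
    apply is_derive_unique in D. rewrite Derive_const in D. lra. }
  assert (C : forall n t, continuous (Dx n) t /\ continuous (Dy n) t).
  { intros n t. split; [apply (is_derive_continuous (dX n t))|apply (is_derive_continuous (dY n t))]. }
  constructor; auto.
  - intros t. apply is_derive_eq with (Dx 2%nat t); [apply dX|]. unfold curv.
    specialize (U t). specialize (Orth t).
    transitivity (Dx 2%nat t * (Dx 1%nat t * Dx 1%nat t + Dy 1%nat t * Dy 1%nat t)
      - Dx 1%nat t * (Dx 1%nat t * Dx 2%nat t + Dy 1%nat t * Dy 2%nat t)); [rewrite U, Orth|]; ring.
  - intros t. apply is_derive_eq with (Dy 2%nat t); [apply dY|]. unfold curv.
    specialize (U t). specialize (Orth t).
    transitivity (Dy 2%nat t * (Dx 1%nat t * Dx 1%nat t + Dy 1%nat t * Dy 1%nat t)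
      - Dy 1%nat t * (Dx 1%nat t * Dx 2%nat t + Dy 1%nat t * Dy 2%nat t)); [rewrite U, Orth|]; ring.
  - intros t. unfold curv. cont1; apply C.
  - intros t. apply Pn. - intros t. apply Pn. - intros t. apply Pn. - intros t. apply Pn.
  - intros t. unfold curv. rewrite !(proj1 (Pn _ t)), !(proj2 (Pn _ t)). reflexivity.
  - apply simple_mod_period; auto; intros t; apply Pn.
Qed.

Section Bounds.

Context {P kmin : R} {X Y X1 Y1 k tau : R -> R}.
Context (H : oval P kmin X Y X1 Y1 k) (A : tangent_angle X1 Y1 k tau).

Notation area := (@area P X Y X1 Y1).

Let HP := oval_P H.

Lemma total_curvature : int k 0 P = 2 * PI.
Proof.
  rewrite (int_derive_open tau k 0 P).
  - assert (T := turning H A 0). rewrite Rplus_0_l in T. lra.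
  - lra.
  - intros; apply (angle_derive A).
  - intros x _. apply (is_derive_continuous (angle_derive A x)).
  - intros; apply (oval_ck H).
Qed.

(** Cauchy-Schwarz against the total curvature, in the pointwise form [1 / k >= 2 la - la^2 k] with
    the optimal [la = P / (2 PI)], the mean radius of curvature in terms of direction. *)
Lemma total_radius : P ^ 2 / (2 * PI) <= int (fun s => / k s) 0 P.
Proof.
  assert (Hpi := PI_RGT_0).
  set (la := P / (2 * PI)).
  assert (Cl : forall s, continuous (fun s => la * la * k s) s).
  { intros s. cont1. apply (oval_ck H). }
  assert (E : int (fun s => 2 * la - la * la * k s) 0 P = P ^ 2 / (2 * PI)).
  { rewrite int_minus, int_const, int_scal, total_curvature.
    - unfold la. field. lra.
    - apply ex_int_cont, (oval_ck H).
    - apply ex_int_const.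
    - apply ex_int_cont, Cl. }
  rewrite <- E. apply int_le; [lra| | |].
  - apply ex_int_cont. intros s. cont1. apply (oval_ck H).
  - apply ex_int_cont. intros s. apply (continuous_Rinv_comp k); [apply (oval_ck H)|]. apply Rgt_not_eq, (kpos H).
  - intros s _. assert (K := kpos H s). apply Rminus_le_0.
    replace (/ k s - (2 * la - la * la * k s)) with ((1 - la * k s) * (1 - la * k s) / k s) by (field; lra).
    apply Rdiv_le_0_compat; [apply Rle_0_sqr|exact K].
Qed.

Variable m : R.
Hypothesis Hm : outer_measure_is billiard_w (Delta_set P X Y X1 Y1) m.

Lemma defect_perimeter : PI / 2 * (P - sqrt (4 * PI * area)) <= m.
Proof.
  assert (Hpi := PI_RGT_0). assert (Ha := area_pos H A). set (ar := area) in *.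
  assert (Hpa : 0 < 4 * PI * ar) by (apply Rmult_lt_0_compat; lra).
  set (q := sqrt (4 * PI * ar)).
  assert (Hq : 0 < q) by (apply sqrt_lt_R0, Hpa).
  assert (Eq : q * q = 4 * PI * ar) by (apply sqrt_sqrt; lra).
  (* This is [sqrt (PI / ar)], written through [q] so that [a q = 2 PI]. *)
  set (a := 2 * PI / q). assert (Ha0 : 0 < a) by (apply Rdiv_lt_0_compat; lra).
  assert (Eaa : a * a * ar = PI).
  { unfold a. replace (2 * PI / q * (2 * PI / q) * ar) with (4 * PI * PI * ar / (q * q)) by (field; lra).
    rewrite Eq. field. lra. }
  destruct (kmax_exists H) as [km [_ Hkm]].
  (* [c = 4 a] is admissible since [k > 0], and for [w = 1] the end terms are bounded by the largest
     curvature. *)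
  assert (B := defect_bound H A (fun _ => 1) a km (4 * a)).
  assert (B1 : PI * int (fun s => 2 * a * 1 - k s * (1 * 1)) 0 P - a * a * (2 * PI * ar) <= 4 * a * m).
  { apply B; auto.
    - intros; apply continuous_const. - intros; lra. - intros s. specialize (Hkm s). lra.
    - intros s. assert (K := kpos H s). lra. - lra. }
  rewrite int_minus, int_const, (int_ext (fun s => k s * (1 * 1)) k), total_curvature in B1.
  - assert (T : PI * (2 * a * P - 2 * PI) - 2 * PI * PI <= 4 * a * m).
    { replace (2 * PI * PI) with (a * a * (2 * PI * ar)); [lra|]. rewrite <- Eaa at 3. ring. }
    assert (Eaq : a * q = 2 * PI) by (unfold a; field; lra).
    apply Rmult_le_reg_l with (4 * a); [lra|].
    replace (4 * a * (PI / 2 * (P - q))) with (2 * PI * a * P - 2 * PI * (a * q)) by field. rewrite Eaq. lra.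
  - lra.
  - intros; ring.
  - apply ex_int_const.
  - apply ex_int_cont. intros s. cont1. apply (oval_ck H).
Qed.

Lemma defect_curvature : (P ^ 2 - 4 * PI * area) * kmin / 4 <= m.
Proof.
  assert (Hpi := PI_RGT_0). assert (Hk := oval_kmin H). set (ar := area).
  assert (Ci : forall s, continuous (fun s => / k s) s).
  { intros s. apply (continuous_Rinv_comp k); [apply (oval_ck H)|]. apply Rgt_not_eq, (kpos H). }
  assert (Eki : forall s, k s * (/ k s * / k s) = / k s).
  { intros s. field. apply Rgt_not_eq, (kpos H). }
  assert (Hki : forall s, / k s <= / kmin) by (intros s; apply Rinv_le_contravar; [exact Hk|apply (oval_k H)]).
  (* Here [k w^2] and [2 a w - k w^2] both reduce to [1 / k], which is at most [1 / kmin]; this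
     explains [K] and [c]. *)
  assert (B := defect_bound H A (fun s => / k s) 1 (/ kmin) (2 / kmin)).
  assert (B1 : PI * int (fun s => 2 * 1 * / k s - k s * (/ k s * / k s)) 0 P - 1 * 1 * (2 * PI * ar) <= 2 / kmin * m).
  { apply B; auto.
    - intros s. rewrite (oval_pk H). reflexivity.
    - intros s. apply Rinv_0_lt_compat, (kpos H).
    - intros s. rewrite Eki. apply Hki.
    - intros s. rewrite Eki. specialize (Hki s). unfold Rdiv. lra.
    - apply Rdiv_lt_0_compat; lra. }
  rewrite (int_ext _ (fun s => / k s)) in B1; [|lra|intros s _; rewrite Eki; ring].
  assert (R := total_radius).
  assert (T : PI * (P ^ 2 / (2 * PI)) <= PI * int (fun s => / k s) 0 P) by (apply Rmult_le_compat_l; lra).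
  replace (PI * (P ^ 2 / (2 * PI))) with (P ^ 2 / 2) in T by (field; lra).
  assert (T2 : P ^ 2 / 2 - 2 * PI * ar <= 2 / kmin * m) by lra.
  apply Rmult_le_reg_l with (2 / kmin); [apply Rdiv_lt_0_compat; lra|].
  replace (2 / kmin * ((P ^ 2 - 4 * PI * ar) * kmin / 4)) with (P ^ 2 / 2 - 2 * PI * ar) by (field; lra). exact T2.
Qed.

End Bounds.

Theorem theorem1p1
  (P : R) (Dx Dy : nat -> R -> R) (A muDelta delta kmin : R) :
  0 < P ->
  (* gamma = (Dx 0, Dy 0) is smooth: Dx n, Dy n are its successive derivatives *)
  (forall (n : nat) (t : R), derivable_pt_lim (Dx n) t (Dx (S n) t)) ->
  (forall (n : nat) (t : R), derivable_pt_lim (Dy n) t (Dy (S n) t)) ->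
  (* closed, P-periodic *)
  (forall t, Dx 0%nat (t + P) = Dx 0%nat t /\ Dy 0%nat (t + P) = Dy 0%nat t) ->
  (* simple *)
  (forall s t, 0 <= s < P -> 0 <= t < P ->
     Dx 0%nat s = Dx 0%nat t -> Dy 0%nat s = Dy 0%nat t -> s = t) ->
  (* arclength parametrization, so P is the length *)
  (forall t, Dx 1%nat t ^ 2 + Dy 1%nat t ^ 2 = 1) ->
  (* positive curvature (positively oriented, strictly convex) *)
  (forall t, 0 < curv Dx Dy t) ->
  (* kmin = min curvature *)
  (forall t, kmin <= curv Dx Dy t) -> (exists t, curv Dx Dy t = kmin) ->
  (* A = enclosed area *)
  outer_measure_is lebesgue_w (inside (Dx 0%nat) (Dy 0%nat)) A ->
  (* muDelta = mu(Delta_set), delta = mu(Delta_set)/mu(Omega_set) with mu(Omega_set) = 2P *)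
  outer_measure_is billiard_w
    (Delta_set P (Dx 0%nat) (Dy 0%nat) (Dx 1%nat) (Dy 1%nat)) muDelta ->
  delta = muDelta / (2 * P) ->
  PI * (P ^ 2 - 4 * PI * A) / (4 * P * (P + sqrt (4 * PI * A))) <= delta /\
  PI * (P ^ 2 - 4 * PI * A) / (8 * P ^ 2)
    <= PI * (P ^ 2 - 4 * PI * A) / (4 * P * (P + sqrt (4 * PI * A))) /\
  (P ^ 2 - 4 * PI * A) * kmin / (8 * P) <= delta.
Proof.
  intros HP DX DY Hper Hs Hu Hkpos Hk [t0 Ht0] HA Hmu Hdelta.
  assert (Hk0 : 0 < kmin) by (rewrite <- Ht0; apply Hkpos).
  assert (O := curve_oval P kmin Dx Dy HP DX DY Hper Hs Hu Hk0 Hk).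
  destruct (tangent_angle_exists O) as [tau T].
  assert (EA := outer_measure_inside O T A HA).
  assert (B1 := defect_perimeter O T muDelta Hmu). assert (B2 := defect_curvature O T muDelta Hmu).
  assert (Iso := isoperimetric O T). assert (Ap := area_pos O T).
  rewrite <- EA in B1, B2, Iso, Ap. assert (Hpi := PI_RGT_0).
  assert (Hpa : 0 < 4 * PI * A) by (apply Rmult_lt_0_compat; lra).
  set (q := sqrt (4 * PI * A)) in *.
  assert (Hq : 0 < q) by (apply sqrt_lt_R0, Hpa).
  assert (Eq : q * q = 4 * PI * A) by (apply sqrt_sqrt; lra).
  (* The isoperimetric inequality; it gives [P + q <= 2 P], which compares the first two lower
     bounds. *)
  assert (HqP : q <= P) by (apply Rsqr_incr_0; unfold Rsqr; lra).
  rewrite <- Eq. rewrite <- Eq in B2. rewrite Hdelta. split; [|split].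
  (* The factor [P + q] cancels because [P^2 - q^2 = (P - q) (P + q)]. *)
  - replace (PI * (P ^ 2 - q * q) / (4 * P * (P + q))) with (PI / 2 * (P - q) / (2 * P)) by (field; lra).
    apply Rmult_le_compat_r; [left; apply Rinv_0_lt_compat; lra|exact B1].
  - apply Rmult_le_compat_l; [apply Rmult_le_pos; nra|].
    apply Rinv_le_contravar; [apply Rmult_lt_0_compat; nra|nra].
  - replace ((P ^ 2 - q * q) * kmin / (8 * P)) with ((P ^ 2 - q * q) * kmin / 4 / (2 * P)) by (field; lra).
    apply Rmult_le_compat_r; [left; apply Rinv_0_lt_compat; lra|exact B2].
Qed.
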